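(* Let $\Lambda$ be an artin algebra and let $\mathcal{M}$ be an $n$-cluster tilting subcategory of $\mathrm{mod}\text{-}\Lambda$, where $n\geq 2$. Then there exists the equivalence $$\underline{\widetilde{\mathcal{P}}^{\leqslant 1}(\mathcal{M})}\simeq\underline{\widetilde{\mathcal{P}}^{\leqslant 1}(\mathcal{M}^{\mathrm{op}})}.$$ In particular, by using the duality $D:\mathcal{M}\text{-}\mathrm{mod}\to\mathrm{mod}\text{-}\mathcal{M}$, we get the equivalence $$\underline{\widetilde{\mathcal{P}}^{\leqslant 1}(\mathcal{M})}\simeq\overline{\widetilde{\mathcal{I}}^{\leqslant 1}(\mathcal{M})},$$ where $\widetilde{\mathcal{I}}^{\leqslant 1}(\mathcal{M})$ denotes the subcategory of $\mathrm{mod}\text{-}\mathcal{M}$ consisting of all functors of injective dimension at most $1$.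
   Context: $\mathrm{mod}\text{-}\Lambda$ is the category of finitely presented (equivalently, finitely generated) $\Lambda$-modules; all subcategories are full. A full additive subcategory $\mathcal{M}$ of $\mathrm{mod}\text{-}\Lambda$ is $n$-cluster tilting if it is functorially finite (every module has a right and a left $\mathcal{M}$-approximation), generating-cogenerating (every module is a quotient of an object of $\mathcal{M}$ and embeds in an object of $\mathcal{M}$), and $$\mathcal{M}=\{A: \mathrm{Ext}^i_\Lambda(\mathcal{M},A)=0,\ 0<i<n\}=\{A: \mathrm{Ext}^i_\Lambda(A,\mathcal{M})=0,\ 0<i<n\}.$$ $\mathrm{mod}\text{-}\mathcal{M}$ (resp. $\mathcal{M}\text{-}\mathrm{mod}$) is the abelian category of finitely presented additive contravariant (resp. covariant) functors from $\mathcal{M}$ to the category of abelian groups, and $D:\mathcal{M}\text{-}\mathrm{mod}\to\mathrm{mod}\text{-}\mathcal{M}$ is the duality induced by the standard duality of finitely generated modules over the commutative artinian base ring of $\Lambda$. $\widetilde{\mathcal{P}}^{\leqslant 1}(\mathcal{M})$ (resp. $\widetilde{\mathcal{P}}^{\leqslant 1}(\mathcal{M}^{\mathrm{op}})$) is the full subcategory of $\mathrm{mod}\text{-}\mathcal{M}$ (resp. $\mathcal{M}\text{-}\mathrm{mod}$) of functors of projective dimension at most one. An underline denotes the stable category, i.e. the quotient by the ideal of morphisms factoring through projective objects of $\mathrm{mod}\text{-}\mathcal{M}$ (resp. $\mathcal{M}\text{-}\mathrm{mod}$); $\overline{\widetilde{\mathcal{I}}^{\leqslant 1}(\mathcal{M})}$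 is the quotient by the ideal of morphisms factoring through injective objects of $\mathrm{mod}\text{-}\mathcal{M}$.
   Formalization: The first equivalence is proved as a contravariant one (a duality, with the opposite category on the right), since a covariant equivalence fails in general (n=2, preprojective algebra of type A_3); the second is an ordinary covariant equivalence. *)

(* Defs.v *)
From HB Require Import structures.
From mathcomp Require Import all_boot all_algebra.
From mathcomp Require Import boolp.

Set Implicit Arguments.
Unset Strict Implicit.
Unset Printing Implicit Defensive.

Import GRing.Theory.
Local Open Scope ring_scope.

(* Categories whose morphism sets carry an explicit equality [eqm]. Quotienting
   a category by an ideal then amounts to keeping the objects and morphisms and
   enlarging [eqm]. *)
Record category := Category {
  obj :> Type;
  mor : obj -> obj -> Type;
  eqm : forall X Y, mor X Y -> mor X Y -> Prop;
  eqm_refl : forall X Y (f : mor X Y), eqm f f;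
  eqm_sym : forall X Y (f g : mor X Y), eqm f g -> eqm g f;
  eqm_trans : forall X Y (f g h : mor X Y), eqm f g -> eqm g h -> eqm f h;
  idm : forall X, mor X X;
  compm : forall X Y Z, mor Y Z -> mor X Y -> mor X Z;
  eqm_comp : forall X Y Z (g g' : mor Y Z) (f f' : mor X Y),
    eqm g g' -> eqm f f' -> eqm (compm g f) (compm g' f');
  compmA : forall W X Y Z (h : mor Y Z) (g : mor X Y) (f : mor W X),
    eqm (compm h (compm g f)) (compm (compm h g) f);
  comp1m : forall X Y (f : mor X Y), eqm (compm (idm Y) f) f;
  compm1 : forall X Y (f : mor X Y), eqm (compm f (idm X)) f
}.

Definition opcat (C : category) : category :=
  @Category C (fun X Y => mor Y X) (fun X Y => @eqm C Y X)
    (fun X Y => @eqm_refl C Y X) (fun X Y => @eqm_sym C Y X)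
    (fun X Y => @eqm_trans C Y X) (@idm C) (fun X Y Z g f => compm f g)
    (fun X Y Z g g' f f' eg ef => eqm_comp ef eg)
    (fun W X Y Z h g f => eqm_sym (compmA f g h))
    (fun X Y f => compm1 f) (fun X Y f => comp1m f).

Definition epi (C : category) (X Y : C) (e : mor X Y) :=
  forall (Z : C) (g h : mor Y Z), eqm (compm g e) (compm h e) -> eqm g h.

Definition mono (C : category) (X Y : C) (m : mor X Y) :=
  forall (Z : C) (g h : mor Z X), eqm (compm m g) (compm m h) -> eqm g h.

Definition projective (C : category) (P : C) :=
  forall (X Y : C) (e : mor X Y), epi e ->
  forall f : mor P Y, exists g : mor P X, eqm (compm e g) f.

Definition injective_obj (C : category) (I : C) :=
  forall (X Y : C) (m : mor X Y), mono m ->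
  forall f : mor X I, exists g : mor Y I, eqm (compm g m) f.

Definition is_iso (C : category) (X Y : C) (f : mor X Y) :=
  exists g : mor Y X, eqm (compm g f) (idm X) /\ eqm (compm f g) (idm Y).

Record functor (C D : category) := Functor {
  fobj :> C -> D;
  fmor : forall X Y, mor X Y -> mor (fobj X) (fobj Y);
  fmor_eqm : forall X Y (f g : mor X Y), eqm f g -> eqm (fmor f) (fmor g);
  fmor_id : forall X, eqm (fmor (idm X)) (idm (fobj X));
  fmor_comp : forall X Y Z (g : mor Y Z) (f : mor X Y),
    eqm (fmor (compm g f)) (compm (fmor g) (fmor f))
}.

Definition idfunctor (C : category) : functor C C :=
  @Functor C C id (fun X Y f => f) (fun X Y f g e => e)
    (fun X => eqm_refl (idm X)) (fun X Y Z g f => eqm_refl (compm g f)).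

Definition compfunctor (C D E : category) (G : functor D E) (F : functor C D) :
    functor C E :=
  @Functor C E (fun X => G (F X)) (fun X Y f => fmor G (fmor F f))
    (fun X Y f g e => fmor_eqm G (fmor_eqm F e))
    (fun X => eqm_trans (fmor_eqm G (fmor_id F X)) (fmor_id G (F X)))
    (fun X Y Z g f => eqm_trans (fmor_eqm G (fmor_comp F g f))
       (fmor_comp G (fmor F g) (fmor F f))).

Definition naturally_isomorphic (C D : category) (F G : functor C D) :=
  exists a : forall X, mor (F X) (G X),
    (forall X, is_iso (a X)) /\
    (forall X Y (f : mor X Y),
       eqm (compm (fmor G f) (a X)) (compm (a Y) (fmor F f))).

Definition equivalent (C D : category) :=
  exists (F : functor C D) (G : functor D C),
    naturally_isomorphic (compfunctor G F) (idfunctor C) /\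
    naturally_isomorphic (compfunctor F G) (idfunctor D).

(* Additive categories. Their morphism groups are zmodTypes, so that they can
   be values of functors; the categories of functors below need larger
   morphism sets, hence the separate structure [category]. *)
Record addcat := Addcat {
  aob :> Type;
  hom : aob -> aob -> zmodType;
  aid : forall X, hom X X;
  acomp : forall X Y Z, hom Y Z -> hom X Y -> hom X Z;
  acompA : forall W X Y Z (h : hom Y Z) (g : hom X Y) (f : hom W X),
    acomp h (acomp g f) = acomp (acomp h g) f;
  acomp1m : forall X Y (f : hom X Y), acomp (aid Y) f = f;
  acompm1 : forall X Y (f : hom X Y), acomp f (aid X) = f;
  acompDl : forall X Y Z (g g' : hom Y Z) (f : hom X Y),
    acomp (g + g') f = acomp g f + acomp g' f;
  acompDr : forall X Y Z (g : hom Y Z) (f f' : hom X Y),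
    acomp g (f + f') = acomp g f + acomp g f';
  azero : exists Z, aid Z = 0;
  abiprod : forall X Y, exists (S : aob) (i1 : hom X S) (i2 : hom Y S)
      (p1 : hom S X) (p2 : hom S Y),
    [/\ acomp p1 i1 = aid X, acomp p2 i2 = aid Y, acomp p1 i2 = 0,
        acomp p2 i1 = 0 & acomp i1 p1 + acomp i2 p2 = aid S]
}.

Section Opposite.
Variable C : addcat.

Lemma op_abiprod (X Y : C) : exists (S : C) (i1 : hom S X) (i2 : hom S Y)
    (p1 : hom X S) (p2 : hom Y S),
  [/\ acomp i1 p1 = aid X, acomp i2 p2 = aid Y, acomp i2 p1 = 0,
      acomp i1 p2 = 0 & acomp p1 i1 + acomp p2 i2 = aid S].
Proof.
have [S [i1 [i2 [p1 [p2 [*]]]]]] := abiprod X Y.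
by exists S, p1, p2, i1, i2.
Qed.

Definition opaddcat : addcat :=
  @Addcat C (fun X Y => hom Y X) (@aid C) (fun X Y Z g f => acomp f g)
    (fun W X Y Z h g f => esym (acompA f g h))
    (fun X Y f => acompm1 f) (fun X Y f => acomp1m f)
    (fun X Y Z g g' f => acompDr f g g') (fun X Y Z g f f' => acompDl f f' g)
    (azero C) op_abiprod.

End Opposite.

(* Additive functors from C^op to abelian groups. *)
Record abfun (C : addcat) := Abfun {
  fun_ob :> C -> zmodType;
  fun_map : forall X Y : C, hom X Y -> {additive fun_ob Y -> fun_ob X};
  fun_map1 : forall (X : C) x, fun_map (aid X) x = x;
  fun_mapM : forall (X Y Z : C) (g : hom Y Z) (f : hom X Y) x,
    fun_map (acomp g f) x = fun_map f (fun_map g x);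
  fun_mapD : forall (X Y : C) (f g : hom X Y) x,
    fun_map (f + g) x = fun_map f x + fun_map g x
}.

Record nattrans (C : addcat) (F G : abfun C) := Nattrans {
  nt_map :> forall X : C, {additive F X -> G X};
  nt_natural : forall (X Y : C) (f : hom X Y) x,
    nt_map X (fun_map F f x) = fun_map G f (nt_map Y x)
}.

Section Representable.
Variables (C : addcat) (X : C).

Definition precomp (Y Z : C) (f : hom Y Z) : hom Z X -> hom Y X :=
  fun h => acomp h f.

Lemma precomp_nmod_morphism (Y Z : C) (f : hom Y Z) : nmod_morphism (precomp f).
Proof.
split=> [|g h]; last exact: acompDl.
by apply: (addrI (acomp 0 f)); rewrite -acompDl !addr0.
Qed.

HB.instance Definition _ (Y Z : C) (f : hom Y Z) :=
  GRing.isNmodMorphism.Build _ _ (precomp f) (precomp_nmod_morphism f).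

Definition representable : abfun C :=
  @Abfun C (fun Y => hom Y X) (fun Y Z f => precomp f)
    (fun Y h => acompm1 h) (fun Y Z W g f h => acompA h g f)
    (fun Y Z f g h => acompDr h f g).

End Representable.

Section PointwiseExactness.
Variables (C : addcat) (F G H : abfun C).

Definition nt_injective (f : nattrans F G) := forall X x y, f X x = f X y -> x = y.

Definition nt_surjective (f : nattrans F G) := forall X y, exists x, f X x = y.

Definition nt_exact (f : nattrans F G) (g : nattrans G H) :=
  forall X y, g X y = 0 <-> exists x, f X x = y.

End PointwiseExactness.

Definition finitely_presented (C : addcat) (F : abfun C) :=
  exists (X1 X0 : C) (p : nattrans (representable X1) (representable X0))
    (q : nattrans (representable X0) F), nt_exact p q /\ nt_surjective q.

Record fpfun (C : addcat) := Fpfun {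
  fpf :> abfun C;
  fpfP : finitely_presented fpf
}.

Section FunctorCategory.
Variable C : addcat.

Definition nt_id (F : abfun C) : nattrans F F :=
  @Nattrans C F F (fun X => idfun) (fun X Y f x => erefl).

Lemma nt_comp_natural (F G H : abfun C) (b : nattrans G H) (a : nattrans F G)
    (X Y : C) (f : hom X Y) x :
  b X (a X (fun_map F f x)) = fun_map H f (b Y (a Y x)).
Proof. by rewrite !nt_natural. Qed.

Definition nt_comp (F G H : abfun C) (b : nattrans G H) (a : nattrans F G) :
    nattrans F H :=
  @Nattrans C F H (fun X => b X \o a X) (nt_comp_natural b a).

Definition nt_eq (F G : abfun C) (a b : nattrans F G) := forall X x, a X x = b X x.

(* mod-C; the covariant functors C-mod are obtained as mod-(opaddcat C). *)
Definition modcat : category.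
Proof.
refine (@Category (fpfun C) (fun F G => nattrans F G) (fun F G => @nt_eq F G)
  _ _ _ (fun F => nt_id F) (fun F G H b a => nt_comp b a) _ _ _ _).
- by move=> F G f X x.
- by move=> F G f g e X x; rewrite e.
- by move=> F G f g h e e' X x; rewrite e e'.
- by move=> F G H g g' f f' e e' X x /=; rewrite e e'.
- by [].
- by [].
- by [].
Defined.

(* When C has weak kernels, mod-C is abelian and its exact sequences are the
   pointwise exact ones. *)
Definition pd_le1 (F : modcat) :=
  exists (P1 P0 : modcat) (i : mor P1 P0) (p : mor P0 F),
    [/\ projective P1, projective P0, nt_injective i, nt_exact i p
      & nt_surjective p].

Definition id_le1 (F : modcat) :=
  exists (I0 I1 : modcat) (i : mor F I0) (p : mor I0 I1),
    [/\ injective_obj I0, injective_obj I1, nt_injective i, nt_exact i p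
      & nt_surjective p].

Definition eq_mod (Q : modcat -> Prop) (F G : modcat) (f g : mor F G) :=
  exists (Z : modcat) (a : mor F Z) (b : mor Z G),
    Q Z /\ forall X x, f X x - g X x = b X (a X x).

Lemma nt_zero_natural (F G : abfun C) (X Y : C) (f : hom X Y) x :
  (\0 : F X -> G X) (fun_map F f x) = fun_map G f ((\0 : F Y -> G Y) x).
Proof. by rewrite /= raddf0. Qed.

Definition nt_zero (F G : abfun C) : nattrans F G :=
  @Nattrans C F G (fun X => \0 : F X -> G X) (@nt_zero_natural F G).

Lemma nt_opp_natural (F G : abfun C) (a : nattrans F G) (X Y : C) (f : hom X Y) x :
  (\- a X) (fun_map F f x) = fun_map G f ((\- a Y) x).
Proof. by rewrite /= nt_natural raddfN. Qed.

Definition nt_opp (F G : abfun C) (a : nattrans F G) : nattrans F G :=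
  @Nattrans C F G (fun X => \- a X) (nt_opp_natural a).

Lemma nt_add_natural (F G : abfun C) (a b : nattrans F G) (X Y : C) (f : hom X Y) x :
  (a X \+ b X) (fun_map F f x) = fun_map G f ((a Y \+ b Y) x).
Proof. by rewrite /= !nt_natural raddfD. Qed.

Definition nt_add (F G : abfun C) (a b : nattrans F G) : nattrans F G :=
  @Nattrans C F G (fun X => a X \+ b X) (nt_add_natural a b).

Section DirectSum.
Variables F G : abfun C.

Definition dsum_map (X Y : C) (f : hom X Y) (x : (F Y * G Y)%type) :
    (F X * G X)%type :=
  (fun_map F f x.1, fun_map G f x.2).

Lemma dsum_map_nmod_morphism (X Y : C) (f : hom X Y) : nmod_morphism (dsum_map f).
Proof. by split=> [|x y]; rewrite /dsum_map /= ?raddf0 ?raddfD. Qed.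

HB.instance Definition _ (X Y : C) (f : hom X Y) :=
  GRing.isNmodMorphism.Build _ _ (dsum_map f) (dsum_map_nmod_morphism f).

Definition dsum : abfun C.
Proof.
refine (@Abfun C (fun X => (F X * G X)%type) (fun X Y f => dsum_map f) _ _ _).
- by move=> X [x y]; rewrite /= /dsum_map !fun_map1.
- by move=> X Y Z g f [x y]; rewrite /= /dsum_map /= !fun_mapM.
- by move=> X Y f g [x y]; rewrite /= /dsum_map /= !fun_mapD.
Defined.

Definition dsum_fst : nattrans dsum F.
Proof. exact: (@Nattrans C dsum F (fun X => fst)). Defined.

Definition dsum_snd : nattrans dsum G.
Proof. exact: (@Nattrans C dsum G (fun X => snd)). Defined.

Definition dsum_inl_map X (x : F X) : (F X * G X)%type := (x, 0).
Definition dsum_inr_map X (x : G X) : (F X * G X)%type := (0, x).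

Lemma dsum_inl_nmod_morphism X : nmod_morphism (@dsum_inl_map X).
Proof. by split=> // x y; rewrite /dsum_inl_map -{1}[0]addr0. Qed.

Lemma dsum_inr_nmod_morphism X : nmod_morphism (@dsum_inr_map X).
Proof. by split=> // x y; rewrite /dsum_inr_map -{1}[0]addr0. Qed.

HB.instance Definition _ X :=
  GRing.isNmodMorphism.Build _ _ (@dsum_inl_map X) (dsum_inl_nmod_morphism X).
HB.instance Definition _ X :=
  GRing.isNmodMorphism.Build _ _ (@dsum_inr_map X) (dsum_inr_nmod_morphism X).

Definition dsum_inl : nattrans F dsum.
Proof.
refine (@Nattrans C F dsum (fun X => @dsum_inl_map X) _).
by move=> X Y f x; rewrite /= /dsum_map /dsum_inl_map /= raddf0.
Defined.

Definition dsum_inr : nattrans G dsum.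
Proof.
refine (@Nattrans C G dsum (fun X => @dsum_inr_map X) _).
by move=> X Y f x; rewrite /= /dsum_map /dsum_inr_map /= raddf0.
Defined.

End DirectSum.

Lemma acomp0m (X Y Z : C) (f : hom X Y) : acomp (0 : hom Y Z) f = 0.
Proof. by apply: (addrI (acomp 0 f)); rewrite -acompDl !addr0. Qed.

Lemma acompm0 (X Y Z : C) (g : hom Y Z) : acomp g (0 : hom X Y) = 0.
Proof. by apply: (addrI (acomp g 0)); rewrite -acompDr !addr0. Qed.

Definition postcomp_at (X Y : C) (f : hom X Y) (W : C) : hom W X -> hom W Y :=
  fun h => acomp f h.

Lemma postcomp_nmod_morphism (X Y : C) (f : hom X Y) W :
  nmod_morphism (@postcomp_at X Y f W).
Proof. by split=> [|g h]; rewrite /postcomp_at ?acompm0 ?acompDr. Qed.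

HB.instance Definition _ (X Y : C) (f : hom X Y) W :=
  GRing.isNmodMorphism.Build _ _ (@postcomp_at X Y f W)
    (postcomp_nmod_morphism f W).

Definition postcomp (X Y : C) (f : hom X Y) :
    nattrans (representable X) (representable Y) :=
  @Nattrans C (representable X) (representable Y) (fun W => @postcomp_at X Y f W)
    (fun W V g h => acompA f h g).

Definition zerofun : abfun C.
Proof.
refine (@Abfun C (fun X => 'I_1 : zmodType) (fun X Y f => \0) _ _ _).
- by move=> X x; rewrite [x]ord1.
- by [].
- by move=> X Y f g x; rewrite /= addr0.
Defined.

Lemma zerofun_fp : finitely_presented zerofun.
Proof.
have [Z Z0] := azero C.
have h0 W (h : hom W Z) : h = 0 by rewrite -(acomp1m h) Z0 acomp0m.
exists Z, Z, (postcomp (aid Z)), (nt_zero _ _); split.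
  move=> X y; split=> // _; exists y; exact: acomp1m.
by move=> X x; exists 0; rewrite [x]ord1.
Qed.

Lemma dsum_fp (F G : abfun C) :
  finitely_presented F -> finitely_presented G -> finitely_presented (dsum F G).
Proof.
move=> [X1 [X0 [p [q [pq qs]]]]] [Y1 [Y0 [p' [q' [pq' qs']]]]].
have [S1 [i1 [j1 [s1 [t1 [si ti sj tj e1]]]]]] := abiprod X1 Y1.
have [S0 [i0 [j0 [s0 [t0 [si0 ti0 sj0 tj0 e0]]]]]] := abiprod X0 Y0.
exists S1, S0.
exists (nt_add (nt_comp (postcomp i0) (nt_comp p (postcomp s1)))
               (nt_comp (postcomp j0) (nt_comp p' (postcomp t1)))).
exists (nt_add (nt_comp (dsum_inl F G) (nt_comp q (postcomp s0)))
               (nt_comp (dsum_inr F G) (nt_comp q' (postcomp t0)))).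
have addpE (A B : zmodType) (a : A) (b : B) : (a, 0) + (0, b) = (a, b).
  by apply/pair_equal_spec => /=; rewrite addr0 add0r.
split=> [X h|X [x y]] /=; last first.
  have [u qu] := qs X x; have [v qv] := qs' X y.
  exists (acomp i0 (u : hom X X0) + acomp j0 (v : hom X Y0) : hom X S0).
  rewrite /dsum_inl_map /dsum_inr_map addpE /postcomp_at !acompDr !acompA.
  by rewrite si0 sj0 ti0 tj0 !acomp1m !acomp0m addr0 add0r qu qv.
rewrite /dsum_inl_map /dsum_inr_map addpE /postcomp_at; split.
  case=> /pq[u pu] /pq'[v pv].
  exists (acomp i1 (u : hom X X1) + acomp j1 (v : hom X Y1) : hom X S1).
  rewrite !acompDr !acompA si ti sj tj !acomp1m !acomp0m addr0 add0r pu pv.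
  by rewrite !acompA -acompDl e0 acomp1m.
case=> u <-; rewrite !acompDr !acompA si0 sj0 ti0 tj0.
rewrite !acomp1m !acomp0m addr0 add0r.
congr (_, _); first by apply/pq; eexists.
by apply/pq'; eexists.
Qed.

Definition fzero : modcat := Fpfun zerofun_fp.
Definition fsum (F G : modcat) : modcat := Fpfun (dsum_fp (fpfP F) (fpfP G)).

Lemma eq_modR (Q : modcat -> Prop) (F G : modcat) (f : mor F G) :
  Q fzero -> eq_mod Q f f.
Proof.
move=> Q0; exists fzero, (nt_zero F fzero), (nt_zero fzero G).
by split=> // X x; rewrite subrr.
Qed.

Lemma eq_modS (Q : modcat -> Prop) (F G : modcat) (f g : mor F G) :
  eq_mod Q f g -> eq_mod Q g f.
Proof.
move=> [Z [a [b [QZ e]]]]; exists Z, a, (nt_opp b : mor Z G); split=> // X x.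
by rewrite /= -e opprB.
Qed.

Lemma eq_modT (Q : modcat -> Prop) (F G : modcat) (f g h : mor F G) :
  (forall P P', Q P -> Q P' -> Q (fsum P P')) ->
  eq_mod Q f g -> eq_mod Q g h -> eq_mod Q f h.
Proof.
move=> QD [Z [a [b [QZ e]]]] [Z' [a' [b' [QZ' e']]]].
exists (fsum Z Z').
exists (nt_add (nt_comp (dsum_inl Z Z') a) (nt_comp (dsum_inr Z Z') a') : mor F (fsum Z Z')).
exists (nt_add (nt_comp b (dsum_fst Z Z')) (nt_comp b' (dsum_snd Z Z')) : mor (fsum Z Z') G).
split=> [|X x]; first exact: QD.
by rewrite /= addr0 add0r -e -e' addrA subrK.
Qed.

Lemma eq_mod_comp (Q : modcat -> Prop) (F G H : modcat) (g g' : mor G H) (f f' : mor F G) :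
  (forall P P', Q P -> Q P' -> Q (fsum P P')) ->
  eq_mod Q g g' -> eq_mod Q f f' -> eq_mod Q (compm g f) (compm g' f').
Proof.
move=> QD [Z [a [b [QZ e]]]] [Z' [a' [b' [QZ' e']]]].
apply: (@eq_modT _ _ _ _ (compm g' f)) => //.
  by exists Z, (compm a f), b; split=> // X x /=; rewrite e.
exists Z', a', (compm g' b'); split=> // X x /=.
by rewrite -raddfB e'.
Qed.

Lemma projective0 : projective fzero.
Proof.
move=> X Y e _ f; exists (nt_zero fzero X) => W x /=.
by rewrite raddf0 [x]ord1 (raddf0 (f W)).
Qed.

Lemma injective0 : injective_obj fzero.
Proof.
move=> X Y m _ f; exists (nt_zero Y fzero) => W x /=.
by rewrite [RHS]ord1.
Qed.

Lemma projectiveD (P P' : modcat) :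
  projective P -> projective P' -> projective (fsum P P').
Proof.
move=> pP pP' X Y e ee f.
have [g eg] := pP X Y e ee (nt_comp f (dsum_inl P P')).
have [g' eg'] := pP' X Y e ee (nt_comp f (dsum_inr P P')).
exists (nt_add (nt_comp g (dsum_fst P P')) (nt_comp g' (dsum_snd P P')) : mor (fsum P P') X).
move=> W [x y]; rewrite /= raddfD.
have /= -> := eg W x; have /= -> := eg' W y; rewrite -raddfD; congr (f W _).
by congr (_, _); rewrite /= ?addr0 ?add0r.
Qed.

Lemma injectiveD (P P' : modcat) :
  injective_obj P -> injective_obj P' -> injective_obj (fsum P P').
Proof.
move=> pP pP' X Y e ee f.
have [g eg] := pP X Y e ee (nt_comp (dsum_fst P P') f).
have [g' eg'] := pP' X Y e ee (nt_comp (dsum_snd P P') f).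
exists (nt_add (nt_comp (dsum_inl P P') g) (nt_comp (dsum_inr P P') g') : mor Y (fsum P P')).
move=> W x.
have /= egx := eg W x; have /= egy := eg' W x.
rewrite /= /dsum_inl_map /dsum_inr_map egx egy.
by case: (f W x) => u v; congr (_, _); rewrite /= ?addr0 ?add0r.
Qed.

(* The full subcategory of mod-C on the objects satisfying A, modulo the ideal
   of the morphisms factoring through an object satisfying Q. The objects
   satisfying Q need not satisfy A a priori, but projectives satisfy [pd_le1]
   and injectives satisfy [id_le1]. *)
Definition quotcat (A Q : modcat -> Prop) (Q0 : Q fzero)
    (QD : forall P P', Q P -> Q P' -> Q (fsum P P')) : category.
Proof.
refine (@Category {F : modcat | A F} (fun F G => mor (sval F) (sval G))
  (fun F G f g => eq_mod Q f g) _ _ _ (fun F => idm (sval F))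
  (fun F G H g f => compm g f) _ _ _ _).
- by move=> F G f; apply: eq_modR.
- by move=> F G f g; apply: eq_modS.
- by move=> F G f g h; apply: eq_modT.
- by move=> F G H g g' f f'; apply: eq_mod_comp.
- by move=> E F G H h g f; apply: eq_modR.
- by move=> F G f; exact: (eq_modR f Q0).
- by move=> F G f; exact: (eq_modR f Q0).
Defined.

Definition stableP1 : category := quotcat pd_le1 projective0 projectiveD.

Definition costableI1 : category := quotcat id_le1 injective0 injectiveD.

End FunctorCategory.

Definition fin_gen (S : pzRingType) (V : lmodType S) :=
  exists (k : nat) (s : 'I_k -> V),
    forall v, exists c : 'I_k -> S, v = \sum_(i < k) c i *: s i.

Definition ideal_of (R : comPzRingType) (I : R -> Prop) :=
  [/\ I 0, forall x y, I x -> I y -> I (x + y) & forall a x, I x -> I (a * x)].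

Definition artinian (R : comPzRingType) :=
  forall I : nat -> R -> Prop,
    (forall k, ideal_of (I k)) -> (forall k x, I k.+1 x -> I k x) ->
  exists N, forall k x, (N <= k)%N -> I N x -> I k x.

Definition artin_algebra (R : comPzRingType) (L : algType R) :=
  artinian R /\ fin_gen L.

(* The objects of mod-L are those of fgmod L^c: right L-modules are left modules
   over the converse ring. *)
Record fgmod (S : pzRingType) := Fgmod {
  fgm :> lmodType S;
  fgmP : fin_gen fgm
}.

Section LinearMaps.
Variables (S : pzRingType) (U V : lmodType S).

Definition linmap : Type := {linear U -> V}.

Definition linmap_add (f g : linmap) : linmap := f \+ g.
Definition linmap_opp (f : linmap) : linmap := \- f.
Definition linmap_zero : linmap := \0.

Lemma linmapP (f g : linmap) : f =1 g -> f = g.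
Proof.
case: f => f [[cf] [df]] ; case: g => g [[cg] [dg]] /= /funext efg.
move: cf df cg dg; rewrite /= efg => *.
by congr (GRing.Linear.Pack (GRing.Linear.Class _ _)); f_equal; exact: Prop_irrelevance.
Qed.

End LinearMaps.

Section LinearMapsZmodule.
Variables (S : pzRingType) (U V : lmodType S).
Implicit Types f g h : linmap U V.

HB.instance Definition _ := gen_eqMixin (linmap U V).
HB.instance Definition _ := gen_choiceMixin (linmap U V).

Lemma linmap_addA : associative (@linmap_add S U V).
Proof. by move=> f g h; apply: linmapP => x /=; rewrite addrA. Qed.

Lemma linmap_addC : commutative (@linmap_add S U V).
Proof. by move=> f g; apply: linmapP => x /=; rewrite addrC. Qed.

Lemma linmap_add0 : left_id (@linmap_zero S U V) (@linmap_add S U V).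
Proof. by move=> f; apply: linmapP => x /=; rewrite add0r. Qed.

Lemma linmap_addN :
  left_inverse (@linmap_zero S U V) (@linmap_opp S U V) (@linmap_add S U V).
Proof. by move=> f; apply: linmapP => x /=; rewrite addNr. Qed.

HB.instance Definition _ :=
  GRing.isZmodule.Build (linmap U V) linmap_addA linmap_addC linmap_add0 linmap_addN.

End LinearMapsZmodule.

Definition linmap_id (S : pzRingType) (U : lmodType S) : linmap U U := idfun.

Definition linmap_comp (S : pzRingType) (U V W : lmodType S)
  (g : linmap V W) (f : linmap U V) : linmap U W := g \o f.

Definition projective_mod (S : pzRingType) (P : fgmod S) :=
  forall (X Y : fgmod S) (e : {linear X -> Y}), (forall y, exists x, e x = y) ->
  forall f : {linear P -> Y}, exists g : {linear P -> X}, e \o g =1 f.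

(* ... -> P 2 -> P 1 -> P 0 -> A -> 0, where d i : P i.+1 -> P i. *)
Definition projective_resolution (S : pzRingType) (A : fgmod S)
    (P : nat -> fgmod S) (d : forall i, {linear P i.+1 -> P i})
    (e : {linear P 0%N -> A}) :=
  [/\ forall i, projective_mod (P i), forall y, exists x, e x = y,
      forall x, e x = 0 <-> exists y, d 0%N y = x
    & forall i x, d i x = 0 <-> exists y, d i.+1 y = x].

(* Ext^i(A, B) = 0, where Ext^i(A, B) is the i-th cohomology group of Hom(P, B)
   for a projective resolution P of A. *)
Definition ext_vanishes (S : pzRingType) (i : nat) (A B : fgmod S) :=
  exists (P : nat -> fgmod S) (d : forall i, {linear P i.+1 -> P i})
    (e : {linear P 0%N -> A}),
    projective_resolution d e /\
    match i with
    | 0%N => forall f : {linear P 0%N -> B}, f \o d 0%N =1 \0 -> f =1 \0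
    | j.+1 => forall f : {linear P j.+1 -> B}, f \o d j.+1 =1 \0 ->
              exists g : {linear P j -> B}, g \o d j =1 f
    end.

Record addsub (S : pzRingType) := Addsub {
  in_sub :> fgmod S -> Prop;
  sub_zero : exists Z : fgmod S, in_sub Z /\ forall z : Z, z = 0;
  sub_biprod : forall X Y : fgmod S, in_sub X -> in_sub Y ->
    exists (T : fgmod S) (f : {linear T -> (X * Y)%type}), in_sub T /\ bijective f
}.

Section SubcategoryAsAddcat.
Variables (S : pzRingType) (M : addsub S).

Lemma sub_addcat_zero :
  exists Z : {X : fgmod S | M X}, linmap_id (sval Z) = 0.
Proof.
have [Z [MZ Z0]] := sub_zero M.
by exists (exist _ Z MZ); apply: linmapP => x /=; rewrite [LHS]Z0.
Qed.

Lemma sub_addcat_biprod (X Y : {X : fgmod S | M X}) :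
  exists (T : {X : fgmod S | M X}) (i1 : linmap (sval X) (sval T))
    (i2 : linmap (sval Y) (sval T)) (p1 : linmap (sval T) (sval X))
    (p2 : linmap (sval T) (sval Y)),
  [/\ linmap_comp p1 i1 = linmap_id _, linmap_comp p2 i2 = linmap_id _,
      linmap_comp p1 i2 = 0, linmap_comp p2 i1 = 0
    & linmap_comp i1 p1 + linmap_comp i2 p2 = linmap_id _].
Proof.
case: X Y => X MX [Y MY] /=.
have [T [f [MT [g fK gK]]]] := sub_biprod MX MY.
have g_lin := can2_linear fK gK.
pose gl : {linear (X * Y)%type -> T} :=
  HB.pack g (GRing.isLinear.Build _ _ _ _ g g_lin).
have i1_lin : linear (fun x : X => (x, 0) : (X * Y)%type).
  move=> a x x'; apply/pair_equal_spec; split=> //=.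
  by rewrite scaler0 addr0.
have i2_lin : linear (fun y : Y => (0, y) : (X * Y)%type).
  move=> a x x'; apply/pair_equal_spec; split=> //=.
  by rewrite scaler0 addr0.
pose i1 : {linear X -> (X * Y)%type} := HB.pack (fun x : X => (x, 0) : (X * Y)%type)
   (GRing.isLinear.Build _ _ _ _ _ i1_lin).
pose i2 : {linear Y -> (X * Y)%type} := HB.pack (fun y : Y => (0, y) : (X * Y)%type)
   (GRing.isLinear.Build _ _ _ _ _ i2_lin).
exists (exist _ T MT), (gl \o i1), (gl \o i2), (fst \o f), (snd \o f).
split; apply: linmapP => x /=; rewrite ?gK //.
rewrite -(raddfD gl); apply: (can_inj fK); rewrite /= gK.
by case: (f x) => u v; apply/pair_equal_spec; rewrite /= addr0 add0r.
Qed.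

Definition sub_addcat : addcat.
Proof.
refine (@Addcat {X : fgmod S | M X} (fun X Y => linmap (sval X) (sval Y) : zmodType)
  (fun X => linmap_id (sval X)) (fun X Y Z g f => linmap_comp g f)
  _ _ _ _ _ sub_addcat_zero sub_addcat_biprod).
- by move=> W X Y Z h g f; apply: linmapP.
- by move=> X Y f; apply: linmapP.
- by move=> X Y f; apply: linmapP.
- by move=> X Y Z g g' f; apply: linmapP.
- by move=> X Y Z g f f'; apply: linmapP => x; rewrite /= raddfD.
Defined.

End SubcategoryAsAddcat.

Section ClusterTilting.
Variables (S : pzRingType) (M : fgmod S -> Prop).

Definition right_approximation (A X : fgmod S) (f : {linear X -> A}) :=
  M X /\ forall X' : fgmod S, M X' ->
  forall g : {linear X' -> A}, exists h : {linear X' -> X}, f \o h =1 g.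

Definition left_approximation (A X : fgmod S) (f : {linear A -> X}) :=
  M X /\ forall X' : fgmod S, M X' ->
  forall g : {linear A -> X'}, exists h : {linear X -> X'}, h \o f =1 g.

Definition functorially_finite := forall A : fgmod S,
  (exists (X : fgmod S) (f : {linear X -> A}), right_approximation f) /\
  (exists (X : fgmod S) (f : {linear A -> X}), left_approximation f).

Definition generating := forall A : fgmod S,
  exists (X : fgmod S) (f : {linear X -> A}), M X /\ forall a, exists x, f x = a.

Definition cogenerating := forall A : fgmod S,
  exists (X : fgmod S) (f : {linear A -> X}), M X /\ injective f.

Definition cluster_tilting (n : nat) :=
  [/\ functorially_finite, generating, cogenerating,
      forall A : fgmod S, M A <->
        (forall X : fgmod S, M X -> forall i, (0 < i < n)%N -> ext_vanishes i X A)
    & forall A : fgmod S, M A <->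
        (forall X : fgmod S, M X -> forall i, (0 < i < n)%N -> ext_vanishes i A X)].

End ClusterTilting.

(* Main.v *)
(** A functor of projective dimension at most one is presented by a monomorphism
    f : X1 -> X0 of M, and modulo projectives it is determined by f up to
    homotopy, hence by the module B = coker f up to maps factoring through M.
    Dually, for covariant functors one gets the kernels K of epimorphisms of M.
    The modules B are those with Ext^i(M, B) = 0 for 0 < i < n - 1, the modules
    K those with Ext^i(K, M) = 0 for 0 < i < n - 1. In an exact sequence
    0 -> A -> X -> A' -> 0 where A -> X is a left and X -> A' a right
    M-approximation, A and A' determine each other modulo M, and passing from A
    to A' trades one vanishing condition of the first kind for one of the second
    kind; after n - 2 such steps the modules B have been exchanged for the
    modules K.

    For the second equivalence, the functor of injective dimension at most one
    attached to K is D Hom(K, -), where D = Hom_R(-, E). Here E is a finitely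
    generated module over the artinian base ring R, of maximal length among
    those whose socle is multiplicity free; maximality makes it an injective
    cogenerator for which finitely generated modules are reflexive. The
    injective objects of mod-M are then the D Hom(X, -) with X in M. *)

From HB Require Import structures.
From mathcomp Require Import all_boot all_algebra.
From mathcomp Require Import zify boolp classical_sets.
Require Import Defs.

Set Implicit Arguments.
Unset Strict Implicit.
Unset Printing Implicit Defensive.

Import GRing.Theory.
Local Open Scope ring_scope.
Local Open Scope classical_set_scope.

(** * Submodules and quotients *)

(** Approximations, presentations and cokernels are determined only up to homotopy, so no step is
    built as a functor. Each step is a [correspondence], a relation between morphisms that is
    bijective modulo the two ideals, and [correspondence_equivalent] makes all choices at once. The
    ideals match because a map of short exact sequences with middle terms in M is null homotopic at
    one end exactly when it is so at the other. The first equivalence reverses arrows: a map K -> K'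
    of kernels extends to a map of the epimorphisms in the same direction, which acts on the
    presented covariant functors in the opposite direction. Hence the [opcat]. The duality D
    reverses once more, so the functors D Hom(K, -) vary covariantly with K. Higher Ext is read as
    Ext^1 into an iterated cosyzygy, and Ext^1 as the splitting of extensions, so that pullbacks and
    pushouts do the work of the long exact sequence. This needs enough injectives among the finitely
    generated modules. They are the coinduced modules Hom_R(L^k, E), so the module E already enters
    the first equivalence. *)

Section Modules.
Variable S : pzRingType.
Implicit Types U V W : lmodType S.

Definition Lin U V (f : U -> V) (f_lin : linear f) : {linear U -> V} :=
  HB.pack f (GRing.isLinear.Build _ _ _ _ f f_lin).

Definition submod V (N : V -> Prop) :=
  N 0 /\ forall a x y, N x -> N y -> N (a *: x + y).

Lemma submodD V (N : V -> Prop) x y : submod N -> N x -> N y -> N (x + y).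
Proof. by case=> _ sN Nx Ny; rewrite -[x]scale1r; apply: sN. Qed.

Lemma submodZ V (N : V -> Prop) a x : submod N -> N x -> N (a *: x).
Proof. by case=> N0 sN Nx; rewrite -[_ *: _]addr0; apply: sN. Qed.

Lemma submodN V (N : V -> Prop) x : submod N -> N x -> N (- x).
Proof. by move=> sN Nx; rewrite -scaleN1r; apply: submodZ. Qed.

Lemma submodB V (N : V -> Prop) x y : submod N -> N x -> N y -> N (x - y).
Proof. by move=> sN Nx Ny; apply: submodD => //; apply: submodN. Qed.

Lemma submod_sum V (N : V -> Prop) (I : finType) (v : I -> V) :
  submod N -> (forall i, N (v i)) -> N (\sum_i v i).
Proof.
move=> sN Nv; apply: (big_ind N) => //; first by case: sN.
by move=> x y; apply: submodD.
Qed.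

Lemma factor_surj U V W (e : {linear U -> V}) (g : {linear U -> W}) :
  (forall v, exists u, e u = v) -> (forall u, e u = 0 -> g u = 0) ->
  exists h : {linear V -> W}, forall u, h (e u) = g u.
Proof.
move=> es kg; pose s v := sval (cid (es v)).
have sK v : e (s v) = v by rewrite /s; case: cid.
have gE u : g (s (e u)) = g u.
  by apply/eqP; rewrite -subr_eq0 -raddfB; apply/eqP/kg; rewrite raddfB /= sK subrr.
have h_lin : linear (g \o s).
  by move=> a x y /=; rewrite -linearP -[in RHS]gE linearP !sK.
by exists (Lin h_lin) => u /=; rewrite gE.
Qed.

Lemma factor_inj U V W (j : {linear V -> W}) (g : {linear U -> W}) :
  (forall x, j x = 0 -> x = 0) -> (forall u, exists v, j v = g u) ->
  exists h : {linear U -> V}, forall u, j (h u) = g u.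
Proof.
move=> ji gj; pose h u := sval (cid (gj u)).
have hE u : j (h u) = g u by rewrite /h; case: cid.
have h_lin : linear h.
  move=> a x y; apply/eqP; rewrite -subr_eq0; apply/eqP/ji.
  by rewrite raddfB /= linearP /= !hE linearP subrr.
by exists (Lin h_lin).
Qed.

Lemma linear_inj U V (f : {linear U -> V}) :
  (forall u, f u = 0 -> u = 0) -> forall x y, f x = f y -> x = y.
Proof.
by move=> fi x y e; apply/eqP; rewrite -subr_eq0; apply/eqP/fi; rewrite raddfB /= e subrr.
Qed.

Section Submodule.
Variables (V : lmodType S) (N : V -> Prop) (sN : submod N).

(** The proof that N is a submodule is a parameter of the carrier, so that the module structure
    below can be inferred from the type alone. *)
Definition submodule of submod N := {x : V | N x}.
Local Notation T := (submodule sN).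

HB.instance Definition _ := gen_eqMixin T.
HB.instance Definition _ := gen_choiceMixin T.

Lemma submodule_inj (x y : T) : sval x = sval y -> x = y.
Proof. by case: x y => x p [y q] /= e; apply: eq_exist. Qed.

Let zero : T := exist _ 0 sN.1.
Let add (x y : T) : T := exist _ (sval x + sval y) (submodD sN (svalP x) (svalP y)).
Let opp (x : T) : T := exist _ (- sval x) (submodN sN (svalP x)).
Let scale a (x : T) : T := exist _ (a *: sval x) (submodZ a sN (svalP x)).

Fact submodule_addA : associative add.
Proof. by move=> x y z; apply: submodule_inj; rewrite /= addrA. Qed.
Fact submodule_addC : commutative add.
Proof. by move=> x y; apply: submodule_inj; rewrite /= addrC. Qed.
Fact submodule_add0 : left_id zero add.
Proof. by move=> x; apply: submodule_inj; rewrite /= add0r. Qed.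
Fact submodule_addN : left_inverse zero opp add.
Proof. by move=> x; apply: submodule_inj; rewrite /= addNr. Qed.

HB.instance Definition _ := GRing.isZmodule.Build T
  submodule_addA submodule_addC submodule_add0 submodule_addN.

Fact submodule_scaleA a b (v : T) : scale a (scale b v) = scale (a * b) v.
Proof. by apply: submodule_inj; rewrite /= scalerA. Qed.
Fact submodule_scale1 : left_id 1 scale.
Proof. by move=> x; apply: submodule_inj; rewrite /= scale1r. Qed.
Fact submodule_scaleDr : right_distributive scale +%R.
Proof. by move=> a x y; apply: submodule_inj; rewrite /= scalerDr. Qed.
Fact submodule_scaleDl v : {morph scale^~ v : a b / a + b}.
Proof. by move=> a b; apply: submodule_inj; rewrite /= scalerDl. Qed.

HB.instance Definition _ := GRing.Zmodule_isLmodule.Build S T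
  submodule_scaleA submodule_scale1 submodule_scaleDr submodule_scaleDl.

(** Closed by [Qed], this hides the underlying function: the inclusion is used only through these
    three properties and never unfolds under simplification. The projection to a quotient is treated
    in the same way. *)
Fact sub_incl_key : {f : {linear T -> V} | [/\ forall x, f x = 0 -> x = 0,
  forall x, N (f x) & forall v, N v -> exists x, f x = v]}.
Proof.
exists (@Lin T V (fun x : T => sval x) (fun a x y => erefl)); split=> [x x0|x|v Nv].
- exact: submodule_inj.
- exact: svalP.
- by exists (exist _ v Nv).
Qed.

Definition sub_incl : {linear T -> V} := sval sub_incl_key.

Lemma sub_incl_eq0 x : sub_incl x = 0 -> x = 0.
Proof. by case: (svalP sub_incl_key) => + _ _; apply. Qed.

Lemma sub_inclP x : N (sub_incl x).
Proof. by case: (svalP sub_incl_key). Qed.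

Lemma sub_incl_onto v : N v -> exists x, sub_incl x = v.
Proof. by case: (svalP sub_incl_key) => _ _; apply. Qed.

End Submodule.

Section Quotient.
Variables (V : lmodType S) (N : V -> Prop) (sN : submod N).

(** [xget] depends only on the set it is given, so all elements of a coset get the same
    representative. The quotient consists of the chosen representatives, and equality of classes is
    Leibniz equality. *)
Definition coset_repr (x : V) : V := xget 0 [set y | N (y - x)].

Lemma coset_reprP x : N (coset_repr x - x).
Proof. by rewrite /coset_repr; apply: (@xgetPex _ 0 [set y | N (y - x)]); exists x; rewrite /= subrr; case: sN. Qed.

Lemma coset_repr_eq x y : N (x - y) -> coset_repr x = coset_repr y.
Proof.
move=> Nxy; rewrite /coset_repr; congr (xget 0 _).
apply/seteqP; split=> z /= Nz.
  by rewrite -(subrKA x); apply: submodD.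
by rewrite -(subrKA y); apply: submodD => //; rewrite -opprB; apply: submodN.
Qed.

Definition quotient of submod N := {x : V | coset_repr x = x}.
Local Notation T := (quotient sN).

HB.instance Definition _ := gen_eqMixin T.
HB.instance Definition _ := gen_choiceMixin T.

Definition quot_class (x : V) : T :=
  exist _ (coset_repr x) (coset_repr_eq (coset_reprP x)).

Lemma quot_class_eq x y : N (x - y) -> quot_class x = quot_class y.
Proof. by move=> /coset_repr_eq e; apply: eq_exist. Qed.

Lemma quot_class_inv x y : quot_class x = quot_class y -> N (x - y).
Proof.
move=> /(congr1 sval)/= e; have := submodB sN (coset_reprP y) (coset_reprP x).
by rewrite e opprB addrC addrA subrK.
Qed.

Lemma quot_svalK (x : T) : quot_class (sval x) = x.
Proof. by case: x => x px; apply: eq_exist. Qed.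

Let zero : T := quot_class 0.
Let add (x y : T) : T := quot_class (sval x + sval y).
Let opp (x : T) : T := quot_class (- sval x).
Let scale a (x : T) : T := quot_class (a *: sval x).

Let addE x y : add (quot_class x) (quot_class y) = quot_class (x + y).
Proof.
by apply: quot_class_eq; rewrite opprD addrACA; apply: submodD => //; apply: coset_reprP.
Qed.
Let oppE x : opp (quot_class x) = quot_class (- x).
Proof. by apply: quot_class_eq; rewrite -opprD; apply: submodN => //; apply: coset_reprP. Qed.
Let scaleE a x : scale a (quot_class x) = quot_class (a *: x).
Proof. by apply: quot_class_eq; rewrite -scalerBr; apply: submodZ => //; apply: coset_reprP. Qed.

Fact quotient_addA : associative add.
Proof.
by move=> x y z; rewrite -(quot_svalK x) -(quot_svalK y) -(quot_svalK z) !addE addrA.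
Qed.
Fact quotient_addC : commutative add.
Proof. by move=> x y; rewrite /add addrC. Qed.
Fact quotient_add0 : left_id zero add.
Proof. by move=> x; rewrite -(quot_svalK x) addE add0r. Qed.
Fact quotient_addN : left_inverse zero opp add.
Proof. by move=> x; rewrite -(quot_svalK x) oppE addE addNr. Qed.

HB.instance Definition _ := GRing.isZmodule.Build T
  quotient_addA quotient_addC quotient_add0 quotient_addN.

Fact quotient_scaleA a b (v : T) : scale a (scale b v) = scale (a * b) v.
Proof. by rewrite -(quot_svalK v) !scaleE scalerA. Qed.
Fact quotient_scale1 : left_id 1 scale.
Proof. by move=> x; rewrite /scale scale1r quot_svalK. Qed.
Fact quotient_scaleDr : right_distributive scale +%R.
Proof.
move=> a x y; rewrite -(quot_svalK x) -(quot_svalK y) [_ + _]addE !scaleE.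
by rewrite scalerDr; exact/esym/addE.
Qed.
Fact quotient_scaleDl v : {morph scale^~ v : a b / a + b}.
Proof.
by move=> a b; rewrite -(quot_svalK v) !scaleE scalerDl; exact/esym/addE.
Qed.

HB.instance Definition _ := GRing.Zmodule_isLmodule.Build S T
  quotient_scaleA quotient_scale1 quotient_scaleDr quotient_scaleDl.

Fact quot_class_linear : linear (quot_class : V -> T).
Proof.
move=> a x y; rewrite -[X in _ = X]/(add (scale a (quot_class x)) (quot_class y)).
by rewrite scaleE addE.
Qed.

Fact quot_proj_key : {f : {linear V -> T} |
  (forall y, exists x, f x = y) /\ (forall x, f x = 0 <-> N x)}.
Proof.
exists (Lin quot_class_linear); split=> [y|x]; first by exists (sval y); apply: quot_svalK.
rewrite -(raddf0 (Lin quot_class_linear)).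
split=> [/quot_class_inv|Nx]; first by rewrite subr0.
by apply: quot_class_eq; rewrite subr0.
Qed.

Definition quot_proj : {linear V -> T} := sval quot_proj_key.

Lemma quot_proj_onto y : exists x, quot_proj x = y.
Proof. exact: (svalP quot_proj_key).1. Qed.

Lemma quot_proj_eq0 x : quot_proj x = 0 <-> N x.
Proof. exact: (svalP quot_proj_key).2. Qed.

End Quotient.
End Modules.

(** * Finitely generated and noetherian modules *)

Section Span.
Variable S : pzRingType.
Implicit Types U V W : lmodType S.

Fixpoint span V (s : seq V) (v : V) : Prop :=
  if s is x :: s' then exists a w, span s' w /\ v = a *: x + w else v = 0.

Lemma span_submod V (s : seq V) : submod (span s).
Proof.
elim: s => [|x s [s0 IHs]] /=; first by split=> // a y z -> ->; rewrite scaler0 addr0.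
split; first by exists 0, 0; rewrite scale0r addr0.
move=> a y z [b [w [sw ->]]] [c [w' [sw' ->]]].
exists (a * b + c), (a *: w + w'); split; first exact: IHs.
by rewrite scalerDr scalerA addrACA scalerDl.
Qed.

Lemma span_min V (N : set V) (s : seq V) v :
  submod N -> (forall x, x \in s -> N x) -> span s v -> N v.
Proof.
move=> sN; elim: s v => [|x s IHs] v Ns /=; first by move=> ->; case: sN.
move=> [a [w [sw ->]]]; apply: sN.2; first by apply: Ns; rewrite mem_head.
by apply: IHs => // y ys; apply: Ns; rewrite inE ys orbT.
Qed.

Lemma mem_span V (s : seq V) x : x \in s -> span s x.
Proof.
elim: s => //= y s IHs; rewrite inE => /orP[/eqP ->|/IHs sx].
  by exists 1, 0; split; [case: (span_submod s) | rewrite scale1r addr0].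
by exists 0, x; rewrite scale0r add0r.
Qed.

Lemma span_cat V (s t : seq V) v :
  span (s ++ t) v <-> exists x y, [/\ span s x, span t y & v = x + y].
Proof.
elim: s v => [|x s IHs] v /=; split.
- by move=> tv; exists 0, v; rewrite add0r.
- by move=> [x [y [-> ty ->]]]; rewrite add0r.
- move=> [a [w [/IHs[y [z [sy tz ->]]] ->]]]; exists (a *: x + y), z.
  by rewrite addrA; split=> //; exists a, y.
move=> [y [z [[a [w [sw ->]]] tz ->]]]; exists a, (w + z); rewrite addrA; split=> //.
by apply/IHs; exists w, z.
Qed.

Lemma span_map U V (f : {linear U -> V}) s u : span s u -> span (map f s) (f u).
Proof.
elim: s u => [|x s IHs] u /=; first by move=> ->; rewrite raddf0.
by move=> [a [w [/IHs sw ->]]]; exists a, (f w); rewrite linearP.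
Qed.

Lemma span_lift U V (f : {linear U -> V}) s w :
  span (map f s) w -> exists2 x, span s x & f x = w.
Proof.
elim: s w => [|x s IHs] w /=; first by move=> ->; exists 0; rewrite ?raddf0.
move=> [a [w' [/IHs[z sz <-] ->]]]; exists (a *: x + z); last by rewrite linearP.
by exists a, z.
Qed.

Lemma map_preimage U V (f : U -> V) (N : set U) (s : seq V) :
  (forall y, y \in s -> (f @` N) y) -> exists2 s', map f s' = s & forall x, x \in s' -> N x.
Proof.
elim: s => [|y s IHs] sN; first by exists [::].
have [x Nx fx] := sN y (mem_head _ _).
have [|s' s'E Ns'] := IHs; first by move=> z zs; apply: sN; rewrite inE zs orbT.
exists (x :: s'); first by rewrite /= fx s'E.
by move=> z; rewrite inE => /orP[/eqP ->//|/Ns'].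
Qed.

Definition fg_submod V (N : set V) := exists s, N = span s.

Lemma fg_submodP V (N : set V) (s : seq V) : submod N ->
  (forall x, x \in s -> N x) -> (forall v, N v -> span s v) -> fg_submod N.
Proof.
move=> sN Ns sNs; exists s; apply/funext => v; apply/propext; split=> [/sNs//|].
exact: span_min.
Qed.

Lemma span_comb V (s : seq V) v :
  span s v <-> exists c : 'I_(size s) -> S, v = \sum_i c i *: s`_i.
Proof.
elim: s v => [|x s IHs] v /=; split.
- by move=> ->; exists (fun=> 0); rewrite big_ord0.
- by move=> [c ->]; rewrite big_ord0.
- move=> [a [w [/IHs[c ->] ->]]].
  exists (fun i => if unlift ord0 i is Some j then c j else a).
  rewrite big_ord_recl unlift_none; congr (_ + _).
  by apply: eq_bigr => i _; rewrite liftK.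
move=> [c ->]; rewrite big_ord_recl; eexists _, _; split; last by [].
by apply/IHs; eexists.
Qed.

Lemma fin_genP V : fin_gen V <-> exists s : seq V, forall v, span s v.
Proof.
split=> [[k [s sV]]|[s sV]]; last first.
  by exists (size s), (fun i => s`_i) => v; apply/span_comb.
exists [seq s i | i <- enum 'I_k] => v; have [c ->] := sV v.
apply: submod_sum => [|i]; first exact: span_submod.
apply: submodZ; [exact: span_submod | apply: mem_span].
by rewrite map_f ?mem_enum.
Qed.

Lemma fin_gen_onto U V (f : {linear U -> V}) :
  (forall v, exists u, f u = v) -> fin_gen U -> fin_gen V.
Proof.
move=> fs [k [s sU]]; exists k, (fun i => f (s i)) => v.
have [u <-] := fs v; have [c ->] := sU u; exists c.
by rewrite raddf_sum; apply: eq_bigr => i _; rewrite /= linearZ.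
Qed.

Lemma fin_gen_prod U V : fin_gen U -> fin_gen V -> fin_gen (U * V)%type.
Proof.
move=> /fin_genP[s sU] /fin_genP[t tV]; apply/fin_genP.
exists ([seq (x, 0) | x <- s] ++ [seq (0, y) | y <- t]) => -[u v]; apply/span_cat.
exists (u, 0), (0, v); split; last by congr (_, _); rewrite /= ?addr0 ?add0r.
  have := sU u; elim: (s) u => [|x s' IHs] u /=; first by move=> ->.
  move=> [a [w [/IHs sw ->]]]; exists a, (w, 0); split=> //.
  by congr (_, _); rewrite /= scaler0 addr0.
have := tV v; elim: (t) v => [|x t' IHs] v /=; first by move=> ->.
move=> [a [w [/IHs sw ->]]]; exists a, (0, w); split=> //.
by congr (_, _); rewrite /= scaler0 addr0.
Qed.

Lemma fin_gen_ffun V k : fin_gen V -> fin_gen {ffun 'I_k -> V}.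
Proof.
move=> [m [s sV]]; apply/fin_genP.
pose del i x : {ffun 'I_k -> V} := [ffun j => if j == i then x else 0].
exists [seq del p.1 (s p.2) | p <- enum {: 'I_k * 'I_m}] => v.
have -> : v = \sum_i del i (v i).
  apply/ffunP => i; rewrite sum_ffunE (bigD1 i) //= ffunE eqxx big1 ?addr0 // => j ji.
  by rewrite ffunE eq_sym (negbTE ji).
apply: submod_sum => [|i]; first exact: span_submod.
have [c ->] := sV (v i).
have -> : del i (\sum_i0 c i0 *: s i0) = \sum_i0 c i0 *: del i (s i0).
  apply/ffunP => j; rewrite sum_ffunE !ffunE; case: eqP => [->|ne].
    by apply: eq_bigr => l _; rewrite !ffunE eqxx.
  by rewrite big1 // => l _; rewrite !ffunE; case: eqP => // _; rewrite scaler0.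
apply: submod_sum => [|l]; first exact: span_submod.
apply: submodZ; [exact: span_submod | apply: mem_span].
by apply/mapP; exists (i, l); rewrite ?mem_enum.
Qed.

Lemma fin_gen_regular : fin_gen (S^o : lmodType S).
Proof.
by exists 1%N, (fun=> 1) => v; exists (fun=> v); rewrite big_ord1; apply/esym/mulr1.
Qed.

Definition noetherian V := forall N : set V, submod N -> fg_submod N.

Lemma submod_preim U V (f : {linear U -> V}) (N : set V) :
  submod N -> submod (f @^-1` N).
Proof. by case=> N0 sN; split=> [|a x y] /=; rewrite ?raddf0 ?linearP //; apply: sN. Qed.

Lemma submod_image U V (f : {linear U -> V}) (N : set U) :
  submod N -> submod (f @` N).
Proof.
case=> N0 sN; split=> [|a _ _ [x Nx <-] [y Ny <-]]; first by exists 0; rewrite ?raddf0.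
by exists (a *: x + y); [apply: sN | rewrite linearP].
Qed.

Lemma submodI V (N N' : set V) : submod N -> submod N' -> submod (N `&` N').
Proof. by move=> [? sN] [? sN']; split=> // a x y [? ?] [? ?]; split; [apply: sN|apply: sN']. Qed.

Lemma fg_submod_fin_gen V (N : set V) (sN : submod N) :
  fg_submod N -> fin_gen (submodule sN).
Proof.
move=> [s Ns]; apply/fin_genP.
have [|s' s'E _] := @map_preimage _ _ (sub_incl sN) setT s.
  move=> y /mem_span; rewrite -Ns => Ny.
  by have [x <-] := sub_incl_onto sN Ny; exists x.
exists s' => v; have: span (map (sub_incl sN) s') (sub_incl sN v).
  by rewrite s'E -Ns; apply: sub_inclP.
by move=> /span_lift[x sx /(linear_inj (@sub_incl_eq0 _ _ _ sN)) <-].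
Qed.

Definition addset V (N N' : set V) : set V := [set v | exists x y, [/\ N x, N' y & v = x + y]].

Lemma submod_addset V (N N' : set V) : submod N -> submod N' -> submod (addset N N').
Proof.
move=> sN sN'; split; first by exists 0, 0; rewrite addr0; case: sN sN' => [? _] [].
move=> a _ _ [x [y [Nx Ny ->]]] [x' [y' [Nx' Ny' ->]]].
exists (a *: x + x'), (a *: y + y'); rewrite scalerDr addrACA.
by split=> //; [apply: sN.2 | apply: sN'.2].
Qed.

Definition line V (x : V) : set V := [set v | exists a, v = a *: x].

Lemma submod_line V (x : V) : submod (line x).
Proof.
split; first by exists 0; rewrite scale0r.
by move=> a _ _ [b ->] [c ->]; exists (a * b + c); rewrite scalerDl scalerA.
Qed.

Lemma submod0 V : submod (V := V) [set 0].
Proof. by split=> // a x y -> ->; rewrite scaler0 addr0. Qed.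

Lemma submodT V : submod (V := V) setT. Proof. by []. Qed.

(** Lifts of generators of the image, together with generators of the part of N in the kernel,
    generate N. *)
Lemma fg_submod_ext U V (f : {linear U -> V}) (N : set U) : submod N ->
  fg_submod (f @` N) -> fg_submod (N `&` [set x | f x = 0]) -> fg_submod N.
Proof.
move=> sN [s fNs] [t Nt].
have [|s' s'E Ns'] := @map_preimage _ _ f N s.
  by move=> y ys; rewrite fNs; apply: mem_span.
have tN x : span t x -> N x /\ f x = 0 by rewrite -Nt.
apply: (fg_submodP (s := s' ++ t)) => // [x|v Nv].
  by rewrite mem_cat => /orP[/Ns'//|xt]; case: (tN x (mem_span xt)).
have: span s (f v) by rewrite -fNs; exists v.
rewrite -s'E => /span_lift[x sx fx]; apply/span_cat; exists x, (v - x); split=> //.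
  rewrite -Nt; split; last by rewrite /= raddfB /= fx subrr.
  by apply: submodB => //; apply: span_min sx.
by rewrite addrC subrK.
Qed.

Lemma noetherian_fin_gen V :
  (forall I : set S^o, submod I -> fg_submod I) -> fin_gen V -> noetherian V.
Proof.
move=> nS /fin_genP[s sV].
suff: forall N : set V, submod N -> (forall v, N v -> span s v) -> fg_submod N.
  by move=> H N sN; apply: H.
elim: s {sV} => [|x s IHs] N sN Ns.
  by apply: (fg_submodP (s := [::])).
(* Z collects the coefficient data of N. Its projection to the ring is an ideal, and the kernel of
   that projection is the part of N in the span of the remaining generators, so Z is finitely
   generated; N is its image. *)
pose Z : set (S^o * V)%type := [set p | N (p.1 *: x + p.2) /\ span s p.2].
have sZ : submod Z.
  split; first by rewrite /Z /= scale0r addr0; case: sN (span_submod s) => ? _ [].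
  move=> a [b v] [c w] [/= Nv sv] [/= Nw sw]; split; last exact: (span_submod s).2.
  rewrite /= scalerDl -scalerA addrACA -scalerDr; exact: sN.2.
have fZ : fg_submod Z.
  apply: (@fg_submod_ext _ _ fst); rewrite //; first by apply: nS; apply: submod_image.
  have [t tE] : fg_submod (N `&` span s).
    apply: IHs => [|v []//]; apply: submodI => //; exact: span_submod.
  exists [seq (0, v) | v <- t]; apply/funext => -[a v]; apply/propext; split.
    move=> [[/= Nv sv] a0]; move: Nv; rewrite {}a0 scale0r add0r => Nv.
    have : span t v by rewrite -tE.
    elim: (t) v {Nv sv} => [|y t' IHt] v /=; first by move=> ->.
    by move=> [b [w [/IHt sw ->]]]; exists b, (0, w); split=> //; congr (_, _); rewrite /= scaler0 addr0.
  have {tE} : forall z, z \in t -> (N `&` span s) z by rewrite tE => z; apply: mem_span.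
  move=> tN /(@span_min _ (Z `&` [set p | p.1 = 0])); apply.
    by apply: submodI => //; apply: (@submod_preim _ _ fst [set 0]); apply: submod0.
  by move=> _ /mapP[z /tN[Nz sz] ->]; rewrite /Z /= scale0r add0r.
have [t tZ] := fZ.
have g_lin : linear ((fun p => (p.1 : S) *: x + p.2) : (S^o * V)%type -> V).
  by move=> a [b v] [c w] /=; rewrite scalerDl -scalerA addrACA -scalerDr.
exists (map (Lin g_lin) t); apply/funext => v; apply/propext; split=> [Nv|].
  have [a [w [sw vE]]] := Ns v Nv.
  have : span t (a, w) by rewrite -tZ; split=> //=; rewrite -vE.
  by rewrite vE -[a *: x + w]/(Lin g_lin (a, w)); apply: span_map.
apply: span_min => // _ /mapP[p pt ->]; have: Z p by rewrite tZ; apply: mem_span.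
by case.
Qed.

(** Without a maximal element, dependent choice yields a strictly increasing chain; its union is
    finitely generated, so one member already contains all generators. *)
Lemma noetherian_max V (P : set (set V)) (N0 : set V) : noetherian V ->
  submod N0 -> P N0 -> exists N, [/\ submod N, P N &
    forall N', submod N' -> P N' -> N `<=` N' -> N' `<=` N].
Proof.
move=> nV sN0 PN0; apply: contrapT => noN.
have next (N : {N : set V | submod N /\ P N}) :
    exists N' : {N : set V | submod N /\ P N}, sval N `<` sval N'.
  case: N => N [sN PN]; apply: contrapT => noN'; apply: noN; exists N; split=> //.
  move=> N' sN' PN' NN'; apply: contrapT => nN'N; apply: noN'.
  by exists (exist _ N' (conj sN' PN')); split.
pose c := fix c k := if k is k'.+1 then sval (cid (next (c k')))
                     else exist _ N0 (conj sN0 PN0).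
have cS k : sval (c k) `<` sval (c k.+1) by rewrite /=; case: cid.
have cle k m : (k <= m)%N -> sval (c k) `<=` sval (c m).
  elim: m => [|m IHm]; first by rewrite leqn0 => /eqP ->.
  rewrite leq_eqVlt => /orP[/eqP -> //|/IHm H]; apply: (subset_trans H).
  by case: (cS m).
pose U : set V := [set v | exists k, sval (c k) v].
have sU : submod U.
  split; first by exists 0%N; exact: sN0.1.
  move=> a x y [k kx] [m my]; exists (maxn k m).
  apply: (svalP (c (maxn k m))).1.2.
    by apply: cle kx; rewrite leq_maxl.
  by apply: cle my; rewrite leq_maxr.
have [s Us] := nV U sU.
have [k ks] : exists k, forall x, x \in s -> sval (c k) x.
  have: forall x, x \in s -> U x by rewrite Us => x; apply: mem_span.
  elim: (s) => [|x s' IHs] sU'; first by exists 0%N.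
  have [k1 kx] := sU' x (mem_head _ _).
  have [|k2 ks] := IHs; first by move=> y ys; apply: sU'; rewrite inE ys orbT.
  exists (maxn k1 k2) => y; rewrite inE => /orP[/eqP ->|/ks].
    by apply: cle kx; rewrite leq_maxl.
  by apply: cle; rewrite leq_maxr.
have [_ nx] := cS k; apply: nx => x ckx.
have : U x by exists k.+1.
by rewrite Us; apply: span_min => //; case: (svalP (c k)).
Qed.

End Span.

(** * Commutative artinian rings *)

Section ArtinianRing.
Variable R : comPzRingType.
Hypothesis artR : artinian R.

Lemma ideal_submod (I : set R^o) : submod I -> ideal_of (I : R -> Prop).
Proof. by move=> sI; split; [case: sI | move=> x y; apply: (submodD sI) | move=> a x; apply: (submodZ a sI)]. Qed.

Lemma artinian_min (P : set (set R^o)) (I0 : set R^o) : submod I0 -> P I0 ->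
  exists I, [/\ submod I, P I & forall J, submod J -> P J -> J `<=` I -> I `<=` J].
Proof.
move=> sI0 PI0; apply: contrapT => noI.
have next (N : {N : set R^o | submod N /\ P N}) :
    exists N' : {N : set R^o | submod N /\ P N}, sval N' `<` sval N.
  case: N => N [sN PN]; apply: contrapT => noN'; apply: noI; exists N; split=> //.
  move=> N' sN' PN' NN'; apply: contrapT => nN'N; apply: noN'.
  by exists (exist _ N' (conj sN' PN')); split.
pose c := fix c k := if k is k'.+1 then sval (cid (next (c k')))
                     else exist _ I0 (conj sI0 PI0).
have cS k : sval (c k.+1) `<` sval (c k) by rewrite /=; case: cid.
have [k||N cN] := artR (I := fun k => sval (c k)).
- by apply: ideal_submod; case: (svalP (c k)).
- by move=> k x; case: (cS k) => cc _; apply: cc.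
by case: (cS N) => _; apply=> x; apply: cN.
Qed.

(** The descending chain of ideals generated by the powers of a is stationary. The relation provides
    an inverse of a wherever powers of a can be divided by or cancelled. *)
Lemma power_stable (a : R) : exists N c, a ^+ N = c * a ^+ N.+1.
Proof.
have [k||N cN] := artR (I := fun k x => exists c, x = c * a ^+ k).
- split; first by exists 0; rewrite mul0r.
    by move=> _ _ [c ->] [d ->]; exists (c + d); rewrite mulrDl.
  by move=> b _ [c ->]; exists (b * c); rewrite mulrA.
- by move=> k _ [c ->]; exists (c * a); rewrite exprS mulrA.
have [|c ac] := cN N.+1 (a ^+ N) (leqnSn N); first by exists 1; rewrite mul1r.
by exists N, c.
Qed.

(* A minimal ideal I that is not finitely generated is a vector space over the
   field R / ann(I). A submodule of I that is maximal among those avoiding some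
   w <> 0 is finitely generated, and together with w it generates I. *)
Lemma artinian_noetherian_ideal (I : set R^o) : submod I -> fg_submod I.
Proof.
move=> sI; apply: contrapT => nI.
have {sI nI} [{}I [sI nI Imin]] := artinian_min (P := fun I => ~ fg_submod I) sI nI.
have fgP J : submod J -> J `<=` I -> ~ (I `<=` J) -> fg_submod J.
  by move=> sJ JI nJ; apply: contrapT => nfJ; apply: nJ; apply: Imin.
have mula_lin (a : R) : linear (fun x : R^o => (a * x : R^o)).
  by move=> b x y; rewrite mulrDr; congr (_ + _); apply: mulrCA.
(* Otherwise the kernel and the image of multiplication by a on I are both proper in I, hence
   finitely generated by minimality, and then so is I. *)
have zero_or_onto a : (forall x, I x -> a * x = 0) \/ (forall y, I y -> exists2 x, I x & a * x = y).
  apply: contrapT => /not_orP[na ns]; apply: nI.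
  apply: (@fg_submod_ext _ _ _ (Lin (mula_lin a))) => //; apply: fgP.
  - exact: submod_image.
  - by move=> _ [x Ix <-]; apply: (submodZ a sI).
  - by move=> H; apply: ns => y /H [x Ix <-]; exists x.
  - apply: submodI => //; apply: (@submod_preim _ _ _ (Lin (mula_lin a)) [set 0]).
    exact: submod0.
  - by move=> x [].
  by move=> H; apply: na => x /H [].
have invertible a : ~ (forall x, I x -> a * x = 0) ->
    exists c, forall x, I x -> c * a * x = x.
  move=> na; have onto : forall y, I y -> exists2 x, I x & a * x = y.
    by case: (zero_or_onto a).
  have [N [c aN]] := power_stable a; exists c => x Ix.
  (* x is divisible by a^N inside I, and on multiples of a^N the relation a^N = c a^(N+1) says that
     c a acts as the identity. *)
  have [y Iy <-] : exists2 y, I y & a ^+ N * y = x.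
    elim: (N) x Ix => [|k IHk] x Ix; first by exists x; rewrite // mul1r.
    have [y Iy <-] := onto x Ix; have [z Iz <-] := IHk y Iy.
    by exists z; rewrite // exprS mulrA.
  by rewrite mulrA -(mulrA c) -exprS -aN.
have [w Iw w0] : exists2 w, I w & w <> 0.
  apply: contrapT => nw; apply: nI; apply: (@fg_submodP _ _ I [::]) => // v Iv /=.
  by apply: contrapT => nv; apply: nw; exists v.
(* Membership of 0 is left out of [P] because Zorn's lemma also takes the union of the empty chain.
   It is recovered afterwards: an empty N could be enlarged to the zero submodule. *)
pose P (N : set R^o) := [/\ N `<=` I, ~ N w & forall a x y, N x -> N y -> N (a *: x + y)].
have [|N [[NI Nw sN] Nmax]] := @Zorn_bigcup _ P.
  move=> F FP Ftot; split.
  - by move=> x [N /FP[NI _ _] /NI].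
  - by move=> [N /FP[]].
  - move=> a x y [N FN Nx] [N' FN' Ny]; have [NN'|NN'] := Ftot N N' FN FN'.
      by exists N'; rewrite //; case: (FP N' FN') => _ _; apply; rewrite //; apply: NN'.
    by exists N; rewrite //; case: (FP N FN) => _ _; apply; rewrite //; apply: NN'.
have N0 : N 0.
  apply: contrapT => N0.
  have Nempty x : ~ N x by move=> Nx; apply: N0; rewrite -(addNr x) -scaleN1r; apply: sN.
  apply: (Nmax [set 0]).
    by split=> [x /Nempty//|H]; case: (Nempty 0); apply: H.
  split; [by move=> _ -> ; case: sI | exact: w0 | by apply: (submod0 _).2].
have {}sN : submod N by split.
have [s Ns] : fg_submod N by apply: fgP => // /(_ w Iw).
apply: nI; apply: (@fg_submodP _ _ I (w :: s)) => // [x|x Ix].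
  rewrite inE => /orP[/eqP ->//|xs]; apply: NI.
  by rewrite Ns; apply: mem_span.
have [Nx|nNx] := EM (N x); first by exists 0, x; rewrite -Ns scale0r add0r.
(* By maximality of N, adding x must capture w. In w = n + a x the scalar a does not annihilate I,
   so it can be inverted to express x through w and N. *)
have : addset N (line x) w.
  apply: contrapT => nw; apply: (Nmax (addset N (line x))).
    split=> [y Ny|]; first by exists y, 0; rewrite addr0; split=> //; apply: (submod_line x).1.
    by move=> H; apply: nNx; apply: H; exists 0, x; rewrite add0r; split=> //; exists 1; rewrite scale1r.
  split=> //; last by apply: (submod_addset sN (submod_line x)).2.
  by move=> _ [y [z [Ny [b ->] ->]]]; apply: submodD => //; [apply: NI|apply: submodZ].
move=> [n [_ [Nn [a ->] wE]]].
have [|c ca] := invertible a.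
  move=> /(_ x Ix) ax; apply: Nw; rewrite wE.
  by have -> : a *: (x : R^o) = 0 := ax; rewrite addr0.
exists c, (- (c *: n)); rewrite -Ns; split; first by apply: submodN => //; apply: submodZ.
rewrite wE scalerDr addrAC subrr add0r scalerA.
by rewrite -[LHS]ca.
Qed.

Definition maximal_ideal (p : set R^o) :=
  [/\ submod p, ~ p 1 & forall a, ~ p a -> exists c, p (c * a - 1)].

Lemma colon_submod (V : lmodType R) (U : set V) x :
  submod U -> submod ([set r | U (r *: x)] : set R^o).
Proof.
move=> sU; split; first by rewrite /= scale0r; case: sU.
by move=> a r s /= Ur Us; rewrite scalerDl -scalerA; apply: sU.2.
Qed.

(** An ideal that is maximal among the annihilators of nonzero elements of V / U is prime, and
    [power_stable] makes every element outside it invertible modulo it. *)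
Lemma colon_maximal (V : lmodType R) (U : set V) : submod U -> (exists x, ~ U x) ->
  exists x, maximal_ideal [set r | U (r *: x)].
Proof.
move=> sU [x0 Ux0].
have [p [sp [x Ux pE] pmax]] := @noetherian_max _ _
  (fun p : set R^o => exists2 x, ~ U x & p = [set r | U (r *: x)]) [set r | U (r *: x0)]
  artinian_noetherian_ideal (colon_submod x0 sU) (ex_intro2 _ _ x0 Ux0 erefl).
exists x; rewrite -pE; split=> // [|a npa]; first by rewrite pE /= scale1r.
have pa r y : ~ U y -> p = [set r | U (r *: y)] -> U (r *: (a *: y)) -> U (r *: y).
  move=> nUy pE' Uray.
  have nUay : ~ U (a *: y) by move: npa; rewrite pE'.
  have : p r; last by rewrite pE'.
  apply: (pmax [set r | U (r *: (a *: y))]) => //; first exact: colon_submod.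
    by exists (a *: y).
  by move=> b; rewrite pE' /= scalerA mulrC -scalerA; exact: (submodZ _ sU).
have [N [c aN]] := power_stable a.
exists c; rewrite pE /=.
have : U ((c * a - 1) *: (a ^+ N *: x)).
  by rewrite scalerA mulrBl -mulrA -exprS -aN mul1r subrr scale0r; case: sU.
have pE'  k : ~ U (a ^+ k *: x) /\ p = [set r | U (r *: (a ^+ k *: x))].
  elim: k => [|k [nk pk]]; first by rewrite expr0 scale1r.
  split; first by rewrite exprS -scalerA; move: npa; rewrite {1}pk.
  apply/seteqP; split=> r; rewrite exprS -scalerA.
    by rewrite pk => Ur; rewrite /= [r *: (a *: _)]scalerA mulrC -scalerA; apply: submodZ.
  by move=> /= Ur; rewrite pk /=; apply: pa.
elim: (N) => [|k IHk]; first by rewrite expr0 scale1r.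
rewrite exprS -scalerA => /(pa _ _ _ _) H; apply: IHk; apply: H; by case: (pE' k).
Qed.

(* Composition series, as an induction principle on submodules. *)
Lemma submod_filtration_ind (V : lmodType R) (P : set (set V)) :
  noetherian V -> P [set 0] ->
  (forall U x, submod U -> maximal_ideal [set r | U (r *: x)] ->
     P U -> P (addset U (line x))) ->
  P setT.
Proof.
move=> nV P0 PS.
have [U [sU PU Umax]] := noetherian_max nV (submod0 V) P0.
suff -> : setT = U by [].
apply/esym/seteqP; split=> // x _; apply: contrapT => nUx.
have [|y my] := colon_maximal sU; first by exists x.
have sU' := submod_addset sU (submod_line y).
have xU : addset U (line y) `<=` U.
  by apply: Umax => //; [exact: PS | move=> z Uz; exists z, 0; rewrite addr0; split=> //; case: (submod_line y)].
case: my => _ n1 _; apply: n1; rewrite /= scale1r; apply: xU.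
by exists 0, y; rewrite add0r; split=> //; [case: sU | exists 1; rewrite scale1r].
Qed.

End ArtinianRing.

(** * Length, and the injective cogenerator *)

Section LengthBound.
Variable S : pzRingType.

(* Strict chains of submodules from U to W have length at most k. *)
Fixpoint length_le (V : lmodType S) (k : nat) (U W : set V) : Prop :=
  if k is k'.+1 then
    forall X, submod X -> U `<=` X -> X `<=` W -> ~ (X `<=` U) -> length_le k' X W
  else W `<=` U.

Lemma length_le_proper (V : lmodType S) k (U A X : set V) :
  submod A -> U `<=` A -> A `<=` X -> ~ (X `<=` A) ->
  length_le k.+1 U X -> length_le k U A.
Proof.
move=> sA + AX XA; elim: k U => [|k IHk] U UA H /=.
  by apply: contrapT => nAU; apply: XA; apply: (H A).
by move=> Y sY UY YA nYU; apply: IHk => //; apply: H => //; apply: subset_trans AX.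
Qed.

Lemma length_le_inj (V V' : lmodType S) (j : {linear V -> V'}) k (U W : set V) :
  (forall x, j x = 0 -> x = 0) ->
  length_le k (j @` U) (j @` W) -> length_le k U W.
Proof.
move=> ji; have inj := linear_inj ji.
elim: k U => [|k IHk] U /= H.
  by move=> x Wx; have [|y Uy /inj <-] := H (j x); first by exists x.
move=> X sX UX XW nXU; apply: IHk; apply: H; first exact: submod_image.
- by move=> _ [x /UX Xx <-]; exists x.
- by move=> _ [x /XW Xx <-]; exists x.
- by move=> H; apply: nXU => x Xx; have [|y Uy /inj <-] := H (j x); first by exists x.
Qed.

(** By the modular law, a proper enlargement of U strictly enlarges its intersection with B or its
    sum with B, so each step of a chain is paid for by a or by b. *)
Lemma length_leD (V : lmodType S) a b (U B C : set V) :
  submod B -> submod U -> submod C -> B `<=` C -> U `<=` C ->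
  length_le a (U `&` B) B -> length_le b (addset U B) C -> length_le (a + b) U C.
Proof.
move=> sB sU sC BC; move: {2}(a + b)%N (erefl (a + b)%N) => m.
elim: m a b U sU => [|m IHm] a b U sU.
  move=> /eqP; rewrite addn_eq0 => /andP[/eqP -> /eqP ->] UC /= BU CU x /CU[y [z [Uy /BU[Uz _] ->]]].
  exact: submodD.
move=> abE UC la lb; rewrite abE => X sX UX XC nXU.
have XBC : addset X B `<=` C.
  by move=> _ [y [z [/XC Cy /BC Cz ->]]]; apply: submodD.
have UXB : U `&` B `<=` X `&` B by move=> x [/UX].
have UXA : addset U B `<=` addset X B.
  by move=> _ [y [z [/UX Xy Bz ->]]]; exists y, z.
have [XBU|nXBU] := EM (X `&` B `<=` U `&` B).
  have nXA : ~ (addset X B `<=` addset U B).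
    move=> H; apply: nXU => x Xx.
    have [|u [z [Uu Bz xE]]] := H x.
      by exists x, 0; rewrite addr0; split=> //; case: sB.
    have [|Uz _] := XBU z; last by rewrite xE; apply: submodD.
    split=> //; have -> : z = x - u by rewrite xE addrAC subrr add0r.
    by apply: submodB => //; apply: UX.
  case: b abE lb => [|b] abE lb.
    by case: nXA; apply: subset_trans lb.
  move: abE; rewrite addnS => -[abE]; rewrite -abE; apply: IHm => //.
    by have -> : X `&` B = U `&` B by apply/seteqP; split.
  by apply: lb => //; exact: submod_addset.
case: a abE la => [|a] abE la.
  by case: nXBU => x [_ /la].
move: abE; rewrite addSn => -[abE]; rewrite -abE; apply: IHm => //.
  by apply: la => //; exact: submodI.
have [H|H] := EM (addset X B `<=` addset U B).
  by have -> : addset X B = addset U B by apply/seteqP; split.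
(* For the case in which both the intersection and the sum grow: only a is decreased, and the bound
   b survives raising the lower end. *)
have mono_le : forall k (Y Z : set V), submod Z -> Y `<=` Z -> Z `<=` C ->
    length_le k Y C -> length_le k Z C.
  elim=> [|k IHk] Y Z sZ YZ ZC /=; first by move=> H'; apply: subset_trans YZ.
  move=> H' X' sX' ZX' X'C nX'; apply: H' => //; first exact: subset_trans ZX'.
  by move=> X'Y; apply: nX'; apply: subset_trans YZ.
by apply: mono_le lb => //; exact: submod_addset.
Qed.

End LengthBound.

Section LinmapModule.
Variables (R : comPzRingType) (U V : lmodType R).

Fact linmap_scale_linear a (f : linmap U V) : linear (fun x => a *: f x).
Proof. by move=> b x y; rewrite linearP scalerDr !scalerA mulrC. Qed.

Definition linmap_scale a (f : linmap U V) : linmap U V := Lin (linmap_scale_linear a f).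

Fact linmap_scaleA a b f : linmap_scale a (linmap_scale b f) = linmap_scale (a * b) f.
Proof. by apply: linmapP => x /=; rewrite scalerA. Qed.
Fact linmap_scale1 : left_id 1 linmap_scale.
Proof. by move=> f; apply: linmapP => x /=; rewrite scale1r. Qed.
Fact linmap_scaleDr : right_distributive linmap_scale +%R.
Proof. by move=> a f g; apply: linmapP => x /=; rewrite scalerDr. Qed.
Fact linmap_scaleDl f : {morph linmap_scale^~ f : a b / a + b}.
Proof. by move=> a b; apply: linmapP => x /=; rewrite scalerDl. Qed.

HB.instance Definition _ := GRing.Zmodule_isLmodule.Build R (linmap U V)
  linmap_scaleA linmap_scale1 linmap_scaleDr linmap_scaleDl.

End LinmapModule.

Section MatlisModule.
Variable R : comPzRingType.
Hypothesis artR : artinian R.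

Let noethR (V : lmodType R) : fin_gen V -> noetherian V.
Proof. by apply: noetherian_fin_gen => I; apply: artinian_noetherian_ideal. Qed.

(* Each residue field occurs at most once in the socle of E. *)
Definition thin_socle (E : lmodType R) := forall (p : set R^o) (y z : E),
  maximal_ideal p -> (forall r, p r -> r *: y = 0) -> (forall r, p r -> r *: z = 0) ->
  y <> 0 -> exists c, z = c *: y.

Definition killed_by (E : lmodType R) (I : set R^o) : set E :=
  [set y | forall r, I r -> r *: y = 0].

Lemma submod_killed_by (E : lmodType R) I : submod (@killed_by E I).
Proof.
split=> [r _|a x y kx ky r Ir]; first by rewrite scaler0.
by rewrite scalerDr scalerA mulrC -scalerA kx // ky // scaler0 addr0.
Qed.

(* A composition series of R cuts E into the pieces killed by I but not by
   I + R a, which multiplication by a embeds into a component of the socle. *)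
Lemma length_bound : exists N, forall E : lmodType R, thin_socle E ->
  length_le N [set (0 : E)] setT.
Proof.
suff [N HN] : exists N, forall E : lmodType R, thin_socle E ->
    length_le N (@killed_by E setT) setT.
  exists N => E tE; rewrite (_ : [set 0] = killed_by setT); first exact: HN.
  apply/seteqP; split=> [_ -> r _|y ky]; first by rewrite scaler0.
  by rewrite /= -[y]scale1r ky.
apply: (@submod_filtration_ind R artR R^o (fun I => exists N, forall E : lmodType R,
  thin_socle E -> length_le N (@killed_by E I) setT)).
- by apply: noethR; apply: fin_gen_regular.
- by exists 0%N => E _ y _ r ->; rewrite scale0r.
move=> I a sI mI [N HN]; exists N.+1 => E tE.
have kk : @killed_by E (addset I (line a)) `<=` killed_by I.
  move=> y ky r Ir; apply: ky; exists r, 0; rewrite addr0; split=> //.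
  by case: (submod_line a).
rewrite -add1n; apply: (@length_leD _ _ _ _ _ (killed_by I)) => //; try exact: submod_killed_by.
- move=> X sX kX XI nX x Ix.
  have [v [Xv nv]] : exists v, X v /\ ~ killed_by (addset I (line a)) v.
    apply: contrapT => H; apply: nX => v Xv; split; last exact: XI.
    by apply: contrapT => nv; apply: H; exists v.
  have Iv := XI v Xv.
  have smul (y : E) : killed_by I y -> forall r, I (r *: a) -> r *: ((a : R) *: y) = 0.
    by move=> Iy r Ira; rewrite scalerA Iy.
  have kadd (y : E) : killed_by I y -> (a : R) *: y = 0 -> killed_by (addset I (line a)) y.
    move=> Iy ay _ [r [_ [Ir [b ->] ->]]].
    by rewrite scalerDl Iy // add0r -scalerA ay scaler0.
  (* Both a v and a x are killed by the maximal ideal of all r with r a in I, and a v is not zero.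
     Thinness gives a x = c (a v), so x - c v is killed by a as well. *)
  have [|c aE] := tE _ _ ((a : R) *: x) mI (smul v Iv) (smul x Ix).
    by move=> av; apply: nv; apply: kadd.
  have -> : x = (x - c *: v) + c *: v by rewrite subrK.
  apply: submodD => //; last exact: submodZ.
  have Ixv : killed_by I (x - c *: v).
    exact: (submodB (submod_killed_by E I) Ix (submodZ c (submod_killed_by E I) Iv)).
  apply: kX; split=> //; apply: kadd => //.
  by rewrite scalerBr aE !scalerA mulrC subrr.
have -> : addset (killed_by (addset I (line a))) (killed_by I) = @killed_by E I; last exact: HN.
apply/seteqP; split=> [_ [y [z [/kk Iy Iz ->]]]|y Iy].
  exact: (submodD (submod_killed_by E I) Iy Iz).
by exists 0, y; rewrite add0r; split=> // r _; rewrite scaler0.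
Qed.

(** The least bound k on the lengths of thin modules is attained by some E, since otherwise k - 1
    would be a bound. A thin module properly containing E would exceed k. *)
Lemma maximal_thin : exists E : fgmod R, thin_socle E /\
  forall (E' : fgmod R) (j : {linear E -> E'}), thin_socle E' ->
    (forall x, j x = 0 -> x = 0) -> forall y, exists x, j x = y.
Proof.
pose Q k := forall E : fgmod R, thin_socle E -> length_le k [set (0 : E)] setT.
have [N HN] := length_bound.
have exQ : exists k, `[<Q k>] by exists N; apply/asboolP => E; apply: HN.
have [k /asboolP Qk kmin] := find_ex_minn exQ.
have [E [tE Emax]] : exists E : fgmod R, thin_socle E /\
    (forall k', k = k'.+1 -> ~ length_le k' [set (0 : E)] setT).
  case: k Qk kmin => [|k] Qk kmin.
    exists (Fgmod (fin_gen_ffun 0 (fin_gen_regular R))); split=> // p y z _ _ _ [].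
    by apply/ffunP => -[].
  apply: contrapT => nE.
  suff /kmin : `[<Q k>] by rewrite ltnn.
  apply/asboolP => E tE; apply: contrapT => nl; apply: nE; exists E; split=> // k' [<-].
  exact: nl.
exists E; split=> // E' j tE' ji y; apply: contrapT => ny.
have := Qk E' tE'; case: k Emax {Qk kmin} => [|k] Emax lE.
  have y0 := lE y Logic.I; apply: ny; exists 0; rewrite raddf0; exact/esym.
apply: (Emax k erefl); apply: (length_le_inj ji).
have -> : j @` [set 0] = [set 0].
  by apply/seteqP; split=> [_ [_ -> <-]|_ ->]; [rewrite raddf0|exists 0; rewrite ?raddf0].
apply: length_le_proper lE => //; first exact: (submod_image _ (submodT _)).
- by move=> _ ->; exists 0; rewrite ?raddf0.
- by move=> H; apply: ny; have [x _ <-] := H y Logic.I; exists x.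
Qed.

End MatlisModule.

(** Extension is asked along every f whose kernel is killed by g, so that no passage to the image of
    f is needed when it is applied. *)
Definition relatively_injective (S : pzRingType) (I : lmodType S) :=
  forall (U V : lmodType S) (f : {linear U -> V}) (g : {linear U -> I}),
    fin_gen V -> (forall u, f u = 0 -> g u = 0) ->
    exists h : {linear V -> I}, forall u, h (f u) = g u.

Definition cogenerator (S : pzRingType) (I : lmodType S) :=
  forall (V : lmodType S) (v : V), fin_gen V -> v <> 0 ->
    exists h : {linear V -> I}, h v <> 0.

(** This is the surjectivity of the map from V to its double dual; its injectivity is the property
    [cogenerator]. *)
Definition reflexive_for (R : comPzRingType) (E : lmodType R) :=
  forall (V : lmodType R) (Phi : {linear linmap V E -> E}), fin_gen V ->
    exists v, forall h : linmap V E, Phi h = h v.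

Section LinearPairing.
Variables (S : pzRingType) (U V W : lmodType S).

Fact copair_linear (f : {linear U -> W}) (g : {linear V -> W}) :
  linear (fun p : (U * V)%type => f p.1 + g p.2).
Proof. by move=> a p q; rewrite !linearP addrACA scalerDr. Qed.
Definition copair f g : {linear (U * V)%type -> W} := Lin (copair_linear f g).

Fact pair_linear (f : {linear W -> U}) (g : {linear W -> V}) :
  linear (fun w => (f w, g w) : (U * V)%type).
Proof. by move=> a x y; rewrite !linearP. Qed.
Definition pairing f g : {linear W -> (U * V)%type} := Lin (pair_linear f g).

Fact inl_linear : linear (fun u => (u, 0) : (U * V)%type).
Proof. by move=> a x y; congr (_, _); rewrite /= scaler0 addr0. Qed.
Definition lin_inl : {linear U -> (U * V)%type} := Lin inl_linear.

Fact inr_linear : linear (fun v => (0, v) : (U * V)%type).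
Proof. by move=> a x y; congr (_, _); rewrite /= scaler0 addr0. Qed.
Definition lin_inr : {linear V -> (U * V)%type} := Lin inr_linear.

End LinearPairing.

Section Times.
Variables (R : pzRingType) (V : lmodType R) (x : V).
Fact scale_elt_linear : linear (fun r : R^o => (r : R) *: x).
Proof. by move=> a r s; rewrite scalerDl -scalerA. Qed.
Definition scale_elt : {linear R^o -> V} := Lin scale_elt_linear.
End Times.

(** * Matlis duality for a maximal thin module *)

Section MatlisDuality.
Variable R : comPzRingType.
Hypothesis artR : artinian R.

Let noethR (V : lmodType R) : fin_gen V -> noetherian V.
Proof. by apply: noetherian_fin_gen => I; apply: artinian_noetherian_ideal. Qed.

Variable E : fgmod R.
Hypothesis thinE : thin_socle E.
Hypothesis maxE : forall (E' : fgmod R) (j : {linear E -> E'}), thin_socle E' ->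
    (forall x, j x = 0 -> x = 0) -> forall y, exists x, j x = y.

(** Otherwise the sum of E and R / p would be a larger thin module: at maximal ideals containing p
    its socle comes from R / p alone, at all others from E alone. *)
Lemma socle_nonzero (p : set R^o) : maximal_ideal p ->
  exists2 y : E, y <> 0 & forall r, p r -> r *: y = 0.
Proof.
move=> mp; have [sp p1 pmax] := mp.
apply: contrapT => nsoc; have soc0 (y : E) : (forall r, p r -> r *: y = 0) -> y = 0.
  by move=> py; apply: contrapT => y0; apply: nsoc; exists y.
pose E' := Fgmod (fin_gen_prod (fgmP E)
  (fin_gen_onto (quot_proj_onto (sN := sp)) (fin_gen_regular R))).
have ji (x : E) : lin_inl E (quotient sp) x = 0 -> x = 0 by case.
have cls (s : quotient sp) r : p r -> r *: s = 0.
  have [a <-] := quot_proj_onto s => pr; rewrite -linearZ.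
  by apply/quot_proj_eq0; have := submodZ a sp pr; rewrite -[a *: r]/(a * r) mulrC.
have [|x] := @maxE E' (lin_inl E (quotient sp)) _ ji (0, quot_proj sp 1).
  move=> p' [e s] [e' s'] mp' ke ke' nz; have [sp' p'1 pmax'] := mp'.
  have [pp'|npp'] := EM (p `<=` p').
    have e0 : e = 0 by apply: soc0 => r /pp' /ke [].
    have e'0 : e' = 0 by apply: soc0 => r /pp' /ke' [].
    have s0 : s <> 0 by move=> s0; apply: nz; rewrite e0 s0.
    have [a aE] := quot_proj_onto s; have [b bE] := quot_proj_onto s'.
    have na : ~ p a by move=> pa; apply: s0; rewrite -aE; apply/quot_proj_eq0.
    have [c pc] := pmax a na; exists (b * c); rewrite e0 e'0.
    congr (_, _); first exact/esym/scaler0.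
    rewrite -aE -bE /= -linearZ; apply/eqP; rewrite -subr_eq0 -raddfB; apply/eqP/quot_proj_eq0.
    rewrite -opprB; apply: submodN => //.
    have -> : (b * c) *: a - b = (b : R) *: (c * a - 1) :> R^o.
      by rewrite -[(b * c) *: a]/(b * c * a) -[b *: _]/(b * _) mulrBr mulr1 mulrA.
    exact: submodZ.
  have [a pa np'a] : exists2 a, p a & ~ p' a.
    by apply: contrapT => H; apply: npp' => a pa; apply: contrapT => na; apply: H; exists a.
  have [c p'c] := pmax' a np'a.
  have s0 (t : quotient sp) : (forall r, p' r -> r *: t = 0) -> t = 0.
    move=> kt; have := kt _ p'c; rewrite scalerBl scale1r -scalerA (cls t a pa) scaler0 sub0r.
    by move/eqP; rewrite oppr_eq0 => /eqP.
  have -> : s' = 0 by apply: s0 => r p'r; exact: (congr1 snd (ke' r p'r)).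
  have s00 : s = 0 by apply: s0 => r p'r; exact: (congr1 snd (ke r p'r)).
  have [|||c' e'E] := thinE mp' (y := e) (z := e').
  - by move=> r /ke [].
  - by move=> r /ke' [].
  - by move=> e0; apply: nz; rewrite e0 s00.
  by exists c'; rewrite e'E s00; congr (_, _); exact/esym/scaler0.
move=> [_ /esym/quot_proj_eq0 pr1]; exact: p1.
Qed.

(** Let N be maximal among the submodules of the sum of E and V that contain all (g u, - f u) and
    meet E trivially. Then E is essential in the quotient by N, so the quotient is still thin and
    equals E by maximality. The image of V in it is the extension. *)
Lemma maximal_relatively_injective : relatively_injective E.
Proof.
move=> U V f g fgV kfg.
pose N0 : set (E * V)%type := range (pairing g (linmap_opp f)).
have sN0 : submod N0 by apply: submod_image; apply: submodT.
have fgEV := fin_gen_prod (fgmP E) fgV.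
have [|N [sN [N0N NE] Nmax]] := @noetherian_max _ _
  (fun N => N0 `<=` N /\ forall e, N (e, 0) -> e = 0) N0 (noethR fgEV) sN0 _.
  split=> // e [u _ [ge /eqP]]; rewrite oppr_eq0 => /eqP fu.
  by rewrite -ge; apply: kfg.
have [j jE] : exists j : {linear E -> quotient sN}, forall x, j x = quot_proj sN (x, 0).
  by exists (linmap_comp (quot_proj sN) (lin_inl E V)).
have ji x : j x = 0 -> x = 0 by rewrite jE => /quot_proj_eq0; apply: NE.
have [|h hE] := @factor_inj _ _ _ _ j (linmap_comp (quot_proj sN) (lin_inr E V)) ji.
  move=> v; apply: (@maxE (Fgmod (fin_gen_onto (quot_proj_onto (sN := sN)) fgEV)) j) => //.
  (* Essentiality of E: a nonzero y killed by p spans a simple module, which meets E and therefore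
     lies in it. *)
  have soc p (y : quotient sN) : maximal_ideal p -> (forall r, p r -> r *: y = 0) ->
      exists2 e : E, y = j e & forall r, p r -> r *: e = 0.
    move=> [sp p1 pmax] ky; suff [e yE] : exists e, y = j e.
      by exists e => // r pr; apply: ji; rewrite linearZ /= -yE; apply: ky.
    have [w wE] := quot_proj_onto y.
    have [Nw|nNw] := EM (N w).
      by exists 0; rewrite raddf0 -wE; apply/quot_proj_eq0.
    have sN' := submod_addset sN (submod_line w).
    have NN' : N `<=` addset N (line w).
      by move=> z Nz; exists z, 0; rewrite addr0; split=> //; case: (submod_line w).
    have [e [n [_ [Nn [r ->] enE]]] e0] : exists2 e, addset N (line w) (e, 0) & e <> 0.
      apply: contrapT => H; apply: nNw; apply: (Nmax _ sN') => //.
        split; first exact: subset_trans NN'.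
        by move=> e Ne; apply: contrapT => e0; apply: H; exists e.
      exists 0, w; rewrite add0r; split=> //; first exact: sN.1.
      by exists 1; rewrite scale1r.
    have jeE : j e = (r : R) *: y.
      rewrite jE enE raddfD /= linearZ /= wE.
      have n0 : quot_proj sN n = 0 by apply/quot_proj_eq0.
      by rewrite n0 add0r.
    have npr : ~ p r by move=> pr; apply: e0; apply: ji; rewrite jeE ky.
    have [c pc] := pmax r npr; exists (c *: e).
    have := ky _ pc; rewrite scalerBl scale1r -scalerA -jeE -linearZ => /eqP.
    by rewrite subr_eq0 => /eqP.
  move=> p y z mp ky kz y0.
  have [e yE ke] := soc p y mp ky; have [e' zE ke'] := soc p z mp kz.
  have [|c e'E] := thinE mp ke ke'; first by move=> e0; apply: y0; rewrite yE e0 raddf0.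
  by exists c; rewrite zE yE -linearZ e'E.
exists h => u; apply/eqP; rewrite -subr_eq0; apply/eqP; apply: ji.
rewrite raddfB /= hE jE /= -raddfB; apply/quot_proj_eq0.
rewrite -opprB; apply: submodN => //; apply: N0N; exists u => //.
by congr (_, _); rewrite /= ?subr0 ?sub0r.
Qed.

(** Some multiple of v spans a simple module R / p. It maps nontrivially to the p-part of the socle
    of E, and injectivity extends this map to V. *)
Lemma maximal_cogenerator : cogenerator E.
Proof.
move=> V v fgV v0.
have sa : submod ([set r : R^o | (r : R) *: v = 0]).
  exact: (@submod_preim _ _ _ (scale_elt v) [set 0] (submod0 V)).
have [|x] := colon_maximal artR sa; first by exists 1; rewrite /= scale1r.
set p := [set r | _] => mp; have [y y0 py] := socle_nonzero mp.
have [|h hE] := @maximal_relatively_injective _ _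
    (scale_elt ((x : R) *: v)) (scale_elt y) fgV.
  by move=> r /= rxv; apply: py; rewrite /p /= -[r *: x]/(r * x) -scalerA.
exists h => hv; apply: y0; rewrite -[y]scale1r -[1 *: y]/(scale_elt y 1) -hE /=.
by rewrite scale1r linearZ /= hv scaler0.
Qed.

(** Along a composition series of V, every functional on the dual that vanishes on the maps killing
    U is evaluation at an element of U; U = V is the claim. *)
Lemma maximal_reflexive : reflexive_for E.
Proof.
move=> V Phi fgV.
suff: forall Psi : {linear linmap V E -> E},
    (forall h : linmap V E, (forall v, setT v -> h v = 0) -> Psi h = 0) ->
    exists2 v, setT v & forall h : linmap V E, Psi h = h v.
  case/(_ Phi) => [h h0|v _ vE]; last by exists v.
  have -> : h = 0 by apply: linmapP => v; rewrite h0.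
  by rewrite raddf0.
apply: (submod_filtration_ind artR (P := fun U : set V =>
  forall Psi : {linear linmap V E -> E},
    (forall h : linmap V E, (forall v, U v -> h v = 0) -> Psi h = 0) ->
    exists2 v, U v & forall h : linmap V E, Psi h = h v)).
- exact: noethR.
- move=> Psi Psi0; exists 0 => // h; rewrite raddf0; apply: Psi0.
  by move=> _ ->; rewrite raddf0.
move=> U x sU mp IH Psi Psi0; have [sp p1 pmax] := mp.
have [y y0 py] := socle_nonzero mp.
(* [h0] kills U and sends x to the socle element y. A map killing U takes x to a multiple of y, so
   on such maps [Psi] is determined by [Psi h0] = s y; subtracting evaluation at s x reduces to
   U. *)
have [|h0 h0E] := @maximal_relatively_injective (submodule sU * R^o)%type V
   (copair (sub_incl sU) (scale_elt x)) (copair \0 (scale_elt y)) fgV.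
  move=> [u r] /= uE; rewrite add0r; apply: py => /=.
  have -> : r *: x = - sub_incl sU u by apply/eqP; rewrite -addr_eq0 addrC uE.
  by apply: submodN => //; apply: sub_inclP.
have h0U u : U u -> h0 u = 0.
  move=> /(sub_incl_onto sU)[w <-].
  by have := h0E (w, 0); rewrite /= !scale0r !addr0.
have h0x : h0 x = y.
  by have := h0E (0, 1); rewrite /= raddf0 !scale1r !add0r.
have [||s sE] := thinE mp py (z := Psi h0); last 1 first.
- have psi_lin : linear (fun h : linmap V E => Psi h - h ((s : R) *: x)).
    move=> a h h'; rewrite linearP /= scalerBr opprD addrACA.
    by congr (_ + _).
  have [|v Uv vE] := IH (Lin psi_lin).
    move=> h hU /=; rewrite linearZ /=.
    have [||r hx] := thinE mp py (z := h x); last 1 first.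
    - have : Psi (h - r *: (h0 : linmap V E)) = 0.
        apply: Psi0 => _ [u [_ [Uu [b ->] ->]]].
        rewrite -[LHS]/(h (u + b *: x) - r *: h0 (u + b *: x)) !raddfD /= !linearZ /= hU // h0U // !add0r h0x hx.
        by rewrite oppr0 scaler0 add0r !scalerN !scalerA mulrC subrr.
      rewrite raddfB /= linearZ /= => /eqP; rewrite subr_eq0 => /eqP ->.
      by rewrite sE hx !scalerA mulrC subrr.
    - by move=> b pb; rewrite -linearZ hU.
    - exact: y0.
  exists (v + (s : R) *: x); first by exists v, (s *: x); split=> //; exists s.
  by move=> h; rewrite raddfD /=; have /= <- := vE h; rewrite subrK.
- move=> r pr; rewrite -linearZ; apply: Psi0 => _ [u [_ [Uu [b ->] ->]]].
  by rewrite -[LHS]/(r *: h0 (u + b *: x)) raddfD /= linearZ /= h0U // h0x add0r scalerA mulrC -scalerA py // scaler0.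
- exact: y0.
Qed.

End MatlisDuality.

Lemma matlis_module (R : comPzRingType) : artinian R ->
  exists E : fgmod R, [/\ relatively_injective E, cogenerator E & reflexive_for E].
Proof.
move=> artR; have [E [tE mE]] := maximal_thin artR.
exists E; split; [exact: maximal_relatively_injective | exact: maximal_cogenerator
  | exact: maximal_reflexive].
Qed.

(** * Extension groups *)

Definition short_exact (S : pzRingType) (A X B : lmodType S)
    (i : {linear A -> X}) (p : {linear X -> B}) :=
  [/\ forall a, i a = 0 -> a = 0, forall x, p x = 0 <-> exists a, i a = x
    & forall b, exists x, p x = b].

(* Ext^1(A, Y) = 0 in the sense of Yoneda. *)
Definition ext1_splits (S : pzRingType) (A Y : fgmod S) :=
  forall (Z : fgmod S) (k : {linear Y -> Z}) (q : {linear Z -> A}),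
    short_exact k q -> exists s : {linear A -> Z}, forall a, q (s a) = a.

Section FreeModule.
Variables (S : pzRingType) (k : nat).

Definition free_gen (i : 'I_k) : {ffun 'I_k -> S^o} := [ffun j => if j == i then 1 else 0].

Lemma free_decomp (c : {ffun 'I_k -> S^o}) : c = \sum_i (c i : S) *: free_gen i.
Proof.
apply/ffunP => i; rewrite sum_ffunE (bigD1 i) //= big1 => [|j ji].
  by rewrite addr0 !ffunE eqxx; apply/esym/mulr1.
by rewrite !ffunE eq_sym (negbTE ji) scaler0.
Qed.

Lemma free_ext (V : lmodType S) (f g : {linear {ffun 'I_k -> S^o} -> V}) :
  (forall i, f (free_gen i) = g (free_gen i)) -> f =1 g.
Proof.
move=> fg c; rewrite (free_decomp c) !raddf_sum; apply: eq_bigr => i _.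
by rewrite /= !linearZ /= fg.
Qed.

Fact comb_linear (V : lmodType S) (v : 'I_k -> V) :
  linear (fun c : {ffun 'I_k -> S^o} => \sum_i (c i : S) *: v i).
Proof.
move=> a x y; rewrite scaler_sumr -big_split; apply: eq_bigr => i _ /=.
by rewrite !ffunE scalerDl scalerA.
Qed.
Definition comb (V : lmodType S) (v : 'I_k -> V) : {linear {ffun 'I_k -> S^o} -> V} :=
  Lin (comb_linear v).

Lemma comb_gen (V : lmodType S) (v : 'I_k -> V) i : comb v (free_gen i) = v i.
Proof.
rewrite /= (bigD1 i) //= big1 => [|j ji]; first by rewrite addr0 ffunE eqxx scale1r.
by rewrite ffunE (negbTE ji) scale0r.
Qed.

End FreeModule.

Arguments free_gen {S k}.

Section Ext.
Variable S : pzRingType.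
Hypothesis noethS : forall V : lmodType S, fin_gen V -> noetherian V.
Hypothesis enough_injectives : forall Y : fgmod S,
  exists (I : fgmod S) (j : {linear Y -> I}),
    relatively_injective I /\ forall y, j y = 0 -> y = 0.

Implicit Types A B X Y Z : fgmod S.

Definition sub_fgmod X (N : set X) (sN : submod N) : fgmod S :=
  Fgmod (fg_submod_fin_gen sN (noethS (fgmP X) sN)).

Definition quot_fgmod (V : lmodType S) (fgV : fin_gen V) (N : set V) (sN : submod N) : fgmod S :=
  Fgmod (fin_gen_onto (quot_proj_onto (sN := sN)) fgV).

Lemma submod_ker (U V : lmodType S) (f : {linear U -> V}) : submod [set u | f u = 0].
Proof. exact: (@submod_preim _ _ _ f [set 0] (submod0 V)). Qed.

Lemma kernel_ses X B (p : {linear X -> B}) : (forall b, exists x, p x = b) ->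
  exists (A : fgmod S) (i : {linear A -> X}), short_exact i p.
Proof.
move=> ps; exists (sub_fgmod (submod_ker p)), (sub_incl (submod_ker p)); split=> //.
  exact: sub_incl_eq0.
move=> x; split=> [px|[a <-]]; first exact: sub_incl_onto.
exact: (sub_inclP a).
Qed.

Lemma cokernel_ses A X (i : {linear A -> X}) : (forall a, i a = 0 -> a = 0) ->
  exists (B : fgmod S) (p : {linear X -> B}), short_exact i p.
Proof.
move=> ii; have sI := submod_image i (submodT A).
exists (quot_fgmod (fgmP X) sI), (quot_proj sI); split=> //; last exact: quot_proj_onto.
move=> x; split=> [/quot_proj_eq0[a _ <-]|[a <-]]; first by exists a.
by apply/quot_proj_eq0; exists a.
Qed.

Lemma retraction_section Y Z A (k : {linear Y -> Z}) (q : {linear Z -> A})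
    (r : {linear Z -> Y}) : short_exact k q -> (forall y, r (k y) = y) ->
  exists s : {linear A -> Z}, forall a, q (s a) = a.
Proof.
move=> [ki kq qs] rk.
have f_lin : linear (fun z => z - k (r z)).
  by move=> a x y; rewrite (linearP r) (linearP k) scalerBr opprD addrACA.
have [|s sE] := @factor_surj _ _ _ _ q (Lin f_lin) qs.
  by move=> _ /kq[y <-] /=; rewrite rk subrr.
exists s => a; have [z <-] := qs a; rewrite sE raddfB /=.
by have /= -> : q (k (r z)) = 0 by [apply/kq; exists (r z)]; rewrite subr0.
Qed.

Lemma injective_ext1 A (I : fgmod S) : relatively_injective I -> ext1_splits A I.
Proof.
move=> inj Z k q kq; have [ki _ _] := kq.
have [|r rk] := inj _ _ k idfun (fgmP Z); first by move=> u /ki.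
exact: (retraction_section (r := r) kq).
Qed.

Section ShortExact.
Variables (A X B : fgmod S) (i : {linear A -> X}) (p : {linear X -> B}).
Hypothesis ip : short_exact i p.

Lemma ses_comp0 a : p (i a) = 0.
Proof. by case: ip => _ kp _; apply/kp; exists a. Qed.

Lemma ses_factor_inj (U : lmodType S) (f : {linear U -> X}) : (forall u, p (f u) = 0) ->
  exists g : {linear U -> A}, forall u, i (g u) = f u.
Proof. by case: ip => ii kp _ pf; apply: factor_inj => // u; apply/kp. Qed.

Lemma ses_factor_surj (U : lmodType S) (f : {linear X -> U}) : (forall a, f (i a) = 0) ->
  exists g : {linear B -> U}, forall x, g (p x) = f x.
Proof.
by case: ip => _ kp ps fi; apply: factor_surj => // x /kp[a <-].
Qed.

(* Pull the sequence back along f. *)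
Lemma ext1_lift Y : ext1_splits Y A ->
  forall f : {linear Y -> B}, exists g : {linear Y -> X}, forall y, p (g y) = f y.
Proof.
move=> eYA f; have [ii kp ps] := ip.
pose XY := Fgmod (fin_gen_prod (fgmP X) (fgmP Y)).
have sN : submod ([set z | p z.1 = f z.2] : set XY).
  split; first by rewrite /= !raddf0.
  by move=> a x y /= ex ey; rewrite !linearP ex ey.
pose j := sub_incl sN.
have [k kE] : exists k : {linear A -> sub_fgmod sN}, forall a, j (k a) = (i a, 0).
  apply: (factor_inj (g := pairing i \0) (@sub_incl_eq0 _ _ _ _)) => a.
  by apply: sub_incl_onto; rewrite /= ses_comp0 raddf0.
pose q : {linear sub_fgmod sN -> Y} := linmap_comp (snd : {linear XY -> Y}) j.
have qE z : q z = (j z).2 by [].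
have jP z : p (j z).1 = f (j z).2 by exact: (sub_inclP z).
have [|s sE] := eYA _ k q.
  split.
  - by move=> a ka; apply: ii; have := kE a; rewrite ka raddf0 => -[].
  - move=> z; split=> [|[a <-]]; last by rewrite /q /= kE.
    rewrite qE => q0; have := jP z; rewrite q0 raddf0 => /kp[a aE]; exists a.
    apply: (linear_inj (@sub_incl_eq0 _ _ _ sN)); rewrite -[LHS]/(j (k a)) kE aE.
    by rewrite -[RHS]/(j z); move: q0; case: (j z) => u v /= ->.
  move=> y; have [x xE] := ps (f y).
  by have [z zE] := @sub_incl_onto _ _ _ sN (x, y) xE; exists z; rewrite /q /= -/j zE.
exists (linmap_comp (fst : {linear XY -> X}) (linmap_comp j s)) => y.
rewrite -[in RHS](sE y); exact: jP.
Qed.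

(* Push the sequence out along f. *)
Lemma ext1_extend Y : ext1_splits B Y ->
  forall f : {linear A -> Y}, exists g : {linear X -> Y}, forall a, g (i a) = f a.
Proof.
move=> eBY f; have [ii kp ps] := ip.
pose YX := Fgmod (fin_gen_prod (fgmP Y) (fgmP X)).
have sN := submod_image (pairing f (linmap_opp i) : {linear A -> YX}) (submodT A).
pose Z := quot_fgmod (fgmP YX) sN; pose c : {linear YX -> Z} := quot_proj sN.
have cE a : c (f a, 0) = c (0, i a).
  apply/eqP; rewrite -subr_eq0 -raddfB; apply/eqP/quot_proj_eq0.
  by exists a => //; congr (_, _); rewrite /= ?subr0 ?sub0r.
have [q qE] : exists q : {linear Z -> B}, forall z, q (c z) = p z.2.
  apply: (factor_surj (g := linmap_comp p (snd : {linear YX -> X}))) => [z|z].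
    exact: quot_proj_onto.
  by move=> /quot_proj_eq0[a _ <-] /=; rewrite raddfN /= ses_comp0 oppr0.
pose k : {linear Y -> Z} := linmap_comp c (lin_inl Y X).
have kq : short_exact k q.
  split.
  - move=> y /quot_proj_eq0[a _ [<- /eqP]]; rewrite oppr_eq0 => /eqP ia.
    by rewrite (ii a ia) raddf0.
  - move=> z; split=> [|[y <-]]; last by rewrite /k /= qE /= raddf0.
    have [[y x] <-] := quot_proj_onto z; rewrite -/c qE /= => /kp[a <-].
    exists (y + f a); rewrite /k /=.
    have -> : (y, i a) = (y, 0) + (0, i a) :> YX by congr (_, _); rewrite /= ?addr0 ?add0r.
    have -> : (y + f a, 0) = (y, 0) + (f a, 0) :> YX by congr (_, _); rewrite /= ?addr0.
    by rewrite !raddfD /= cE.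
  by move=> b; have [x xE] := ps b; exists (c (0, x)); rewrite qE.
have [ki kqE qs] := kq; have [s sE] := eBY Z k q kq.
have f_lin : linear (fun z => z - s (q z)).
  by move=> a x y; rewrite (linearP q) (linearP s) scalerBr opprD addrACA.
have [|r rE] := @factor_inj _ _ _ _ k (Lin f_lin) ki.
  by move=> z; apply/kqE; rewrite /= raddfB /= sE subrr.
exists (linmap_comp r (linmap_comp c (lin_inr Y X))) => a.
by apply: (linear_inj ki); rewrite -[LHS]/(k (r (c (0, i a)))) rE -cE /= qE /= !raddf0 addr0 //.
Qed.

End ShortExact.

Lemma sub_linear (U V : lmodType S) (f g : {linear U -> V}) :
  exists h : {linear U -> V}, forall u, h u = f u - g u.
Proof. by exists (f \- g). Qed.

(** This is exactness of Hom(Y, X) -> Hom(Y, B) -> Ext^1(Y, A) -> Ext^1(Y, X): i extends to a map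
    from Z to X, and a lift along p corrects it to land in A. *)
Lemma ext1_of_lift A X B (i : {linear A -> X}) (p : {linear X -> B}) Y :
  short_exact i p -> ext1_splits Y X ->
  (forall f : {linear Y -> B}, exists g : {linear Y -> X}, forall y, p (g y) = f y) ->
  ext1_splits Y A.
Proof.
move=> ip eYX liftB Z k q kq; have [ki _ _] := kq.
have [t tk] := ext1_extend kq eYX i.
have [|u uq] := ses_factor_surj kq (f := linmap_comp p t).
  by move=> a; rewrite /= tk (ses_comp0 ip).
have [g gp] := liftB u.
have [h hE] := sub_linear t (linmap_comp g q).
have [|r rE] := ses_factor_inj ip (f := h).
  by move=> z; rewrite hE raddfB /= gp uq subrr.
apply: (retraction_section (r := r) kq) => a.
case: ip => ii _ _; apply: (linear_inj ii).
by rewrite rE hE /= tk (ses_comp0 kq) raddf0 subr0.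
Qed.

Lemma ext1_of_extend A X B (i : {linear A -> X}) (p : {linear X -> B}) Y :
  short_exact i p -> ext1_splits X Y ->
  (forall f : {linear A -> Y}, exists g : {linear X -> Y}, forall a, g (i a) = f a) ->
  ext1_splits B Y.
Proof.
move=> ip eXY extA Z k q kq; have [_ _ ps] := ip.
have [t tq] := ext1_lift kq eXY p.
have [|u uk] := ses_factor_inj kq (f := linmap_comp t i).
  by move=> a; rewrite /= tq (ses_comp0 ip).
have [g gi] := extA u.
have [h hE] := sub_linear t (linmap_comp k g).
have [|s sE] := ses_factor_surj ip (f := h).
  by move=> a; rewrite hE /= gi uk subrr.
exists s => b; have [x <-] := ps b.
by rewrite sE hE raddfB /= tq (ses_comp0 kq) subr0.
Qed.

Definition cosyzygy_key Y : exists (I C : fgmod S) (j : {linear Y -> I}) (c : {linear I -> C}),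
  relatively_injective I /\ short_exact j c.
Proof.
have [I [j [inj ji]]] := enough_injectives Y; have [C [c jc]] := cokernel_ses ji.
by exists I, C, j, c.
Qed.

Definition injective_overmodule Y : fgmod S := sval (cid (cosyzygy_key Y)).
(** Chosen once for every module, so that it can be iterated: Ext^(j+1)(A, Y) is read as Ext^1(A, -)
    at the j-th cosyzygy of Y. *)
Definition cosyzygy Y : fgmod S := sval (cid (svalP (cid (cosyzygy_key Y)))).

Lemma cosyzygyP Y : exists (j : {linear Y -> injective_overmodule Y})
    (c : {linear injective_overmodule Y -> cosyzygy Y}),
  relatively_injective (injective_overmodule Y) /\ short_exact j c.
Proof. exact: (svalP (cid (svalP (cid (cosyzygy_key Y))))). Qed.

(** Ext^1(B, -) at the cosyzygy of Y stands for Ext^2(B, Y). A map from A into the cosyzygy extends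
    to X and then lifts to the injective overmodule. *)
Lemma ext1_kernel_shift A X B (i : {linear A -> X}) (p : {linear X -> B}) Y :
  short_exact i p -> ext1_splits B (cosyzygy Y) -> ext1_splits X Y -> ext1_splits A Y.
Proof.
move=> ip eBY eXY; have [j [c [inj jc]]] := cosyzygyP Y.
apply: (ext1_of_lift jc); first exact: injective_ext1.
move=> f; have [g gE] := ext1_extend ip eBY f; have [h hE] := ext1_lift jc eXY g.
by exists (linmap_comp h i) => a; rewrite /= hE gE.
Qed.

Lemma ext1_cokernel_shift A X B (i : {linear A -> X}) (p : {linear X -> B}) Y :
  short_exact i p -> ext1_splits A Y -> ext1_splits X (cosyzygy Y) ->
  ext1_splits B (cosyzygy Y).
Proof.
move=> ip eAY eXY; have [j [c [inj jc]]] := cosyzygyP Y; have [ii _ _] := ip.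
apply: (ext1_of_extend ip eXY) => f; have [g gE] := ext1_lift jc eAY f.
have [|h hE] := inj _ _ i g (fgmP X); first by move=> u /ii ->; rewrite raddf0.
by exists (linmap_comp c h) => a; rewrite /= hE gE.
Qed.

(** * Ext by resolutions and by iterated cosyzygies *)

Section Resolution.
Variables (A : fgmod S) (P : nat -> fgmod S) (d : forall i, {linear P i.+1 -> P i})
  (e : {linear P 0%N -> A}).
Hypothesis res : projective_resolution d e.

(* The cohomology of Hom(P, Y) vanishes in degree j + 1. *)
Definition cohomology_vanishes (j : nat) Y :=
  forall f : {linear P j.+1 -> Y}, f \o d j.+1 =1 \0 ->
    exists g : {linear P j -> Y}, g \o d j =1 f.

Lemma proj_lift j X B (p : {linear X -> B}) (f : {linear P j -> B}) :
  (forall b, exists x, p x = b) -> exists g : {linear P j -> X}, forall x, p (g x) = f x.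
Proof. by case: res => pP _ _ _ ps; apply: (pP j X B p ps f). Qed.

Lemma res_comp0 j x : d j (d j.+1 x) = 0.
Proof. by case: res => _ _ _ ex; apply/ex; exists x. Qed.

Lemma injective_cohomology j (I : fgmod S) :
  relatively_injective I -> cohomology_vanishes j I.
Proof.
move=> inj f fd; have [|g gE] := inj _ _ (d j) f (fgmP _); last by exists g.
by case: res => _ _ _ ex u /ex[v <-]; apply: fd.
Qed.

Section CohomologyShift.
Variables (Y X B : fgmod S) (i : {linear Y -> X}) (p : {linear X -> B}).
Hypothesis ip : short_exact i p.

Lemma cohomology_right j : cohomology_vanishes j.+1 Y -> cohomology_vanishes j X ->
  cohomology_vanishes j B.
Proof.
move=> HY HX f fd; have [ii kp ps] := ip; have [f' f'E] := proj_lift f ps.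
have [|c cE] := ses_factor_inj ip (f := linmap_comp f' (d j.+1)).
  by move=> u; rewrite /= f'E; apply: fd.
have [x|g gE] := HY c.
  by apply: ii; rewrite cE /= res_comp0 raddf0.
have [h hE] := sub_linear f' (linmap_comp i g).
have [x|k kE] := HX h.
  by rewrite /= hE /=; have /= -> := gE x; rewrite cE subrr.
exists (linmap_comp p k) => x; have /= -> := kE x.
by rewrite hE raddfB /= f'E (ses_comp0 ip) subr0.
Qed.

Lemma cohomology_left j : cohomology_vanishes j B -> cohomology_vanishes j.+1 X ->
  cohomology_vanishes j.+1 Y.
Proof.
move=> HB HX f fd; have [ii kp ps] := ip.
have [x|g gE] := HX (linmap_comp i f).
  by rewrite /=; have /= -> := fd x; rewrite raddf0.
have [x|h hE] := HB (linmap_comp p g).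
  by rewrite /=; have /= -> := gE x; rewrite (ses_comp0 ip).
have [h' h'E] := proj_lift h ps.
have [k kE] := sub_linear g (linmap_comp h' (d j)).
have [|r rE] := ses_factor_inj ip (f := k).
  by move=> x; rewrite kE raddfB /= h'E; have /= -> := hE x; rewrite subrr.
exists r => x; apply: (linear_inj ii).
by rewrite /= rE kE /= res_comp0 raddf0 subr0; have /= -> := gE x.
Qed.

End CohomologyShift.

Lemma cohomology_ext1 Y : cohomology_vanishes 0 Y <-> ext1_splits A Y.
Proof.
have [_ es ke _] := res; split=> [HY Z k q kq|eAY f fd].
  have [ki kqE qs] := kq; have [e' e'E] := proj_lift e qs.
  have [|c cE] := ses_factor_inj kq (f := linmap_comp e' (d 0)).
    by move=> x; rewrite /= e'E; apply/ke; exists x.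
  have [x|g gE] := HY c; first by apply: ki; rewrite cE /= res_comp0 raddf0.
  have [h hE] := sub_linear e' (linmap_comp k g).
  have [|s sE] := @factor_surj _ _ _ _ e h es.
    by move=> _ /ke[x <-]; rewrite hE /=; have /= -> := gE x; rewrite cE subrr.
  by exists s => a; have [x <-] := es a; rewrite sE hE raddfB /= e'E (ses_comp0 kq) subr0.
(* K is the first syzygy of A. A cocycle f kills the image of [d 1], so it descends to K, and
   vanishing of Ext^1(A, Y) extends it to [P 0]. *)
have sK := submod_image (d 0) (submodT (P 1)).
pose K := sub_fgmod sK; pose j : {linear K -> P 0%N} := sub_incl sK.
have ji : forall x, j x = 0 -> x = 0 := @sub_incl_eq0 _ _ _ sK.
have je : short_exact j e.
  split=> // x; rewrite ke; split=> [[y yE]|[a <-]].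
    by apply: sub_incl_onto; exists y.
  by have [y _ yE] := sub_inclP a; exists y.
have [|d' d'E] := ses_factor_inj je (f := d 0).
  by move=> u; apply/ke; exists u.
have [x|u|f' f'E] := @factor_surj _ _ _ _ d' f.
- have [y _ yE] := sub_inclP x; exists y; apply: (linear_inj ji).
  by rewrite d'E yE.
- move=> d'0; have : d 0 u = 0 by rewrite -d'E d'0 raddf0.
  by case: res => _ _ _ ex /ex[v <-]; apply: fd.
have [g gE] := ext1_extend je eAY f'.
by exists g => x; rewrite /= -d'E gE f'E.
Qed.

Lemma cohomology_cosyzygy j Y :
  cohomology_vanishes j.+1 Y <-> cohomology_vanishes j (cosyzygy Y).
Proof.
have [i [c [inj ic]]] := cosyzygyP Y; split=> H.
  by apply: (cohomology_right ic) => //; apply: injective_cohomology.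
by apply: (cohomology_left ic) => //; apply: injective_cohomology.
Qed.

Lemma cohomology_iter_cosyzygy j Y :
  cohomology_vanishes j Y <-> ext1_splits A (iter j cosyzygy Y).
Proof.
rewrite -cohomology_ext1; elim: j Y => // j IHj Y.
by rewrite cohomology_cosyzygy IHj -iterSr.
Qed.

End Resolution.

Lemma free_cover (A : fgmod S) : exists (F : fgmod S) (e : {linear F -> A}),
  projective_mod F /\ forall a, exists x, e x = a.
Proof.
have [k [s sA]] := fgmP A.
exists (Fgmod (fin_gen_ffun k (fin_gen_regular S))), (comb s); split.
  move=> X Y p ps f; have xP i : exists x, p x = f (free_gen i) by apply: ps.
  exists (comb (fun i => sval (cid (xP i)))) => c.
  apply: (free_ext (f := linmap_comp p (comb _))) => i.
  by rewrite -[LHS]/(p (comb _ _)) comb_gen; case: cid.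
move=> a; have [c ->] := sA a; exists [ffun i => c i].
by apply: eq_bigr => i _; rewrite ffunE.
Qed.

Lemma resolution_exists A : exists (P : nat -> fgmod S)
  (d : forall i, {linear P i.+1 -> P i}) (e : {linear P 0%N -> A}), projective_resolution d e.
Proof.
have cover (B : fgmod S) : exists p : {K : fgmod S & {F : fgmod S & ({linear K -> F} * {linear F -> B})%type}},
    projective_mod (projT1 (projT2 p)) /\
    short_exact (projT2 (projT2 p)).1 (projT2 (projT2 p)).2.
  have [F [e [pF es]]] := free_cover B; have [K [i ie]] := kernel_ses es.
  by exists (existT _ K (existT _ F (i, e))).
pose K B := projT1 (sval (cid (cover B))).
pose F B := projT1 (projT2 (sval (cid (cover B)))).
pose i B : {linear K B -> F B} := (projT2 (projT2 (sval (cid (cover B))))).1.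
pose e B : {linear F B -> B} := (projT2 (projT2 (sval (cid (cover B))))).2.
have pF B : projective_mod (F B) by exact: (svalP (cid (cover B))).1.
have ie B : short_exact (i B) (e B) by exact: (svalP (cid (cover B))).2.
pose P j := F (iter j K A).
exists P, (fun j => linmap_comp (i (iter j K A)) (e (K (iter j K A)))), (e A).
split=> [j|y|x|j x]; first exact: pF.
- by case: (ie A).
- have [_ -> _] := ie A; split=> [[a <-]|[y <-]]; last by eexists.
  by have [_ _ /(_ a)[y yE]] := ie (K A); exists y; rewrite /= yE.
have [ii kp _] := ie (iter j K A); have [ii' kp' _] := ie (iter j.+1 K A).
split=> [/= /ii /kp'[a <-]|[y <-]].
  by have [_ _ /(_ a)[y yE]] := ie (iter j.+2 K A); exists y; rewrite /= yE.
rewrite /=; have [_ kp1 _] := ie (K (iter j K A)).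
by rewrite (iffRL (kp1 _)) ?raddf0 //; eexists.
Qed.

(** [ext_vanishes] asks for some projective resolution. The right-hand side mentions none, which
    makes vanishing independent of the resolution and lets several vanishing statements be tested on
    a common one. *)
Lemma ext_vanishes_ext1 j A Y :
  ext_vanishes j.+1 A Y <-> ext1_splits A (iter j cosyzygy Y).
Proof.
split=> [[P [d [e [res H]]]]|H]; first by apply/(cohomology_iter_cosyzygy res).
have [P [d [e res]]] := resolution_exists A.
by exists P, d, e; split=> //; apply/(cohomology_iter_cosyzygy res).
Qed.

(** * Dimension shifting in both arguments of Ext *)

Section ExtShift.
Variables (A X B : fgmod S) (i : {linear A -> X}) (p : {linear X -> B}).
Hypothesis ip : short_exact i p.

Let via_resolution Y : exists (P : nat -> fgmod S) (d : forall i, {linear P i.+1 -> P i}),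
  (exists e : {linear P 0%N -> Y}, projective_resolution d e) /\
  forall Z k, ext_vanishes k.+1 Y Z <-> cohomology_vanishes d k Z.
Proof.
have [P [d [e res]]] := resolution_exists Y; exists P, d; split; first by exists e.
by move=> Z k; rewrite ext_vanishes_ext1 (cohomology_iter_cosyzygy res).
Qed.

Lemma ext_into_cokernel Y j :
  ext_vanishes j.+2 Y A -> ext_vanishes j.+1 Y X -> ext_vanishes j.+1 Y B.
Proof.
have [P [d [[e res] E]]] := via_resolution Y; rewrite !E.
exact: (cohomology_right res ip).
Qed.

Lemma ext_into_kernel Y j :
  ext_vanishes j.+1 Y B -> ext_vanishes j.+2 Y X -> ext_vanishes j.+2 Y A.
Proof.
have [P [d [[e res] E]]] := via_resolution Y; rewrite !E.
exact: (cohomology_left res ip).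
Qed.

Lemma ext_from_kernel Y j :
  ext_vanishes j.+2 B Y -> ext_vanishes j.+1 X Y -> ext_vanishes j.+1 A Y.
Proof. by rewrite !ext_vanishes_ext1; apply: (ext1_kernel_shift ip). Qed.

Lemma ext_from_cokernel Y j :
  ext_vanishes j.+1 A Y -> ext_vanishes j.+2 X Y -> ext_vanishes j.+2 B Y.
Proof. by rewrite !ext_vanishes_ext1; apply: (ext1_cokernel_shift ip). Qed.

Lemma ext_lift Y : ext_vanishes 1 Y A ->
  forall f : {linear Y -> B}, exists g : {linear Y -> X}, forall y, p (g y) = f y.
Proof. by rewrite ext_vanishes_ext1; apply: (ext1_lift ip). Qed.

Lemma ext_extend Y : ext_vanishes 1 B Y ->
  forall f : {linear A -> Y}, exists g : {linear X -> Y}, forall a, g (i a) = f a.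
Proof. by rewrite ext_vanishes_ext1; apply: (ext1_extend ip). Qed.

Lemma ext_of_lift Y : ext_vanishes 1 Y X ->
  (forall f : {linear Y -> B}, exists g : {linear Y -> X}, forall y, p (g y) = f y) ->
  ext_vanishes 1 Y A.
Proof. by rewrite !ext_vanishes_ext1; apply: (ext1_of_lift ip). Qed.

Lemma ext_of_extend Y : ext_vanishes 1 X Y ->
  (forall f : {linear A -> Y}, exists g : {linear X -> Y}, forall a, g (i a) = f a) ->
  ext_vanishes 1 B Y.
Proof. by rewrite !ext_vanishes_ext1; apply: (ext1_of_extend ip). Qed.

End ExtShift.
End Ext.

(** * Equivalences of categories *)

Section Equivalences.

Lemma is_iso_comp (C : category) (X Y Z : C) (g : mor Y Z) (f : mor X Y) :
  is_iso g -> is_iso f -> is_iso (compm g f).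
Proof.
move=> [g' [g'g gg']] [f' [f'f ff']]; exists (compm f' g'); split.
  apply: eqm_trans (eqm_sym (compmA _ _ _)) _; apply: eqm_trans _ f'f.
  apply: eqm_comp; first exact: eqm_refl.
  apply: eqm_trans (compmA _ _ _) _; apply: eqm_trans _ (comp1m f).
  by apply: eqm_comp => //; exact: eqm_refl.
apply: eqm_trans (eqm_sym (compmA _ _ _)) _; apply: eqm_trans _ gg'.
apply: eqm_comp; first exact: eqm_refl.
apply: eqm_trans (compmA _ _ _) _; apply: eqm_trans _ (comp1m g').
by apply: eqm_comp => //; exact: eqm_refl.
Qed.

Lemma is_iso_fmor (C D : category) (F : functor C D) (X Y : C) (f : mor X Y) :
  is_iso f -> is_iso (fmor F f).
Proof.
move=> [g [gf fg]]; exists (fmor F g); split.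
  by apply: eqm_trans (eqm_sym (fmor_comp F _ _)) _;
    apply: eqm_trans (fmor_eqm F gf) (fmor_id F X).
by apply: eqm_trans (eqm_sym (fmor_comp F _ _)) _;
  apply: eqm_trans (fmor_eqm F fg) (fmor_id F Y).
Qed.

Lemma equivalent_refl (C : category) : equivalent C C.
Proof.
exists (idfunctor C), (idfunctor C); split; exists (fun X : C => idm X);
  by split=> [X|X Y f]; [exists (idm X); split; exact: comp1m
    | apply: eqm_trans (compm1 _) (eqm_sym (comp1m _))].
Qed.

Lemma equivalent_sym (C D : category) : equivalent C D -> equivalent D C.
Proof. by move=> [F [G [GF FG]]]; exists G, F. Qed.

Let conj_iso (C D E : category) (F1 : functor C D) (G1 : functor D C)
    (F2 : functor D E) (G2 : functor E D) :
  naturally_isomorphic (compfunctor G1 F1) (idfunctor C) ->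
  naturally_isomorphic (compfunctor G2 F2) (idfunctor D) ->
  naturally_isomorphic (compfunctor (compfunctor G1 G2) (compfunctor F2 F1)) (idfunctor C).
Proof.
move=> [a [ai an]] [b [bi bn]].
exists (fun X => compm (a X) (fmor G1 (b (F1 X)))); split=> [X|X Y f].
  exact: (is_iso_comp (ai X) (is_iso_fmor G1 (bi (F1 X)))).
apply: eqm_trans (compmA _ _ _) _.
apply: eqm_trans (eqm_comp (an X Y f) (eqm_refl _)) _.
apply: eqm_trans (eqm_sym (compmA _ _ _)) _.
apply: eqm_trans _ (compmA _ _ _).
apply: eqm_comp; first exact: eqm_refl.
apply: eqm_trans (eqm_sym (fmor_comp G1 _ _)) _.
apply: eqm_trans _ (fmor_comp G1 _ _).
exact: fmor_eqm (bn _ _ (fmor F1 f)).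
Qed.

Lemma equivalent_trans (C D E : category) :
  equivalent C D -> equivalent D E -> equivalent C E.
Proof.
move=> [F1 [G1 [GF1 FG1]]] [F2 [G2 [GF2 FG2]]].
exists (compfunctor F2 F1), (compfunctor G1 G2); split; exact: conj_iso.
Qed.

Lemma equivalent_of_fully_faithful (C D : category) (F : functor C D) :
  (forall X Y (g : mor (F X) (F Y)), exists f : mor X Y, eqm (fmor F f) g) ->
  (forall X Y (f f' : mor X Y), eqm (fmor F f) (fmor F f') -> eqm f f') ->
  (forall Y, exists X (w : mor (F X) Y), is_iso w) ->
  equivalent C D.
Proof.
move=> full faith surj.
pose gob Y := sval (cid (surj Y)).
pose w Y : mor (F (gob Y)) Y := sval (cid (svalP (cid (surj Y)))).
have wi Y : is_iso (w Y) by exact: (svalP (cid (svalP (cid (surj Y))))).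
pose w' Y := sval (cid (wi Y)).
have w'w Y : eqm (compm (w' Y) (w Y)) (idm _) := (svalP (cid (wi Y))).1.
have ww' Y : eqm (compm (w Y) (w' Y)) (idm _) := (svalP (cid (wi Y))).2.
pose gmor Y Y' (g : mor Y Y') : mor (gob Y) (gob Y') :=
  sval (cid (full _ _ (compm (w' Y') (compm g (w Y))))).
have gE Y Y' (g : mor Y Y') : eqm (fmor F (gmor Y Y' g)) (compm (w' Y') (compm g (w Y))).
  exact: (svalP (cid (full _ _ (compm (w' Y') (compm g (w Y)))))).
have wg Y Y' (g : mor Y Y') : eqm (compm (w Y') (fmor F (gmor Y Y' g))) (compm g (w Y)).
  apply: eqm_trans (eqm_comp (eqm_refl _) (gE _ _ g)) _.
  apply: eqm_trans (compmA _ _ _) _; apply: eqm_trans _ (comp1m _).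
  by apply: eqm_comp => //; exact: eqm_refl.
have cancel Y Z (g g' : mor Z (F (gob Y))) : eqm (compm (w Y) g) (compm (w Y) g') -> eqm g g'.
  move=> e; apply: eqm_trans (eqm_sym (comp1m _)) _; apply: eqm_trans _ (comp1m _).
  apply: eqm_trans (eqm_comp (eqm_sym (w'w Y)) (eqm_refl _)) _.
  apply: eqm_trans _ (eqm_comp (w'w Y) (eqm_refl _)).
  apply: eqm_trans (eqm_sym (compmA _ _ _)) _; apply: eqm_trans _ (compmA _ _ _).
  by apply: eqm_comp e; exact: eqm_refl.
have g_eqm Y Y' (g h : mor Y Y') : eqm g h -> eqm (gmor Y Y' g) (gmor Y Y' h).
  move=> e; apply: faith; apply: cancel; apply: eqm_trans (wg _ _ g) _.
  apply: eqm_trans _ (eqm_sym (wg _ _ h)); apply: eqm_comp e _; exact: eqm_refl.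
have g_id Y : eqm (gmor Y Y (idm Y)) (idm (gob Y)).
  apply: faith; apply: cancel; apply: eqm_trans (wg _ _ _) _.
  apply: eqm_trans (comp1m _) _; apply: eqm_sym.
  apply: eqm_trans (eqm_comp (eqm_refl _) (fmor_id F _)) _; exact: compm1.
have g_comp Y Y' Y'' (h : mor Y' Y'') (g : mor Y Y') :
    eqm (gmor Y Y'' (compm h g)) (compm (gmor Y' Y'' h) (gmor Y Y' g)).
  apply: faith; apply: cancel; apply: eqm_trans (wg _ _ _) _; apply: eqm_sym.
  apply: eqm_trans (eqm_comp (eqm_refl _) (fmor_comp F _ _)) _.
  apply: eqm_trans (compmA _ _ _) _.
  apply: eqm_trans (eqm_comp (wg _ _ h) (eqm_refl _)) _.
  apply: eqm_trans (eqm_sym (compmA _ _ _)) _.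
  apply: eqm_trans (eqm_comp (eqm_refl _) (wg _ _ g)) _; exact: compmA.
pose G := @Functor D C gob gmor g_eqm g_id g_comp.
exists F, G; split; last by exists w; split=> // X Y f; apply: eqm_sym; apply: wg.
pose a X := sval (cid (full (gob (F X)) X (w (F X)))).
have aE X : eqm (fmor F (a X)) (w (F X)) by exact: (svalP (cid (full _ X (w (F X))))).
exists a; split=> [X|X Y f].
  have [a' a'E] := full X (gob (F X)) (w' (F X)); exists a'.
  split; apply: faith; apply: eqm_trans (fmor_comp F _ _) _;
    apply: eqm_trans _ (eqm_sym (fmor_id F _)).
    by apply: eqm_trans (eqm_comp a'E (aE X)) _.
  by apply: eqm_trans (eqm_comp (aE X) a'E) _.
apply: faith; apply: eqm_trans (fmor_comp F _ _) _; apply: eqm_sym.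
apply: eqm_trans (fmor_comp F _ _) _.
apply: eqm_trans (eqm_comp (aE Y) (eqm_refl _)) _.
apply: eqm_trans (wg _ _ _) _; apply: eqm_comp; first exact: eqm_refl.
exact: eqm_sym (aE X).
Qed.

(* A span of object maps C <- T -> D, surjective on both sides, together with a
   relation between morphisms that is a bijection up to [eqm]. *)
Definition correspondence (C D : category) :=
  exists (T : Type) (a : T -> C) (b : T -> D)
    (R : forall s t, mor (a s) (a t) -> mor (b s) (b t) -> Prop),
  [/\ (forall X, exists t, a t = X) /\ (forall Y, exists t, b t = Y),
      (forall s t f, exists g, R s t f g) /\ (forall s t g, exists f, R s t f g),
      forall t, R t t (idm _) (idm _),
      forall s t u f g f' g', R t u f' g' -> R s t f g -> R s u (compm f' f) (compm g' g)
    & forall s t f g f' g', R s t f g -> R s t f' g' -> (eqm f f' <-> eqm g g')].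

Lemma correspondence_op (C D : category) :
  correspondence C D -> correspondence (opcat C) (opcat D).
Proof.
move=> [T [a [b [R [surj [R1 R2] Rid Rcomp Req]]]]].
exists T, a, b, (fun s t f g => R t s f g); split=> //.
- by split=> s t f; [apply: R1 | apply: R2].
- by move=> s t u f g f' g' H H'; apply: Rcomp.
- by move=> s t f g f' g'; apply: Req.
Qed.

Lemma correspondence_equivalent (C D : category) : correspondence C D -> equivalent C D.
Proof.
move=> [T [a [b [R [[sa sb] [R1 R2] Rid Rcomp Req]]]]].
(* The equality [a t = X] is replaced by a pair of inverse morphisms, so that morphisms are
   conjugated instead of transported along equalities. *)
have iso X : exists t (u : mor X (a t)) (v : mor (a t) X),
    eqm (compm v u) (idm _) /\ eqm (compm u v) (idm _).
  have [t <-] := sa X; exists t, (idm _), (idm _); split; exact: comp1m.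
pose t X := sval (cid (iso X)).
pose u X : mor X (a (t X)) := sval (cid (svalP (cid (iso X)))).
have uv X : exists v : mor (a (t X)) X, eqm (compm v (u X)) (idm _) /\ eqm (compm (u X) v) (idm _).
  exact: (svalP (cid (svalP (cid (iso X))))).
pose v X := sval (cid (uv X)).
have vu X : eqm (compm (v X) (u X)) (idm _) := (svalP (cid (uv X))).1.
have uvE X : eqm (compm (u X) (v X)) (idm _) := (svalP (cid (uv X))).2.
pose c X Y (f : mor X Y) := compm (u Y) (compm f (v X)).
have c_comp X Y Z (g : mor Y Z) (f : mor X Y) : eqm (c X Z (compm g f)) (compm (c Y Z g) (c X Y f)).
  rewrite /c; apply: eqm_trans _ (compmA _ _ _); apply: eqm_comp; first exact: eqm_refl.
  apply: eqm_trans _ (compmA _ _ _); apply: eqm_trans (eqm_sym (compmA _ _ _)) _.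
  apply: eqm_comp; first exact: eqm_refl.
  apply: eqm_sym; apply: eqm_trans (compmA _ _ _) _.
  apply: eqm_trans (eqm_comp (vu Y) (eqm_refl _)) _; exact: comp1m.
have c_inj X Y (f f' : mor X Y) : eqm (c X Y f) (c X Y f') -> eqm f f'.
  have cE (h : mor X Y) : eqm (compm (v Y) (compm (c X Y h) (u X))) h.
    rewrite /c; apply: eqm_trans (eqm_comp (eqm_refl _) (eqm_sym (compmA _ _ _))) _.
    apply: eqm_trans (compmA _ _ _) _.
    apply: eqm_trans (eqm_comp (vu Y) (eqm_refl _)) _.
    apply: eqm_trans (comp1m _) _; apply: eqm_trans (eqm_sym (compmA _ _ _)) _.
    apply: eqm_trans (eqm_comp (eqm_refl _) (vu X)) _; exact: compm1.
  move=> e; apply: eqm_trans (eqm_sym (cE f)) _; apply: eqm_trans _ (cE f').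
  apply: eqm_comp; first exact: eqm_refl.
  by apply: eqm_comp e _; exact: eqm_refl.
pose Fm X Y (f : mor X Y) : mor (b (t X)) (b (t Y)) := sval (cid (R1 _ _ (c X Y f))).
have FR X Y (f : mor X Y) : R _ _ (c X Y f) (Fm X Y f) by exact: (svalP (cid (R1 _ _ (c X Y f)))).
have F_eqm X Y (f f' : mor X Y) : eqm f f' -> eqm (Fm X Y f) (Fm X Y f').
  move=> e; apply/(Req _ _ _ _ _ _ (FR X Y f) (FR X Y f')).
  apply: eqm_comp; first exact: eqm_refl.
  by apply: eqm_comp e _; exact: eqm_refl.
have F_id X : eqm (Fm X X (idm X)) (idm (b (t X))).
  apply/(Req _ _ _ _ _ _ (FR X X (idm X)) (Rid _)).
  apply: eqm_trans (eqm_comp (eqm_refl _) (comp1m _)) _; exact: uvE.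
have F_comp X Y Z (g : mor Y Z) (f : mor X Y) :
    eqm (Fm X Z (compm g f)) (compm (Fm Y Z g) (Fm X Y f)).
  by apply/(Req _ _ _ _ _ _ (FR _ _ _) (Rcomp _ _ _ _ _ _ _ (FR _ _ _) (FR _ _ _))).
apply: (@equivalent_of_fully_faithful _ _ (@Functor C D (fun X => b (t X)) Fm F_eqm F_id F_comp)).
- move=> X Y g; have [f Rf] := R2 _ _ g; exists (compm (v Y) (compm f (u X))) => /=.
  apply/(Req _ _ _ _ _ _ (FR _ _ _) Rf); rewrite /c.
  apply: eqm_trans (eqm_comp (eqm_refl _) (eqm_sym (compmA _ _ _))) _.
  apply: eqm_trans (compmA _ _ _) _.
  apply: eqm_trans (eqm_comp (uvE Y) (eqm_refl _)) _.
  apply: eqm_trans (comp1m _) _; apply: eqm_trans (eqm_sym (compmA _ _ _)) _.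
  apply: eqm_trans (eqm_comp (eqm_refl _) (uvE X)) _; exact: compm1.
- by move=> X Y f f' /(Req _ _ _ _ _ _ (FR X Y f) (FR X Y f')) /c_inj.
move=> Y; have [s <-] := sb Y; exists (a s).
have [g Rg] := R1 _ _ (v (a s)); have [h Rh] := R1 _ _ (u (a s)).
exists g, h; split.
  by apply/(Req _ _ _ _ _ _ (Rcomp _ _ _ _ _ _ _ Rh Rg) (Rid _)).
by apply/(Req _ _ _ _ _ _ (Rcomp _ _ _ _ _ _ _ Rg Rh) (Rid _)).
Qed.

End Equivalences.

(** * Finitely presented functors *)

Section FunctorCategory.
Variable C : addcat.
Implicit Types (X Y Z : C) (F G H : abfun C).

Lemma acompmN X Y Z (g : hom Y Z) (f : hom X Y) : acomp g (- f) = - acomp g f.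
Proof. by apply: (addrI (acomp g f)); rewrite -acompDr !subrr acompm0. Qed.

Lemma acompNm X Y Z (g : hom Y Z) (f : hom X Y) : acomp (- g) f = - acomp g f.
Proof. by apply: (addrI (acomp g f)); rewrite -acompDl !subrr acomp0m. Qed.

Lemma acompBr X Y Z (g : hom Y Z) (f f' : hom X Y) : acomp g (f - f') = acomp g f - acomp g f'.
Proof. by rewrite acompDr acompmN. Qed.

Lemma acompBl X Y Z (g g' : hom Y Z) (f : hom X Y) : acomp (g - g') f = acomp g f - acomp g' f.
Proof. by rewrite acompDl acompNm. Qed.

Lemma fun_map0 F X Y (s : F Y) : fun_map F (0 : hom X Y) s = 0.
Proof. by apply: (addrI (fun_map F (0 : hom X Y) s)); rewrite -fun_mapD !addr0. Qed.

Section Yoneda.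
Variables (X : C) (F : abfun C) (s : F X).

Definition yoneda_map Y (h : hom Y X) : F Y := fun_map F h s.

Fact yoneda_nmod_morphism Y : nmod_morphism (@yoneda_map Y).
Proof. by split=> [|g h]; rewrite /yoneda_map ?fun_map0 ?fun_mapD. Qed.

HB.instance Definition _ Y :=
  GRing.isNmodMorphism.Build _ _ (@yoneda_map Y) (@yoneda_nmod_morphism Y).

Definition yoneda : nattrans (representable X) F :=
  @Nattrans C (representable X) F (fun Y => @yoneda_map Y)
    (fun Y Z f h => fun_mapM h f s).

End Yoneda.

Lemma rep_elt X F (a : nattrans (representable X) F) Y (h : hom Y X) :
  a Y h = fun_map F h (a X (aid X)).
Proof. by rewrite -nt_natural /= /precomp acomp1m. Qed.

Lemma nt_factor F G H (q : nattrans G F) (a : nattrans G H) : nt_surjective q ->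
  (forall X x, q X x = 0 -> a X x = 0) ->
  exists b : nattrans F H, forall X x, b X (q X x) = a X x.
Proof.
move=> qs ka; pose b X y := a X (sval (cid (qs X y))).
have bE X x : b X (q X x) = a X x.
  rewrite /b; case: cid => z /= qz; apply/eqP; rewrite -subr_eq0 -raddfB.
  by apply/eqP/ka; rewrite raddfB /= qz subrr.
have b_nmod X : nmod_morphism (b X).
  split=> [|y y']; first by rewrite -(raddf0 (q X)) bE raddf0.
  have [x <-] := qs X y; have [x' <-] := qs X y'.
  by rewrite -raddfD !bE raddfD.
pose b' X : {additive F X -> H X} :=
  HB.pack (b X) (GRing.isNmodMorphism.Build _ _ (b X) (b_nmod X)).
have b_nat X Y (f : hom X Y) y : b' X (fun_map F f y) = fun_map H f (b' Y y).
  by have [x <-] := qs Y y; rewrite /= -nt_natural !bE nt_natural.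
by exists (Nattrans b_nat).
Qed.

Lemma nt_factor_inj F G H (j : nattrans G H) (a : nattrans F H) : nt_injective j ->
  (forall X x, exists y, j X y = a X x) ->
  exists b : nattrans F G, forall X x, j X (b X x) = a X x.
Proof.
move=> ji ja; pose b X x := sval (cid (ja X x)).
have bE X x : j X (b X x) = a X x by rewrite /b; case: cid.
have b_nmod X : nmod_morphism (b X).
  by split=> [|y y']; apply: ji; rewrite ?raddfD /= !bE ?raddfD ?raddf0.
pose b' X : {additive F X -> G X} :=
  HB.pack (b X) (GRing.isNmodMorphism.Build _ _ (b X) (b_nmod X)).
have b_nat X Y (f : hom X Y) y : b' X (fun_map F f y) = fun_map G f (b' Y y).
  by apply: ji; rewrite /= bE !nt_natural /= bE.
by exists (Nattrans b_nat).
Qed.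

Lemma nt_cokernel F G (e : nattrans F G) :
  exists (Q : abfun C) (p : nattrans G Q), nt_exact e p /\ nt_surjective p.
Proof.
(* Abelian groups are viewed as modules over the integers, so that the quotient construction for
   modules applies pointwise. *)
pose N X : zmodule (G X) -> Prop := fun y => exists x, e X x = y.
have sN X : submod (N X).
  split; first by exists 0; rewrite raddf0.
  move=> a _ _ [x <-] [y <-]; exists (x *~ a + y).
  by rewrite raddfD /= raddfMz.
pose pi X := quot_proj (sN X).
have lift X Y (f : hom X Y) : exists h : {linear quotient (sN Y) -> quotient (sN X)},
    forall y, h (pi Y y) = pi X (fun_map G f y).
  have g_lin : linear ((fun y => pi X (fun_map G f y)) : zmodule (G Y) -> quotient (sN X)).
    by move=> a x y; rewrite raddfD /= raddfMz /= raddfD /= -linearZ.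
  apply: (@factor_surj _ _ _ _ (pi Y) (Lin g_lin)) => [|y]; first exact: quot_proj_onto.
  move=> /quot_proj_eq0[x <-] /=; apply/quot_proj_eq0.
  by exists (fun_map F f x); rewrite nt_natural.
pose m X Y f := sval (cid (lift X Y f)).
have mE X Y f y : m X Y f (pi Y y) = pi X (fun_map G f y) by rewrite /m; case: cid.
have pis X y : exists x, pi X x = y by apply: quot_proj_onto.
have m1 X x : m X X (aid X) x = x.
  by have [y <-] := pis X x; rewrite mE fun_map1.
have mM X Y Z (g : hom Y Z) (f : hom X Y) x : m X Z (acomp g f) x = m X Y f (m Y Z g x).
  by have [y <-] := pis Z x; rewrite !mE fun_mapM.
have mD X Y (f g : hom X Y) x : m X Y (f + g) x = m X Y f x + m X Y g x.
  by have [y <-] := pis Y x; rewrite !mE fun_mapD raddfD.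
pose Q := @Abfun C (fun X => quotient (sN X)) m m1 mM mD.
exists Q, (@Nattrans C G Q (fun X => pi X) (fun X Y f x => esym (mE X Y f x))).
split; last exact: pis.
by move=> X y; apply: (iff_trans (quot_proj_eq0 _ _)).
Qed.

Lemma rep_fp X : finitely_presented (representable X).
Proof.
exists X, X, (nt_zero _ _), (nt_id _); split=> [Y y|Y y]; last by exists y.
by split=> [y0|[x <-] //]; exists 0; apply: esym.
Qed.

Definition repf X : modcat C := Fpfun (rep_fp X).

(** The relations of the cokernel are those of G together with the generator of F, carried to G by e
    and lifted to X0 along q. *)
Lemma cokernel_fp F G H (e : nattrans F G) (p : nattrans G H) :
  nt_exact e p -> nt_surjective p -> finitely_presented F -> finitely_presented G ->
  finitely_presented H.
Proof.
move=> ep ps [_ [Y0 [_ [r [_ rs]]]]] [X1 [X0 [a [q [aq qs]]]]].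
have [g gE] := qs Y0 (e Y0 (r Y0 (aid Y0))).
have geE Z (y : hom Z Y0) : q Z (acomp g y) = e Z (r Z y).
  have -> : acomp g y = fun_map (representable X0) y g by [].
  by rewrite nt_natural gE -!nt_natural /= /precomp acomp1m.
have [W [i1 [i2 [p1 [p2 [e11 e22 e12 e21 eW]]]]]] := abiprod X1 Y0.
exists W, X0, (nt_add (nt_comp a (postcomp p1)) (postcomp (acomp g p2))), (nt_comp p q).
split=> [Z x|Z y]; last by have [u <-] := ps Z y; have [v <-] := qs Z u; exists v.
split=> /= [/ep[s sE]|[w <-]].
  have [y yE] := rs Z s.
  have [|x1 x1E] := (aq Z (x - acomp g y)).1.
    by rewrite raddfB /= geE yE sE subrr.
  have w1 : acomp p1 (acomp i1 (x1 : hom Z X1) + acomp i2 y) = x1.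
    by rewrite acompDr !acompA e11 e12 acomp1m acomp0m addr0.
  have w2 : acomp p2 (acomp i1 (x1 : hom Z X1) + acomp i2 y) = y.
    by rewrite acompDr !acompA e22 e21 acomp1m acomp0m add0r.
  exists (acomp i1 (x1 : hom Z X1) + acomp i2 y).
  by rewrite /= /postcomp_at w1 -acompA w2 x1E subrK.
apply/ep; rewrite raddfD /= /postcomp_at -acompA geE.
exists (r Z (acomp p2 w)); rewrite (_ : q Z (a Z _) = 0) ?add0r //.
by apply/aq; eexists.
Qed.

(** The pointwise cokernel is again finitely presented, so the epimorphism can be tested against its
    projection and the zero map. *)
Lemma epi_surjective (F G : modcat C) (e : mor F G) : epi e -> nt_surjective e.
Proof.
move=> ee; have [Q [p [ep ps]]] := nt_cokernel e.
pose Qf : modcat C := Fpfun (cokernel_fp ep ps (fpfP F) (fpfP G)).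
have p0 : eqm (p : mor G Qf) (nt_zero G Qf).
  by apply: ee => X x /=; apply/ep; exists x.
by move=> X y; apply/ep; apply: p0.
Qed.

Lemma surjective_epi (F G : modcat C) (e : mor F G) : nt_surjective e -> epi e.
Proof. by move=> es Z g h gh X y; have [x <-] := es X y; apply: gh. Qed.

Lemma rep_projective X : projective (repf X).
Proof.
move=> F G e /epi_surjective es f; have [s sE] := es X (f X (aid X)).
exists (yoneda s : mor (repf X) F) => Y h /=.
by rewrite nt_natural sE -rep_elt.
Qed.

Definition idempotent_complete := forall X (e : hom X X), acomp e e = e ->
  exists Y (i : hom Y X) (r : hom X Y), acomp r i = aid Y /\ acomp i r = e.

Lemma projective_retract (P : modcat C) : projective P -> exists X
  (q : nattrans (representable X) P) (s : nattrans P (representable X)),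
  forall Y x, q Y (s Y x) = x.
Proof.
move=> pP; have [_ [X [_ [q [_ qs]]]]] := fpfP P.
have [s sE] := pP (repf X) P q (surjective_epi (e := q : mor (repf X) P) qs) (nt_id P).
by exists X, q, s.
Qed.

(** P is a retract of a representable functor; by Yoneda the resulting idempotent is an endomorphism
    in C, and its splitting represents P. *)
Lemma projective_representable (P : modcat C) : idempotent_complete -> projective P ->
  exists X (u : nattrans (representable X) P) (v : nattrans P (representable X)),
  (forall Y x, u Y (v Y x) = x) /\ (forall Y x, v Y (u Y x) = x).
Proof.
move=> ic /projective_retract[X0 [q [s qs]]].
pose e : hom X0 X0 := s X0 (q X0 (aid X0)).
have eE Y (x : hom Y X0) : s Y (q Y x) = acomp e x.
  rewrite -[RHS]/(fun_map (representable X0) x (s X0 (q X0 (aid X0)))).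
  by rewrite -!nt_natural /= /precomp acomp1m.
have [|X [i [r [ri ire]]]] := ic X0 e.
  by rewrite -eE /e qs.
exists X, (nt_comp q (postcomp i)), (nt_comp (postcomp r) s); split=> Y x /=.
  by rewrite /postcomp_at acompA ire -eE !qs.
by rewrite /postcomp_at (eE Y (acomp i x)) -ire !acompA ri acomp1m ri acomp1m.
Qed.

End FunctorCategory.

(** * Functors of projective dimension at most one *)

Section MonoCategory.
Variable C : addcat.

Record mono_arrow := MonoArrow {
  msrc : C;
  mtgt : C;
  marr : hom msrc mtgt;
  marrP : forall Z (x : hom Z msrc), acomp marr x = 0 -> x = 0
}.

Definition square (f g : mono_arrow) :=
  {p : hom (msrc f) (msrc g) * hom (mtgt f) (mtgt g) |
    acomp p.2 (marr f) = acomp (marr g) p.1}.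

(** The homotopy s is tested at the sources only. What it leaves over at the targets kills [marr f],
    so it induces a map from the presented functor to a representable one, which vanishes stably. *)
Definition square_eq (f g : mono_arrow) (p q : square f g) :=
  exists s : hom (mtgt f) (msrc g), (sval p).1 - (sval q).1 = acomp s (marr f).

Definition square_id (f : mono_arrow) : square f f.
Proof. by exists (aid _, aid _); rewrite /= acomp1m acompm1. Defined.

Fact square_comp_subproof (f g h : mono_arrow) (q : square g h) (p : square f g) :
  acomp (acomp (sval q).2 (sval p).2) (marr f) = acomp (marr h) (acomp (sval q).1 (sval p).1).
Proof. by rewrite -acompA (svalP p) acompA (svalP q) acompA. Qed.

Definition square_comp (f g h : mono_arrow) (q : square g h) (p : square f g) : square f h :=
  exist _ (acomp (sval q).1 (sval p).1, acomp (sval q).2 (sval p).2)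
    (square_comp_subproof q p).

Definition monocat : category.
Proof.
refine (@Category mono_arrow square square_eq _ _ _ square_id square_comp _ _ _ _).
- by move=> f g p; exists 0; rewrite subrr acomp0m.
- by move=> f g p q [s e]; exists (- s); rewrite acompNm -e opprB.
- by move=> f g p q r [s e] [t e']; exists (s + t); rewrite acompDl -e -e' subrKA.
- move=> f g h q q' p p' [s e] [t e'].
  exists (acomp (sval q).1 t + acomp s (sval p').2) => /=.
  rewrite acompDl -!acompA -e' (svalP p') (acompA s) -e acompBr acompBl.
  by rewrite subrKA.
- by move=> e f g h r q p; exists 0; rewrite /= acompA subrr acomp0m.
- by move=> f g p; exists 0; rewrite /= acomp1m subrr acomp0m.
- by move=> f g p; exists 0; rewrite /= acompm1 subrr acomp0m.
Defined.

Record mono_presentation := MonoPresentation {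
  mp_arr : mono_arrow;
  mp_fun : stableP1 C;
  mp_map : nattrans (representable (mtgt mp_arr)) (sval mp_fun);
  mp_exact : nt_exact (postcomp (marr mp_arr)) mp_map;
  mp_surj : nt_surjective mp_map
}.

Arguments mp_map : clear implicits.
Arguments mp_exact : clear implicits.
Arguments mp_surj : clear implicits.

Definition presents (s t : mono_presentation) (p : @mor monocat (mp_arr s) (mp_arr t))
    (phi : @mor (stableP1 C) (mp_fun s) (mp_fun t)) :=
  forall Z x, phi Z (mp_map s Z x) = mp_map t Z (acomp (sval p).2 x).

Lemma mp_comp0 (t : mono_presentation) Z (y : hom Z _) : mp_map t Z (acomp (marr (mp_arr t)) y) = 0.
Proof. by apply/(mp_exact t _ _); exists y. Qed.

Lemma square_exists (s t : mono_presentation) (phi : nattrans (sval (mp_fun s)) (sval (mp_fun t)))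
    (b : hom (mtgt (mp_arr s)) (mtgt (mp_arr t))) :
  (forall Z x, phi Z (mp_map s Z x) = mp_map t Z (acomp b x)) ->
  exists a : hom (msrc (mp_arr s)) (msrc (mp_arr t)),
    acomp b (marr (mp_arr s)) = acomp (marr (mp_arr t)) a.
Proof.
move=> bE; have [|a aE] := (mp_exact t _ (acomp b (marr (mp_arr s)))).1; last by exists a.
by rewrite -bE -[marr _]acompm1 mp_comp0 raddf0.
Qed.

Lemma presents_full (s t : mono_presentation) phi : exists p, @presents s t p phi.
Proof.
have [b bE] := mp_surj t _ (phi _ (mp_map s _ (aid _))).
have H Z x : phi Z (mp_map s Z x) = mp_map t Z (acomp b x).
  rewrite [in LHS](rep_elt (mp_map s)) nt_natural -bE.
  by rewrite -nt_natural.
by have [a e] := square_exists H; exists (exist _ (a, b) e).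
Qed.

Lemma presents_exists (s t : mono_presentation) p : exists phi, @presents s t p phi.
Proof.
have [|phi phiE] := @nt_factor _ _ _ _ (mp_map s)
    (nt_comp (mp_map t) (postcomp (sval p).2)) (mp_surj s); last by exists phi.
move=> X x /(mp_exact s _ _)[y <-]; rewrite /= /postcomp_at acompA (svalP p) -acompA.
exact: mp_comp0.
Qed.

Lemma presents_eq (s t : mono_presentation) p p' phi phi' :
  @presents s t p phi -> presents p' phi' -> (eqm p p' <-> eqm phi phi').
Proof.
move=> H H'; have [mt mt'] := (marrP (m := mp_arr t), svalP p).
have dE : acomp ((sval p).2 - (sval p').2) (marr (mp_arr s)) =
    acomp (marr (mp_arr t)) ((sval p).1 - (sval p').1).
  by rewrite acompBl acompBr (svalP p) (svalP p').
have dphi Z x : phi Z (mp_map s Z x) - phi' Z (mp_map s Z x) =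
    mp_map t Z (acomp ((sval p).2 - (sval p').2) x).
  by rewrite H H' -raddfB acompBl.
split=> [[h e]|[P [beta [gamma [projP e]]]]].
  pose u := (sval p).2 - (sval p').2 - acomp (marr (mp_arr t)) h.
  have [|b bE] := @nt_factor _ _ _ _ (mp_map s) (postcomp u) (mp_surj s).
    move=> X x /(mp_exact s _ _)[y <-].
    by rewrite /= /postcomp_at acompA /u acompBl dE e -!acompA subrr acomp0m.
  exists (repf (mtgt (mp_arr t))), (b : mor (sval (mp_fun s)) (repf _)), (mp_map t).
  split; first exact: rep_projective.
  move=> X y; have [x <-] := mp_surj s _ y; rewrite dphi bE /= /postcomp_at /u.
  by rewrite [in RHS]acompBl raddfB /= -acompA mp_comp0 subr0.
have [Y [q [r qr]]] := projective_retract projP.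
(* P is a retract of a representable functor, so by Yoneda the factorization through P becomes two
   morphisms [t0] and [w] of C. Exactness writes the difference of the second components minus w t0
   as [marr] after some h; since t0 kills the monomorphism of s, this h is the homotopy. *)
pose t0 := r _ (beta _ (mp_map s _ (aid _))).
have t0E Z x : r Z (beta Z (mp_map s Z x)) = acomp t0 x.
  by rewrite [in LHS](rep_elt (mp_map s)) !nt_natural.
have t00 : acomp t0 (marr (mp_arr s)) = 0.
  by rewrite -t0E -[marr _]acompm1 mp_comp0 !raddf0.
have [w wE] := mp_surj t _ (gamma _ (q _ (aid Y))).
have gE Z (y : hom Z Y) : gamma Z (q Z y) = mp_map t Z (acomp w y).
  by rewrite [in LHS](rep_elt q) nt_natural -wE -nt_natural.
have [|h hE] := (mp_exact t _ ((sval p).2 - (sval p').2 - acomp w t0)).1.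
  rewrite raddfB /= -[X in mp_map t _ X - _]acompm1 -dphi e -gE.
  by rewrite -[t0]acompm1 -t0E qr subrr.
exists h; apply/eqP; rewrite -subr_eq0; apply/eqP; apply: marrP.
rewrite acompBr -dE acompA; move: hE; rewrite /= /postcomp_at => ->.
by rewrite [in X in _ - X]acompBl -[in X in _ - X]acompA t00 acompm0 subr0 subrr.
Qed.

Lemma mono_presented (f : mono_arrow) : exists t, mp_arr t = f.
Proof.
have [Q [p [fp ps]]] := nt_cokernel (postcomp (marr f)).
have Qfp := cokernel_fp fp ps (rep_fp _) (rep_fp _).
have pd : pd_le1 (Fpfun Qfp : modcat C).
  exists (repf (msrc f)), (repf (mtgt f)), (postcomp (marr f)), p.
  split=> //; try exact: rep_projective.
  move=> Z x y; rewrite /= /postcomp_at => e; apply/eqP; rewrite -subr_eq0; apply/eqP.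
  by apply: (@marrP f); rewrite acompBr e subrr.
by exists (@MonoPresentation f (exist _ (Fpfun Qfp : modcat C) pd) p fp ps).
Qed.

Hypothesis ic : idempotent_complete C.

Lemma pd_le1_presented (F : stableP1 C) : exists t, mp_fun t = F.
Proof.
case: F => F pdF; have [P1 [P0 [i [p [pP1 pP0 ii ip ps]]]]] := pdF.
have [X1 [u1 [v1 [uv1 vu1]]]] := projective_representable ic pP1.
have [X0 [u0 [v0 [uv0 vu0]]]] := projective_representable ic pP0.
pose f : hom X1 X0 := v0 X1 (i X1 (u1 X1 (aid X1))).
have fE Z x : v0 Z (i Z (u1 Z x)) = acomp f x.
  by rewrite [in LHS](rep_elt u1) !nt_natural.
have fm Z (x : hom Z X1) : acomp f x = 0 -> x = 0.
  rewrite -fE => e; rewrite -(vu1 Z x); have: i Z (u1 Z x) = i Z 0.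
    by rewrite -(uv0 Z (i Z _)) e !raddf0.
  by move=> /ii ->; rewrite raddf0.
have fp : nt_exact (postcomp f) (nt_comp p u0).
  move=> Z y /=; rewrite /postcomp_at; split=> [/ip[z zE]|[x <-]].
    by exists (v1 Z z); rewrite -fE uv1 zE vu0.
  by apply/ip; exists (u1 Z x); rewrite -fE uv0.
have ps' : nt_surjective (nt_comp p u0).
  by move=> Z y; have [z <-] := ps Z y; exists (v0 Z z); rewrite /= uv0.
by exists (@MonoPresentation (MonoArrow fm) (exist _ F pdF) (nt_comp p u0) fp ps').
Qed.

Lemma monocat_stableP1 : correspondence monocat (stableP1 C).
Proof.
exists mono_presentation, mp_arr, mp_fun, presents; split.
- by split; [exact: mono_presented | exact: pd_le1_presented].
- by split=> s t f; [exact: presents_exists | exact: presents_full].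
- by move=> t Z x; rewrite /= acomp1m.
- by move=> s t u f g f' g' H' H Z x /=; rewrite H H' acompA.
- by move=> s t f g f' g'; apply: presents_eq.
Qed.

End MonoCategory.

(** * Stable categories of modules *)

Lemma idempotent_complete_op (C : addcat) :
  idempotent_complete C -> idempotent_complete (opaddcat C).
Proof.
move=> ic X e ee; have [Y [i [r [ri ir]]]] := ic X e ee.
by exists Y, r, i.
Qed.

Section StableModules.
Variables (S : pzRingType) (M : addsub S).

Definition factors_through_M (A B : fgmod S) (f : A -> B) :=
  exists (X : fgmod S) (u : {linear A -> X}) (v : {linear X -> B}),
    M X /\ forall a, f a = v (u a).

Lemma factors_through_M0 (A B : fgmod S) : factors_through_M (fun _ : A => 0 : B).
Proof.
have [Z [MZ Z0]] := sub_zero M; exists Z, \0, \0; split=> // a.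
Qed.

Lemma factors_through_MN (A B : fgmod S) (f : A -> B) :
  factors_through_M f -> factors_through_M (fun a => - f a).
Proof.
by move=> [X [u [v [MX E]]]]; exists X, u, (\- v); split=> // a; rewrite E.
Qed.

Lemma factors_through_MD (A B : fgmod S) (f g : A -> B) :
  factors_through_M f -> factors_through_M g -> factors_through_M (fun a => f a + g a).
Proof.
move=> [X [u [v [MX E]]]] [Y [u' [v' [MY E']]]].
have [T [h [MT [k hk kh]]]] := sub_biprod MX MY.
have k_lin := can2_linear hk kh.
exists T, (linmap_comp (Lin k_lin) (pairing u u')), (linmap_comp (copair v v') h).
by split=> // a; rewrite /= kh /= E E'.
Qed.

Lemma factors_through_M_comp (A B D E : fgmod S) (f : A -> B) (g : {linear B -> D})
    (h : {linear E -> A}) :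
  factors_through_M f -> factors_through_M (fun a => g (f (h a))).
Proof.
move=> [X [u [v [MX H]]]]; exists X, (linmap_comp u h), (linmap_comp g v).
by split=> // a; rewrite H.
Qed.

Definition stable_modules (Q : fgmod S -> Prop) : category.
Proof.
refine (@Category {A : fgmod S | Q A} (fun A B => linmap (sval A) (sval B))
  (fun A B f g => factors_through_M (fun a => f a - g a)) _ _ _
  (fun A => linmap_id (sval A)) (fun A B D g f => linmap_comp g f) _ _ _ _).
- move=> A B f; rewrite (_ : (fun a => _) = fun=> 0); first exact: factors_through_M0.
  by apply/funext => a; rewrite subrr.
- move=> A B f g /factors_through_MN; congr (factors_through_M _).
  by apply/funext => a; rewrite opprB.
- move=> A B f g h /factors_through_MD H /H; congr (factors_through_M _).
  by apply/funext => a; rewrite subrKA.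
- move=> A B D g g' f f' H /(@factors_through_M_comp _ _ _ _ _ g idfun) H'.
  have := factors_through_MD H' (factors_through_M_comp idfun f' H).
  congr (factors_through_M _); apply/funext => a /=.
  by rewrite raddfB subrKA.
- move=> A B D E h g f; rewrite (_ : (fun a => _) = fun=> 0); first exact: factors_through_M0.
  by apply/funext => a; rewrite subrr.
- move=> A B f; rewrite (_ : (fun a => _) = fun=> 0); first exact: factors_through_M0.
  by apply/funext => a; rewrite subrr.
move=> A B f; rewrite (_ : (fun a => _) = fun=> 0); first exact: factors_through_M0.
by apply/funext => a; rewrite subrr.
Defined.

End StableModules.

(** * Approximations and Ext over a cluster tilting subcategory *)

Section ClusterTilting.
Variable S : pzRingType.
Hypothesis noethS : forall V : lmodType S, fin_gen V -> noetherian V.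
Hypothesis enough_injectives : forall Y : fgmod S,
  exists (I : fgmod S) (j : {linear Y -> I}),
    relatively_injective I /\ forall y, j y = 0 -> y = 0.
Variables (M : addsub S) (n : nat).
Hypothesis n2 : (2 <= n)%N.
Hypothesis ctM : cluster_tilting M n.

Implicit Types A B X Y : fgmod S.
Local Notation C := (sub_addcat M).

Lemma extMM X Y i : M X -> M Y -> (0 < i < n)%N -> ext_vanishes i X Y.
Proof. by case: ctM => _ _ _ H _ MX MY; apply: (H Y).1. Qed.

Lemma memM_into A : (forall X, M X -> forall i, (0 < i < n)%N -> ext_vanishes i X A) -> M A.
Proof. by case: ctM => _ _ _ H _; apply: (H A).2. Qed.

Lemma memM_from A : (forall X, M X -> forall i, (0 < i < n)%N -> ext_vanishes i A X) -> M A.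
Proof. by case: ctM => _ _ _ _ H; apply: (H A).2. Qed.

(** M is cut out by the vanishing of Ext, which passes to retracts. *)
Lemma memM_retract X A (i : {linear A -> X}) (r : {linear X -> A}) :
  M X -> (forall a, r (i a) = a) -> M A.
Proof.
move=> MX ri; apply: memM_into => Y MY [|j] jn; first by [].
have [P [d [e [res H]]]] := extMM MY MX jn.
exists P, d, e; split=> // f fd.
have [x|g gE] := H (linmap_comp i f); first by rewrite /=; have /= -> := fd x; rewrite raddf0.
by exists (linmap_comp r g) => x; rewrite /=; have /= -> := gE x; rewrite /= ri.
Qed.

Lemma idempotent_complete_M : idempotent_complete C.
Proof.
move=> [X MX] e /= ee; have eE x : e (e x) = e x.
  by rewrite -[RHS](congr1 (fun h : linmap X X => h x) ee).
have sI := submod_image e (submodT X).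
pose A := sub_fgmod noethS sI; pose i : {linear A -> X} := sub_incl sI.
have [|r rE] := @factor_inj _ _ _ _ i e (@sub_incl_eq0 _ _ _ sI).
  by move=> x; apply: sub_incl_onto; exists x.
have ri a : r (i a) = a.
  apply: (linear_inj (@sub_incl_eq0 _ _ _ sI)); rewrite -[LHS]/(i (r (i a))) rE.
  by have [x _ <-] := sub_inclP a; apply: eE.
exists (exist _ A (memM_retract MX ri)), i, r.
by split; apply: linmapP.
Qed.

(** The kernel of f need not lie in M, but M is generating: an object of M mapping onto the kernel
    serves as the test object. *)
Lemma mono_injective (X1 X0 : C) (f : hom X1 X0) :
  (forall Z (x : hom Z X1), acomp f x = 0 -> x = 0) ->
  forall x : sval X1, (f : linmap _ _) x = 0 -> x = 0.
Proof.
case: X1 f => X1 M1; case: X0 => X0 M0 /= f fm x fx.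
pose K := sub_fgmod noethS (submod_ker f).
have [G [g [MG gs]]] : exists (G : fgmod S) (g : {linear G -> K}), M G /\ forall a, exists x, g x = a.
  by case: ctM => _ gen _ _ _; apply: gen.
have [k kE] := sub_incl_onto (submod_ker f) fx; have [y yE] := gs k.
have := fm (exist _ G MG) (linmap_comp (sub_incl (submod_ker f)) g) _.
rewrite -kE -yE => /(_ _)/(congr1 (fun h : linmap G X1 => h y)); apply.
by apply: linmapP => z; apply: (sub_inclP (g z)).
Qed.

Lemma epi_onto (X0 X1 : C) (f : hom X0 X1) :
  (forall Z (x : hom X1 Z), acomp x f = 0 -> x = 0) ->
  forall y : sval X1, exists x, (f : linmap _ _) x = y.
Proof.
case: X1 f => X1 M1; case: X0 => X0 M0 /= f fm y.
have sI := submod_image f (submodT X0).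
have [G [g [MG gi]]] : exists (G : fgmod S) (g : {linear quot_fgmod (fgmP X1) sI -> G}),
    M G /\ injective g by case: ctM => _ _ cog _ _; apply: cog.
have := fm (exist _ G MG) (linmap_comp g (quot_proj sI)) _.
have g0 : linmap_comp (linmap_comp g (quot_proj sI)) f = 0.
  apply: linmapP => z; rewrite /= (_ : quot_proj sI (f z) = 0) ?raddf0 //.
  by apply/quot_proj_eq0; exists z.
move=> /(_ g0)/(congr1 (fun h : linmap X1 G => h y)) gy.
have /quot_proj_eq0[x _ <-] : quot_proj sI y = 0; last by exists x.
by apply: gi; rewrite raddf0.
Qed.

(** The chain of exchanges runs from (n - 2, 0), the cokernels of monomorphisms of M, to (0, n - 2),
    the kernels of epimorphisms, with p + q constant. One degree more on either side, n - 1, would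
    force A into M. *)
Definition ext_range (p q : nat) A :=
  (forall Y, M Y -> forall i, (0 < i <= p)%N -> ext_vanishes i Y A) /\
  (forall Y, M Y -> forall i, (0 < i <= q)%N -> ext_vanishes i A Y).

Lemma right_approx_onto A X (p : {linear X -> A}) :
  right_approximation M p -> forall a, exists x, p x = a.
Proof.
move=> [MX ap] a; case: ctM => _ gen _ _ _; have [G [g [MG gs]]] := gen A.
by have [x <-] := gs a; have [h hE] := ap G MG g; exists (h x); have /= -> := hE x.
Qed.

Lemma left_approx_inj A X (i : {linear A -> X}) :
  left_approximation M i -> forall a, i a = 0 -> a = 0.
Proof.
move=> [MX ap] a ia; case: ctM => _ _ cog _ _; have [G [g [MG gi]]] := cog A.
have [h hE] := ap G MG g; apply: gi; rewrite raddf0.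
by have /= <- := hE a; rewrite ia raddf0.
Qed.

Section Conflations.
Variables (A X B : fgmod S) (i : {linear A -> X}) (p : {linear X -> B}).
Hypotheses (ip : short_exact i p) (MX : M X).

Lemma approx_right : (forall Y, M Y -> ext_vanishes 1 Y A) -> right_approximation M p.
Proof.
move=> eA; split=> // Y MY g.
by have [h hE] := ext_lift noethS enough_injectives ip (eA Y MY) g; exists h.
Qed.

Lemma approx_left : (forall Y, M Y -> ext_vanishes 1 B Y) -> left_approximation M i.
Proof.
move=> eB; split=> // Y MY g.
by have [h hE] := ext_extend noethS enough_injectives ip (eB Y MY) g; exists h.
Qed.

(** Degree one is the approximation property, read through the connecting map. In higher degrees
    Ext^k(Y, A) is squeezed between Ext^(k-1)(Y, B) and Ext^k(Y, X), and the latter vanishes for k <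
    n. *)
Lemma ext_range_kernel q Y k : M Y -> right_approximation M p ->
  (forall i, (0 < i <= q)%N -> ext_vanishes i Y B) ->
  (q.+1 < n)%N -> (0 < k <= q.+1)%N -> ext_vanishes k Y A.
Proof.
move=> MY [_ ap] eB qn; case: k => // -[|k] kq.
  apply: (ext_of_lift noethS enough_injectives ip); first by apply: extMM.
  by move=> f; have [g gE] := ap Y MY f; exists g.
apply: (ext_into_kernel noethS enough_injectives ip); first by apply: eB.
by apply: extMM => //; apply: leq_ltn_trans qn.
Qed.

Lemma ext_range_cokernel q Y k : M Y -> left_approximation M i ->
  (forall i, (0 < i <= q)%N -> ext_vanishes i A Y) ->
  (q.+1 < n)%N -> (0 < k <= q.+1)%N -> ext_vanishes k B Y.
Proof.
move=> MY [_ ap] eA qn; case: k => // -[|k] kq.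
  apply: (ext_of_extend noethS enough_injectives ip); first by apply: extMM.
  by move=> f; have [g gE] := ap Y MY f; exists g.
apply: (ext_from_cokernel noethS enough_injectives ip); first by apply: eA.
by apply: extMM => //; apply: leq_ltn_trans qn.
Qed.

Lemma ext_range_cokernel_into q Y k : M Y ->
  (forall i, (0 < i <= q.+1)%N -> ext_vanishes i Y A) ->
  (q < n)%N -> (0 < k <= q)%N -> ext_vanishes k Y B.
Proof.
move=> MY eA qn; case: k => // k kq.
apply: (ext_into_cokernel noethS enough_injectives ip); first by apply: eA.
by apply: extMM => //; apply: leq_ltn_trans qn.
Qed.

Lemma ext_range_kernel_from q Y k : M Y ->
  (forall i, (0 < i <= q.+1)%N -> ext_vanishes i B Y) ->
  (q < n)%N -> (0 < k <= q)%N -> ext_vanishes k A Y.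
Proof.
move=> MY eB qn; case: k => // k kq.
apply: (ext_from_kernel noethS enough_injectives ip); first by apply: eB.
by apply: extMM => //; apply: leq_ltn_trans qn.
Qed.

End Conflations.

Section ConflationMaps.
Variables (A X B A' X' B' : fgmod S).
Variables (i : {linear A -> X}) (p : {linear X -> B}).
Variables (i' : {linear A' -> X'}) (p' : {linear X' -> B'}).
Hypotheses (ip : short_exact i p) (ip' : short_exact i' p').

Lemma conflation_ker (b : {linear X -> X'}) (c : {linear B -> B'}) :
  (forall x, p' (b x) = c (p x)) -> exists a : {linear A -> A'}, forall y, i' (a y) = b (i y).
Proof.
move=> bc; apply: (ses_factor_inj ip' (f := linmap_comp b i)) => u.
by rewrite /= bc (ses_comp0 ip) raddf0.
Qed.

Lemma conflation_coker (a : {linear A -> A'}) (b : {linear X -> X'}) :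
  (forall y, i' (a y) = b (i y)) -> exists c : {linear B -> B'}, forall x, c (p x) = p' (b x).
Proof.
move=> ab; apply: (ses_factor_surj ip (f := linmap_comp p' b)) => u.
by rewrite /= -ab (ses_comp0 ip').
Qed.

End ConflationMaps.

(* A map of conflations with middle terms in M is null homotopic as soon as it
   is so at one end. *)
Section Homotopy.
Variables (A X B A' X' B' : fgmod S).
Variables (i : {linear A -> X}) (p : {linear X -> B}).
Variables (i' : {linear A' -> X'}) (p' : {linear X' -> B'}).
Hypotheses (ip : short_exact i p) (ip' : short_exact i' p').
Variables (a : A -> A') (b : {linear X -> X'}) (c : B -> B').
Hypotheses (ab : forall y, i' (a y) = b (i y)) (bc : forall x, c (p x) = p' (b x)).

Lemma coker_factors_of_extension (s : {linear X -> A'}) :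
  (forall y, a y = s (i y)) -> exists w : {linear B -> X'}, forall z, c z = p' (w z).
Proof.
move=> aE; have [h hE] := sub_linear b (linmap_comp i' s).
have [|w wE] := ses_factor_surj ip (f := h).
  by move=> y; rewrite hE /= -aE ab subrr.
exists w => z; have [_ _ /(_ z)[x <-]] := ip.
by rewrite bc wE hE raddfB /= (ses_comp0 ip') subr0.
Qed.

Lemma extension_of_coker_factors (w : {linear B -> X'}) :
  (forall z, c z = p' (w z)) -> exists s : {linear X -> A'}, forall y, a y = s (i y).
Proof.
move=> cE; have [h hE] := sub_linear b (linmap_comp w p).
have [|s sE] := ses_factor_inj ip' (f := h).
  by move=> x; rewrite hE raddfB /= -cE -bc subrr.
exists s => y; have [ii _ _] := ip'; apply: (linear_inj ii).
by rewrite ab sE hE /= (ses_comp0 ip) raddf0 subr0.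
Qed.

(** Every map from M to B' lifts along the right approximation p', so factoring through M can be
    tested on this one map. *)
Lemma coker_factors_through_M : M X' -> right_approximation M p' ->
  factors_through_M M c <-> exists w : {linear B -> X'}, forall z, c z = p' (w z).
Proof.
move=> MX' [_ ap]; split=> [[Y [u [v [MY cE]]]]|[w wE]]; last by exists X', w, p'.
have [h hE] := ap Y MY v; exists (linmap_comp h u) => z.
by rewrite cE /=; have /= -> := hE (u z).
Qed.

Lemma ker_factors_through_M : M X -> left_approximation M i ->
  factors_through_M M a <-> exists s : {linear X -> A'}, forall y, a y = s (i y).
Proof.
move=> MX [_ ap]; split=> [[Y [u [v [MY aE]]]]|[s sE]]; last by exists X, i, s.
have [h hE] := ap Y MY u; exists (linmap_comp v h) => z.
by rewrite aE /=; have /= -> := hE z.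
Qed.

End Homotopy.

(** * Cokernels of monomorphisms of M *)

Section MonosAndCokernels.

Lemma memM (X : C) : M (sval X).
Proof. by case: X. Qed.

Record mono_cokernel := MonoCokernel {
  mc_arr : mono_arrow C;
  mc_obj : stable_modules M (ext_range (n - 2) 0);
  mc_proj : {linear sval (mtgt mc_arr) -> sval mc_obj};
  mc_ses : short_exact (marr mc_arr : linmap _ _) mc_proj
}.

Lemma extM1 X Y : M X -> M Y -> ext_vanishes 1 X Y.
Proof. by move=> MX MY; apply: extMM. Qed.

Lemma mc_approx t : right_approximation M (mc_proj t).
Proof.
apply: (approx_right (mc_ses t)); first exact: (memM (mtgt _)).
by move=> Y MY; apply: extM1 => //; exact: (memM (msrc _)).
Qed.

Lemma monocat_stable_modules :
  correspondence (monocat C) (stable_modules M (ext_range (n - 2) 0)).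
Proof.
exists mono_cokernel, mc_arr, mc_obj, (fun s t sq c =>
  forall x, (c : linmap _ _) (mc_proj s x) = mc_proj t (((sval sq).2 : linmap _ _) x)).
split; first split.
- move=> f; have fi := mono_injective (@marrP _ f).
  have [B [p fp]] := cokernel_ses fi.
  (* Passing to the cokernel loses one degree: Ext^i(M, -) vanishes on the source of f for 0 < i <=
     n - 1, hence on B for 0 < i <= n - 2. *)
  suff WB : ext_range (n - 2) 0 B by exists (@MonoCokernel f (exist _ B WB) p fp).
  split=> [Y MY i ir|Y MY []//].
  apply: (ext_range_cokernel_into fp (memM (mtgt f)) MY _ _ ir).
    move=> k /andP[k0 kn]; apply: extMM => //; first exact: (memM (msrc f)).
    by move: n2 kn; lia.
  by move: n2; lia.
- move=> [B WB]; have [ff _ _ _ _] := ctM; have [[X [p ap]] _] := ff B.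
  have MX := ap.1; have [A [i ip]] := kernel_ses noethS (right_approx_onto ap).
  (* The kernel of an approximation regains that degree: n - 2 vanishing degrees for B become n - 1
     for A, which is membership in M. *)
  have MA : M A.
    apply: memM_into => Y MY k /andP[k0 kn].
    apply: (ext_range_kernel ip MX MY ap (q := n - 2)).
    + by move=> j jr; apply: WB.1.
    + by move: n2; lia.
    + by move: n2 kn k0; lia.
  have im Z (x : @hom C Z (exist _ A MA)) :
      @acomp C Z (exist _ A MA) (exist _ X MX) i x = 0 -> x = 0.
    move=> ix; apply: linmapP => z; have [ii _ _] := ip; apply: ii.
    exact: (congr1 (fun h : linmap _ _ => h z) ix).
  by exists (@MonoCokernel (MonoArrow im) (exist _ B WB) p ip).
- split=> s t.
    move=> sq; have [|c cE] := @conflation_coker _ _ _ _ _ _ _ _ _ _ (mc_ses s) (mc_ses t)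
        ((sval sq).1 : linmap _ _) ((sval sq).2 : linmap _ _).
      by move=> y; exact: (congr1 (fun h : linmap _ _ => h y) (esym (svalP sq))).
    by exists c.
  move=> c; have [_ ap] := mc_approx t.
  have [b bE] := ap _ (memM (mtgt (mc_arr s))) (linmap_comp c (mc_proj s)).
  have [|a aE] := @conflation_ker _ _ _ _ _ _ _ _ _ _ (mc_ses s) (mc_ses t) b c.
    by move=> x; exact: bE.
  have e : acomp (b : hom (mtgt (mc_arr s)) (mtgt (mc_arr t))) (marr (mc_arr s)) =
      acomp (marr (mc_arr t)) (a : hom (msrc (mc_arr s)) (msrc (mc_arr t))).
    by apply: linmapP => y; exact: (esym (aE y)).
  by exists (exist _ (a, b) e) => x; exact: (esym (bE x)).
- by [].
- by move=> s t u f g f' g' H' H x; rewrite /= H H'.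
move=> s t sq c sq' c' H H'.
have [b bE] : exists b : linmap _ _, forall x, b x = ((sval sq).2 : linmap _ _) x - ((sval sq').2 : linmap _ _) x.
  exact: sub_linear.
have [a aE] : exists b : linmap _ _, forall x, b x = ((sval sq).1 : linmap _ _) x - ((sval sq').1 : linmap _ _) x.
  exact: sub_linear.
have ab y : (marr (mc_arr t) : linmap _ _) (a y) = b ((marr (mc_arr s) : linmap _ _) y).
  rewrite aE bE raddfB; congr (_ - _).
    exact: (congr1 (fun h : linmap _ _ => h y) (esym (svalP sq))).
  exact: (congr1 (fun h : linmap _ _ => h y) (esym (svalP sq'))).
have bc x : c (mc_proj s x) - c' (mc_proj s x) = mc_proj t (b x).
  by rewrite bE raddfB H H'.
have E1 := coker_factors_through_M (fun x => c x - c' x) (memM (mtgt (mc_arr t))) (mc_approx t).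
split=> [[h hE]|/E1[w wE]].
  apply/E1; apply: (coker_factors_of_extension (mc_ses s) (mc_ses t) ab bc (s := (h : linmap _ _))).
  by move=> y; rewrite aE; exact: (congr1 (fun h : linmap _ _ => h y) hE).
have [h hE] := extension_of_coker_factors (mc_ses s) (mc_ses t) ab bc wE.
by exists h; apply: linmapP => y; rewrite -[RHS]hE aE.
Qed.

End MonosAndCokernels.

(** * Exchanging vanishing conditions along approximation sequences *)

Section Cosyzygies.
Variables p q : nat.
Hypothesis pq : (p.+1 + q <= n - 2)%N.

(** Both approximation properties are recorded: the left one extends maps given at the source end to
    the middle terms, the right one lifts maps given at the target end. *)
Record exchange := Exchange {
  ex_src : stable_modules M (ext_range p.+1 q);
  ex_tgt : stable_modules M (ext_range p q.+1);
  ex_mid : fgmod S;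
  ex_inj : {linear sval ex_src -> ex_mid};
  ex_proj : {linear ex_mid -> sval ex_tgt};
  ex_ses : short_exact ex_inj ex_proj;
  ex_left : left_approximation M ex_inj;
  ex_right : right_approximation M ex_proj
}.

Lemma cosyzygy_correspondence :
  correspondence (stable_modules M (ext_range p.+1 q)) (stable_modules M (ext_range p q.+1)).
Proof.
exists exchange, ex_src, ex_tgt, (fun s t a c => exists b : {linear ex_mid s -> ex_mid t},
  (forall y, ex_inj t ((a : linmap _ _) y) = b (ex_inj s y)) /\
  forall x, (c : linmap _ _) (ex_proj s x) = ex_proj t (b x)).
split; first split.
- move=> [A WA]; have [ff _ _ _ _] := ctM; have [_ [X [i ap]]] := ff A.
  have MX := ap.1; have [B [c ic]] := cokernel_ses (left_approx_inj ap).
  have WB : ext_range p q.+1 B.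
    split=> Y MY k kr.
      apply: (ext_range_cokernel_into ic MX MY (q := p)) => //; last by move: n2 pq; lia.
      by move=> j jr; apply: WA.1.
    apply: (ext_range_cokernel ic MX MY ap (q := q)) => //; last by move: n2 pq; lia.
    by move=> j jr; apply: WA.2.
  (* At least one degree is left on the first side, so Ext^1(M, A) = 0 and the cokernel of a left
     approximation is automatically a right approximation. *)
  have apr : right_approximation M c by apply: (approx_right ic MX) => Y MY; apply: WA.1.
  by exists (@Exchange (exist _ A WA) (exist _ B WB) X i c ic ap apr).
- move=> [B WB]; have [ff _ _ _ _] := ctM; have [[X [c ap]] _] := ff B.
  have MX := ap.1; have [A [i ic]] := kernel_ses noethS (right_approx_onto ap).
  have WA : ext_range p.+1 q A.
    split=> Y MY k kr.
      apply: (ext_range_kernel ic MX MY ap (q := p)) => //; last by move: n2 pq; lia.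
      by move=> j jr; apply: WB.1.
    apply: (ext_range_kernel_from ic MX MY (q := q)) => //; last by move: n2 pq; lia.
    by move=> j jr; apply: WB.2.
  have apl : left_approximation M i by apply: (approx_left ic MX) => Y MY; apply: WB.2.
  by exists (@Exchange (exist _ A WA) (exist _ B WB) X i c ic apl ap).
- split=> s t.
    move=> a; have [_ ap] := ex_left s.
    have [b bE] := ap _ (ex_left t).1 (linmap_comp (ex_inj t) a).
    have ab y : ex_inj t ((a : linmap _ _) y) = b (ex_inj s y) by rewrite -[LHS]bE.
    by have [c cE] := conflation_coker (ex_ses s) (ex_ses t) ab; exists c, b.
  move=> c; have [_ ap] := ex_right t.
  have [b bE] := ap _ (ex_right s).1 (linmap_comp c (ex_proj s)).
  have bc x : ex_proj t (b x) = (c : linmap _ _) (ex_proj s x) by exact: bE.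
  by have [a aE] := conflation_ker (ex_ses s) (ex_ses t) bc; exists a, b; split=> // x; rewrite bc.
- by move=> t; exists idfun.
- move=> s t u f g f' g' [b' [ab' bc']] [b [ab bc]]; exists (linmap_comp b' b).
  by split=> x; rewrite /= ?ab' ?ab ?bc ?bc'.
move=> s t a c a' c' [b [ab bc]] [b' [ab' bc']].
have [d dE] := sub_linear b b'.
have iE y : ex_inj t (a y - a' y) = d (ex_inj s y) by rewrite raddfB /= ab ab' dE.
have pE x : c (ex_proj s x) - c' (ex_proj s x) = ex_proj t (d x).
  by rewrite bc bc' -raddfB dE.
have El := ker_factors_through_M (fun y => a y - a' y) (ex_left s).1 (ex_left s).
have Er := coker_factors_through_M (fun y => c y - c' y) (ex_right t).1 (ex_right t).
split=> [/El[h hE]|/Er[w wE]].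
  apply/Er; exact: (coker_factors_of_extension (ex_ses s) (ex_ses t) iE pE hE).
by apply/El; exact: (extension_of_coker_factors (ex_ses s) (ex_ses t) iE pE wE).
Qed.

End Cosyzygies.

(** * Kernels of epimorphisms of M *)

Section EpisAndKernels.

(** A monomorphism of [opaddcat C] is an epimorphism of C with the ends exchanged: as a map of
    modules it goes from [mtgt] to [msrc], so its kernel sits in [mtgt]. *)
Record epi_kernel := EpiKernel {
  ek_arr : mono_arrow (opaddcat C);
  ek_obj : stable_modules M (ext_range 0 (n - 2));
  ek_inj : {linear sval ek_obj -> sval (mtgt ek_arr : C)};
  ek_ses : short_exact ek_inj
    (marr ek_arr : linmap (sval (mtgt ek_arr : C)) (sval (msrc ek_arr : C)))
}.

Lemma kernel_left_approx (X Y : C) (g : hom X Y) (K : fgmod S) (i : {linear K -> sval X}) :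
  short_exact i (g : linmap _ _) -> left_approximation M i.
Proof.
move=> ig; apply: (approx_left ig); first exact: memM.
by move=> Z MZ; apply: extM1 => //; exact: memM.
Qed.

Lemma kernel_ext_range (X Y : C) (g : hom X Y) (K : fgmod S) (i : {linear K -> sval X}) :
  short_exact i (g : linmap _ _) -> ext_range 0 (n - 2) K.
Proof.
move=> ig; split=> [Z MZ [] //|Z MZ k kr].
apply: (ext_range_kernel_from ig (memM X) MZ _ _ kr); last by move: n2; lia.
by move=> j jr; apply: extMM (memM Y) MZ _; move: n2 jr; lia.
Qed.

Lemma ext_range_kernel_exists K : ext_range 0 (n - 2) K ->
  exists (X Y : C) (g : hom X Y) (i : {linear K -> sval X}), short_exact i (g : linmap _ _).
Proof.
move=> WK; have [ff _ _ _ _] := ctM; have [_ [X [i ap]]] := ff K.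
have MX := ap.1; have [B [c ic]] := cokernel_ses (left_approx_inj ap).
have MB : M B.
  apply: memM_from => Y MY k kr.
  apply: (ext_range_cokernel ic MX MY ap (q := n - 2)); try by move: n2 kr; lia.
  by move=> j jr; apply: WK.2.
by exists (exist _ X MX), (exist _ B MB), c, i.
Qed.

Lemma epicat_stable_modules :
  correspondence (stable_modules M (ext_range 0 (n - 2))) (opcat (monocat (opaddcat C))).
Proof.
exists epi_kernel, ek_obj, ek_arr, (fun s t k sq =>
  forall x, ek_inj t ((k : linmap _ _) x) = ((sval sq).2 : linmap _ _) (ek_inj s x)).
split; first split.
- move=> [K WK]; have [X [Y [g [i ig]]]] := ext_range_kernel_exists WK.
  have gm Z (x : @hom (opaddcat C) Z Y) : @acomp (opaddcat C) Z Y X g x = 0 -> x = 0.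
    move=> xg; apply: linmapP => y; have [_ _ /(_ y)[z <-]] := ig.
    exact: (congr1 (fun h : linmap _ _ => h z) xg).
  by exists (@EpiKernel (@MonoArrow (opaddcat C) Y X g gm) (exist _ K WK) i ig).
- move=> f; have fs := epi_onto (@marrP _ f).
  have [K [i ig]] := kernel_ses noethS fs.
  by exists (@EpiKernel f (exist _ K (kernel_ext_range ig)) i ig).
- split=> s t.
    move=> k; have [_ ap] := kernel_left_approx (ek_ses s).
    have [b bE] := ap _ (memM (mtgt (ek_arr t) : C)) (linmap_comp (ek_inj t) k).
    have kb y : ek_inj t ((k : linmap _ _) y) = b (ek_inj s y) by rewrite -[LHS]bE.
    have [c cE] := conflation_coker (ek_ses s) (ek_ses t) kb.
    have e : @acomp (opaddcat C) _ _ _ (b : @hom (opaddcat C) (mtgt (ek_arr t)) (mtgt (ek_arr s)))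
        (marr (ek_arr t)) = @acomp (opaddcat C) _ _ _ (marr (ek_arr s))
        (c : @hom (opaddcat C) (msrc (ek_arr t)) (msrc (ek_arr s))).
      by apply: linmapP => y; exact: (esym (cE y)).
    by exists (exist _ (c, b) e).
  move=> sq.
  have [|k kE] := @conflation_ker _ _ _ _ _ _ _ _ _ _ (ek_ses s) (ek_ses t)
        ((sval sq).2 : linmap _ _) ((sval sq).1 : linmap _ _).
    by move=> y; exact: (congr1 (fun h : linmap _ _ => h y) (svalP sq)).
  by exists k.
- by [].
- by move=> s t u k sq k' sq' H' H x; rewrite /= H' H.
move=> s t k sq k' sq' H H'.
have [b bE] : exists b : linmap _ _, forall x, b x = ((sval sq).2 : linmap _ _) x - ((sval sq').2 : linmap _ _) x.
  exact: sub_linear.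
have [c cE] : exists b : linmap _ _, forall x, b x = ((sval sq).1 : linmap _ _) x - ((sval sq').1 : linmap _ _) x.
  exact: sub_linear.
have kb x : ek_inj t (k x - k' x) = b (ek_inj s x) by rewrite raddfB /= H H' bE.
have bc x : c ((marr (ek_arr s) : linmap _ _) x) = (marr (ek_arr t) : linmap _ _) (b x).
  rewrite cE bE raddfB; congr (_ - _).
    exact: (congr1 (fun h : linmap _ _ => h x) (esym (svalP sq))).
  exact: (congr1 (fun h : linmap _ _ => h x) (esym (svalP sq'))).
have El := ker_factors_through_M (fun x => k x - k' x) (memM (mtgt (ek_arr s) : C))
  (kernel_left_approx (ek_ses s)).
split=> [/El[h hE]|[w wE]].
  have [w wE] := coker_factors_of_extension (ek_ses s) (ek_ses t) kb bc hE.
  by exists w; apply: linmapP => y; rewrite -[RHS]wE cE.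
apply/El; apply: (extension_of_coker_factors (ek_ses s) (ek_ses t) kb bc (w := (w : linmap _ _))).
by move=> y; rewrite cE; exact: (congr1 (fun h : linmap _ _ => h y) wE).
Qed.

End EpisAndKernels.

Lemma cosyzygy_equivalence p q : (p + q = n - 2)%N ->
  equivalent (stable_modules M (ext_range p q)) (stable_modules M (ext_range 0 (n - 2))).
Proof.
elim: p q => [|p IHp] q pq.
  by rewrite -pq add0n; apply: equivalent_refl.
apply: equivalent_trans (IHp q.+1 _); last by rewrite addnS.
by apply: correspondence_equivalent; apply: cosyzygy_correspondence; rewrite pq.
Qed.

Lemma stableP1_stable_modules :
  equivalent (stableP1 C) (stable_modules M (ext_range 0 (n - 2))).
Proof.
apply: equivalent_trans (cosyzygy_equivalence (addn0 _)).
apply: equivalent_trans (correspondence_equivalent monocat_stable_modules).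
apply: equivalent_sym; apply: correspondence_equivalent.
exact: monocat_stableP1 idempotent_complete_M.
Qed.

Lemma stableP1_op :
  equivalent (stableP1 C) (opcat (stableP1 (opaddcat C))).
Proof.
apply: equivalent_trans stableP1_stable_modules _.
apply: equivalent_trans (correspondence_equivalent epicat_stable_modules) _.
apply: correspondence_equivalent; apply: correspondence_op.
exact: monocat_stableP1 (idempotent_complete_op idempotent_complete_M).
Qed.

End ClusterTilting.

(** * Restriction of scalars and coinduction *)

Section Restriction.
Variables (R : comPzRingType) (L : algType R).

Definition scalar_elt (r : R) : L^c := r%:A.

Lemma scalar_eltM r s : scalar_elt (r * s) = scalar_elt r * scalar_elt s.
Proof. by rewrite /scalar_elt -[RHS]/((s%:A : L) * r%:A) mulr_algl scalerA mulrC. Qed.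

Lemma scalar_elt_central r (a : L^c) : scalar_elt r * a = a * scalar_elt r.
Proof.
by rewrite -[LHS]/((a : L) * r%:A) -[RHS]/((r%:A : L) * a) mulr_algl mulr_algr.
Qed.

Section RestrictionModule.
Variable V : lmodType L^c.

(* V as a module over the base ring R. *)
Definition rst : Type := V.
HB.instance Definition _ := GRing.Zmodule.on rst.

Let scale (r : R) (v : rst) : rst := scalar_elt r *: (v : V).

Fact rst_scaleA a b v : scale a (scale b v) = scale (a * b) v.
Proof. by rewrite /scale scalerA scalar_eltM. Qed.
Fact rst_scale1 : left_id 1 scale.
Proof. by move=> v; rewrite /scale /scalar_elt scale1r -[X in X *: _]/(1 : L^c) scale1r. Qed.
Fact rst_scaleDr : right_distributive scale +%R.
Proof. by move=> a x y; apply: scalerDr. Qed.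
Fact rst_scaleDl v : {morph scale^~ v : a b / a + b}.
Proof. by move=> a b; rewrite /scale /scalar_elt scalerDl; apply: (scalerDl (v : V)). Qed.

HB.instance Definition _ := GRing.Zmodule_isLmodule.Build R rst
  rst_scaleA rst_scale1 rst_scaleDr rst_scaleDl.

Lemma rstZ (r : R) (v : rst) : r *: v = scalar_elt r *: (v : V) :> V.
Proof. by []. Qed.

End RestrictionModule.

Section HomModule.
Variables U V : lmodType L^c.

(** A copy of the group of L-linear maps on which R acts. Scalar multiples stay L-linear because the
    image of R is central in L. *)
Definition homR : Type := linmap U V.
HB.instance Definition _ := GRing.Zmodule.on homR.

Fact homR_scale_linear r (f : linmap U V) : linear (fun x => scalar_elt r *: f x).
Proof.
move=> a x y; rewrite linearP scalerDr; congr (_ + _).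
by rewrite !scalerA scalar_elt_central.
Qed.

Let scale (r : R) (f : homR) : homR := Lin (homR_scale_linear r f).

Fact homR_scaleA a b f : scale a (scale b f) = scale (a * b) f.
Proof. by apply: linmapP => x; apply: (@rst_scaleA V). Qed.
Fact homR_scale1 : left_id 1 scale.
Proof. by move=> f; apply: linmapP => x; apply: (@rst_scale1 V). Qed.
Fact homR_scaleDr : right_distributive scale +%R.
Proof. by move=> a f g; apply: linmapP => x; apply: (@rst_scaleDr V). Qed.
Fact homR_scaleDl f : {morph scale^~ f : a b / a + b}.
Proof. by move=> a b; apply: linmapP => x; apply: (@rst_scaleDl V). Qed.

HB.instance Definition _ := GRing.Zmodule_isLmodule.Build R homR
  homR_scaleA homR_scale1 homR_scaleDr homR_scaleDl.

End HomModule.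

Lemma homR_eval (U V : lmodType L^c) (f g : homR U V) (r : R) x :
  ((r *: f + g : homR U V) : linmap U V) x = r *: ((f : linmap U V) x : rst V) + (g : linmap U V) x.
Proof. by []. Qed.

Fact rst_lin_linear (U V : lmodType L^c) (f : linmap U V) : linear (f : rst U -> rst V).
Proof. by move=> a x y; exact: (linearP f). Qed.
Definition rst_lin (U V : lmodType L^c) (f : linmap U V) : {linear rst U -> rst V} :=
  Lin (rst_lin_linear f).

Fact homR_post_linear (U V W : lmodType L^c) (f : linmap V W) :
  linear ((fun h => linmap_comp f h) : homR U V -> homR U W).
Proof. by move=> a g h; apply: linmapP => x; exact: (linearP (rst_lin f)). Qed.
Definition homR_post (U V W : lmodType L^c) (f : linmap V W) :
  {linear homR U V -> homR U W} := Lin (@homR_post_linear U V W f).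

Fact homR_pre_linear (U V W : lmodType L^c) (f : linmap U V) :
  linear ((fun h => linmap_comp h f) : homR V W -> homR U W).
Proof. by move=> a g h; apply: linmapP. Qed.
Definition homR_pre (U V W : lmodType L^c) (f : linmap U V) :
  {linear homR V W -> homR U W} := Lin (@homR_pre_linear U V W f).

Hypothesis fgL : fin_gen (L : lmodType R).

Lemma rst_fin_gen (V : lmodType L^c) : fin_gen V -> fin_gen (rst V).
Proof.
move=> [m [s sV]]; have [k [t tL]] := fgL; apply/fin_genP.
exists [seq (t p.2 : L^c) *: s p.1 : rst V | p <- enum {: 'I_m * 'I_k}] => v.
have [c ->] := sV v.
apply: (@submod_sum _ (rst V)) => [|i]; first exact: span_submod.
have [d dE] := tL (c i : L).
have -> : c i *: s i = \sum_j d j *: ((t j : L^c) *: s i : rst V) :> rst V.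
  under eq_bigr => j _ do rewrite rstZ scalerA -[scalar_elt _ * _]/((t j : L) * (d j)%:A) mulr_algr.
  by rewrite dE; apply: (@scaler_suml _ V).
apply: submod_sum => [|j]; first exact: span_submod.
apply: submodZ; [exact: span_submod | apply: mem_span].
by apply/mapP; exists (i, j); rewrite ?mem_enum.
Qed.

Lemma fin_gen_of_rst (V : lmodType L^c) : fin_gen (rst V) -> fin_gen V.
Proof.
move=> [m [s sV]]; exists m, s => v; have [c cE] := sV v.
by exists (fun i => scalar_elt (c i)).
Qed.

Hypothesis noethR : forall V : lmodType R, fin_gen V -> noetherian V.

Lemma rst_submod (V : lmodType L^c) (N : set V) : submod N -> submod (N : set (rst V)).
Proof. by case=> N0 sN; split=> // a x y Nx Ny; apply: sN. Qed.

Lemma artin_algebra_noetherian (V : lmodType L^c) : fin_gen V -> noetherian V.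
Proof.
move=> /rst_fin_gen fgV N sN; have [s Ns] := noethR fgV (rst_submod sN).
apply: (fg_submodP (s := s : seq V)) => // [x xs|v Nv].
  by rewrite Ns; apply: (@mem_span _ (rst V)).
have : span (s : seq (rst V)) v by rewrite -Ns.
elim: (s) v {Nv} => [|x s' IHs] v //= [a [w [/IHs sw ->]]].
by exists (scalar_elt a), w.
Qed.

(** Evaluation at generators of U embeds Hom(U, V) into a power of V, which is noetherian over R. *)
Lemma homR_fin_gen (U V : fgmod L^c) : fin_gen (homR U V).
Proof.
have [m [s sU]] := fgmP U.
have f_lin : linear ((fun h => [ffun i => (h : linmap U V) (s i)]) : homR U V -> {ffun 'I_m -> rst V}).
  by move=> a g h; apply/ffunP => i; rewrite !ffunE.
have fgT := fin_gen_ffun m (rst_fin_gen (fgmP V)).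
have fi (h : homR U V) : Lin f_lin h = 0 -> h = 0.
  move=> h0; apply: linmapP => u; have [c ->] := sU u.
  rewrite raddf_sum big1 // => i _; rewrite /= linearZ /=.
  by have := congr1 (fun g : {ffun 'I_m -> rst V} => g i) h0; rewrite !ffunE => ->; rewrite scaler0.
have sI := submod_image (Lin f_lin) (submodT (homR U V)).
have [|e eE] := @factor_inj _ _ _ _ (Lin f_lin) (sub_incl sI) fi.
  by move=> x; have [h _ hE] := sub_inclP x; exists h.
apply: (@fin_gen_onto _ _ _ e); last exact: (fg_submod_fin_gen sI (noethR fgT sI)).
move=> h; have [x xE] : exists x, sub_incl sI x = Lin f_lin h.
  by apply: sub_incl_onto; exists h.
by exists x; apply: (linear_inj fi); rewrite eE.
Qed.

End Restriction.

Section Coinduction.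
Variables (R : comPzRingType) (L : algType R) (E : lmodType R).

Local Notation pow k V := {ffun 'I_k -> rst V}.

Fact power_lmul_linear k (a : L) :
  linear ((fun x => [ffun i => a * x i]) : {ffun 'I_k -> L} -> {ffun 'I_k -> L}).
Proof. by move=> r x y; apply/ffunP => i; rewrite !ffunE mulrDr scalerAr. Qed.
Definition power_lmul k a := Lin (@power_lmul_linear k a).

Section CoinducedModule.
Variable k : nat.

(* The right module Hom_R(L^k, E). *)
Definition coind : Type := linmap {ffun 'I_k -> L} E.
HB.instance Definition _ := GRing.Zmodule.on coind.

Let scale (a : L^c) (w : coind) : coind := linmap_comp w (power_lmul k a).

Fact coind_scaleA a b w : scale a (scale b w) = scale (a * b) w.
Proof.
apply: linmapP => x; rewrite /=; congr (w _); apply/ffunP => i.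
by rewrite !ffunE -[a * b]/((b : L) * a) mulrA.
Qed.
Fact coind_scale1 : left_id 1 scale.
Proof.
move=> w; apply: linmapP => x; rewrite /=; congr (w _); apply/ffunP => i.
by rewrite !ffunE -[1]/(1 : L) mul1r.
Qed.
Fact coind_scaleDr : right_distributive scale +%R.
Proof. by move=> a v w; apply: linmapP. Qed.
Fact coind_scaleDl w : {morph scale^~ w : a b / a + b}.
Proof.
move=> a b; apply: linmapP => x /=; rewrite -raddfD; congr (w _); apply/ffunP => i.
by rewrite !ffunE mulrDl.
Qed.

HB.instance Definition _ := GRing.Zmodule_isLmodule.Build L^c coind
  coind_scaleA coind_scale1 coind_scaleDr coind_scaleDl.

Lemma coind_scalar (r : R) (w : rst coind) x : (r *: w : coind) x = r *: (w : coind) x.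
Proof.
rewrite -linearZ -[LHS]/((w : coind) (power_lmul k (scalar_elt L r) x)); congr ((w : coind) _).
by apply/ffunP => i; rewrite !ffunE mulr_algl.
Qed.

Definition unit_vec (i : 'I_k) : {ffun 'I_k -> L} := [ffun j => if j == i then 1 else 0].

Section Adjunction.
Variable Z : lmodType L^c.

Definition spread (z : Z) (x : {ffun 'I_k -> L}) : pow k Z := [ffun i => (x i : L^c) *: z].

Fact spread_linear z : linear (spread z).
Proof.
move=> r x y; apply/ffunP => i; rewrite !ffunE scalerDl; congr (_ + _).
by rewrite rstZ scalerA -[scalar_elt _ _ * _]/((x i : L) * r%:A) mulr_algr.
Qed.

Lemma spreadD a z z' x : spread (a *: z + z') x = spread z (power_lmul k a x) + spread z' x.
Proof. by apply/ffunP => i; rewrite !ffunE scalerDr scalerA. Qed.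

Fact adj_linear (eta : linmap (pow k Z) E) :
  linear ((fun z => linmap_comp eta (Lin (spread_linear z))) : Z -> coind).
Proof. by move=> a z z'; apply: linmapP => x; rewrite /= spreadD raddfD. Qed.
(** With [coadj] this is the adjunction Hom_L(Z, Hom_R(L^k, E)) = Hom_R(Z^k, E). Through it a
    k-tuple of elements of Z becomes a functional on the maps from Z to the coinduced module. *)
Definition adj (eta : linmap (pow k Z) E) : {linear Z -> coind} := Lin (adj_linear eta).

Fact coadj_linear (h : linmap Z coind) :
  linear ((fun z => \sum_i (h (z i) : coind) (unit_vec i)) : pow k Z -> E).
Proof.
move=> r z z'; rewrite scaler_sumr -big_split; apply: eq_bigr => i _ /=.
rewrite !ffunE -coind_scalar -[h (r *: z i + z' i)]/(rst_lin h (r *: z i + z' i)).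
by rewrite linearP.
Qed.
Definition coadj (h : linmap Z coind) : linmap (pow k Z) E := Lin (coadj_linear h).

Lemma adjK eta : coadj (adj eta) = eta.
Proof.
apply: linmapP => z; rewrite /= -raddf_sum; congr (eta _); apply/ffunP => i.
rewrite sum_ffunE (bigD1 i) //= big1 => [|j ji].
  by rewrite addr0 !ffunE eqxx; apply: (@scale1r _ Z).
by rewrite !ffunE eq_sym (negbTE ji); apply: (@scale0r _ Z).
Qed.

Lemma coadj_spread (h : linmap Z coind) z x : coadj h (spread z x) = h z x.
Proof.
rewrite /= -[in RHS](_ : \sum_i power_lmul k (x i) (unit_vec i) = x).
  rewrite raddf_sum; apply: eq_bigr => i _.
  by rewrite ffunE linearZ.
apply/ffunP => i; rewrite sum_ffunE (bigD1 i) //= big1 => [|j ji].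
  by rewrite addr0 !ffunE eqxx mulr1.
by rewrite !ffunE eq_sym (negbTE ji) mulr0.
Qed.

Lemma coadjK (h : linmap Z coind) : adj (coadj h) = h.
Proof. by apply: linmapP => z; apply: linmapP => x; rewrite -[RHS]coadj_spread. Qed.

Fact coadjR_linear : linear ((@coadj) : homR Z coind -> linmap (pow k Z) E).
Proof.
move=> r h h'; apply: linmapP => z; rewrite -[RHS]/(r *: coadj h z + coadj h' z) /=.
rewrite scaler_sumr -big_split; apply: eq_bigr => i _ /=.
by rewrite -coind_scalar.
Qed.
Definition coadjR : {linear homR Z coind -> linmap (pow k Z) E} := Lin coadjR_linear.

End Adjunction.

Section Map.
Variables (U V : lmodType L^c) (f : linmap U V).
Fact power_map_linear : linear ((fun z => [ffun i => f (z i)]) : pow k U -> pow k V).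
Proof.
move=> r z z'; apply/ffunP => i; rewrite !ffunE.
exact: (linearP (rst_lin f)).
Qed.
Definition power_map : {linear pow k U -> pow k V} := Lin power_map_linear.

Lemma coadj_comp (h : linmap V coind) z : coadj (linmap_comp h f) z = coadj h (power_map z).
Proof. by apply: eq_bigr => i _; rewrite ffunE. Qed.
End Map.

End CoinducedModule.

Hypothesis injE : relatively_injective E.
Hypothesis cogE : cogenerator E.
Hypothesis fgL : fin_gen (L : lmodType R).
Hypothesis noethR : forall V : lmodType R, fin_gen V -> noetherian V.

Lemma pow_fin_gen k (V : lmodType L^c) : fin_gen V -> fin_gen (pow k V).
Proof. by move=> fgV; apply: fin_gen_ffun; apply: rst_fin_gen. Qed.

(** The adjunction turns an extension problem into [coind k] over L into one into E over R. *)
Lemma coind_injective k : relatively_injective (coind k).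
Proof.
move=> U V f g fgV kfg.
have [|eta etaE] := @injE _ _ (power_map k f) (coadj g) (pow_fin_gen k fgV).
  move=> z /ffunP fz; apply: big1 => i _.
  by have := fz i; rewrite !ffunE => /kfg ->.
exists (adj eta) => u; rewrite -[in RHS](coadjK g); apply: linmapP => x.
rewrite -[RHS]/(coadj g (spread u x)) -etaE -[LHS]/(eta (spread (f u) x)).
congr (eta _); apply/ffunP => i.
by rewrite !ffunE linearZ.
Qed.

Hypothesis fgE : fin_gen E.

Lemma dual_fin_gen (V : lmodType R) : fin_gen V -> fin_gen (linmap V E).
Proof.
move=> [m [s sV]].
have f_lin : linear ((fun h => [ffun i => h (s i)]) : linmap V E -> {ffun 'I_m -> E}).
  by move=> a g h; apply/ffunP => i; rewrite !ffunE.
have fi (h : linmap V E) : Lin f_lin h = 0 -> h = 0.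
  move=> h0; apply: linmapP => u; have [c ->] := sV u.
  rewrite raddf_sum big1 // => i _; rewrite /= linearZ /=.
  by have := congr1 (fun g : {ffun 'I_m -> E} => g i) h0; rewrite !ffunE => ->; rewrite scaler0.
have sI := submod_image (Lin f_lin) (submodT (linmap V E)).
have [|e eE] := @factor_inj _ _ _ _ (Lin f_lin) (sub_incl sI) fi.
  by move=> x; have [h _ hE] := sub_inclP x; exists h.
apply: (@fin_gen_onto _ _ _ e).
  move=> h; have [x xE] : exists x, sub_incl sI x = Lin f_lin h.
    by apply: sub_incl_onto; exists h.
  by exists x; apply: (linear_inj fi); rewrite eE.
exact: (fg_submod_fin_gen sI (noethR (fin_gen_ffun m fgE) sI)).
Qed.

Lemma coind_fin_gen k : fin_gen (coind k).
Proof.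
apply: fin_gen_of_rst; have [m [s sV]] := dual_fin_gen (fin_gen_ffun k fgL).
exists m, s => v; have [c cE] := sV v; exists c; rewrite cE.
apply: eq_bigr => i _; apply: linmapP => x.
by rewrite -[LHS]/(c i *: s i x) coind_scalar.
Qed.

Definition coind_fg k : fgmod L^c := Fgmod (coind_fin_gen k).

(** Generators of the R-dual of Y add up to one functional on Y^k. An element killed by its adjoint
    is killed by all generators, hence by every functional on Y. *)
Lemma coind_embedding (Y : fgmod L^c) : exists k (j : {linear Y -> coind_fg k}),
  forall y, j y = 0 -> y = 0.
Proof.
have [k [s sE]] := dual_fin_gen (rst_fin_gen fgL (fgmP Y)).
have eta_lin : linear (fun z : pow k Y => \sum_i s i (z i)).
  move=> r z z'; rewrite scaler_sumr -big_split; apply: eq_bigr => i _ /=.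
  by rewrite !ffunE linearP.
exists k, (adj (Lin eta_lin)) => y y0; apply: contrapT => ny.
have [h hy] := @cogE _ _ (rst_fin_gen fgL (fgmP Y)) ny; apply: hy.
have [c ->] := sE h; rewrite -[LHS]/(_ y).
have -> : (\sum_i c i *: s i : linmap (rst Y) E) y = \sum_i c i *: s i y.
  apply: (big_ind2 (fun (f : linmap (rst Y) E) e => f y = e)) => // f e g e' <- <- //.
apply: big1 => i _.
have := congr1 (fun w : coind k => w (unit_vec i)) y0; rewrite /= (bigD1 i) //= big1 => [|j ji].
  rewrite addr0 !ffunE eqxx (_ : (1 : L^c) *: y = y) => [->|]; first by rewrite scaler0.
  exact: scale1r.
by rewrite !ffunE (negbTE ji) (_ : (0 : L^c) *: y = 0) ?raddf0 //; apply: scale0r.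
Qed.

Lemma coind_enough_injectives (Y : fgmod L^c) : exists (I : fgmod L^c) (j : {linear Y -> I}),
  relatively_injective I /\ forall y, j y = 0 -> y = 0.
Proof.
have [k [j ji]] := coind_embedding Y; exists (coind_fg k), j; split=> //.
exact: coind_injective.
Qed.

Hypothesis refE : reflexive_for E.

(** Hom(Z, coind k) is the dual of Z^k by adjunction, so reflexivity represents its functionals by
    tuples. *)
Lemma coind_functional k (Z : fgmod L^c) (theta : {linear homR Z (coind k) -> E}) :
  exists z : pow k Z, forall h : homR Z (coind k), theta h = coadj h z.
Proof.
have adj_lin : linear ((@adj k Z) : linmap (pow k Z) E -> homR Z (coind k)).
  move=> r f g; apply: linmapP => z; apply: linmapP => x.
  rewrite homR_eval -[RHS]/((r *: (adj f z : rst (coind k)) : coind k) x + adj g z x).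
  by rewrite coind_scalar.
have [z zE] := @refE _ (linmap_comp theta (Lin adj_lin)) (pow_fin_gen k (fgmP Z)).
by exists z => h; rewrite -zE /= coadjK.
Qed.

Lemma coind_separates k (Z : fgmod L^c) (z : pow k Z) :
  (forall h : linmap Z (coind k), coadj h z = 0) -> z = 0.
Proof.
move=> z0; apply: contrapT => nz; have [eta] := @cogE _ _ (pow_fin_gen k (fgmP Z)) nz.
by apply; rewrite -(adjK eta).
Qed.

End Coinduction.

(** * The duals of the covariant representable functors *)

Section NatOf.
Variables (C : addcat) (F G : abfun C) (a : forall X, F X -> G X).
Hypothesis aD : forall X x y, @a X (x + y) = @a X x + @a X y.
Hypothesis a_nat : forall (X Y : C) (f : hom X Y) x, @a X (fun_map F f x) = fun_map G f (@a Y x).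

Fact nat_of_nmod_morphism X : nmod_morphism (@a X).
Proof. by split=> [|x y]; [apply: (addrI (@a X 0)); rewrite -aD !addr0 | apply: aD]. Qed.

Definition nat_of : nattrans F G :=
  @Nattrans C F G (fun X => HB.pack (@a X)
    (GRing.isNmodMorphism.Build _ _ (@a X) (nat_of_nmod_morphism X))) a_nat.
End NatOf.

Section Dual.
Variables (R : comPzRingType) (L : algType R) (E : fgmod R) (M : addsub L^c).
Local Notation C := (sub_addcat M).
Local Notation pow k V := {ffun 'I_k -> rst V}.

Section DualHom.
Variable K : fgmod L^c.

Definition dualhom_map (X Y : C) (f : hom X Y)
    (theta : linmap (homR K (sval Y)) E) : linmap (homR K (sval X)) E :=
  linmap_comp theta (homR_post K f).

Fact dualhom_map_nmod_morphism (X Y : C) (f : hom X Y) : nmod_morphism (dualhom_map f).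
Proof. by split=> [|g h]; apply: linmapP. Qed.

HB.instance Definition _ (X Y : C) (f : hom X Y) :=
  GRing.isNmodMorphism.Build _ _ (dualhom_map f) (dualhom_map_nmod_morphism f).

Definition dualhom : abfun C.
Proof.
refine (@Abfun C (fun X => linmap (homR K (sval X)) E) (fun X Y f => dualhom_map f) _ _ _).
- by move=> X theta; apply: linmapP => h; rewrite /=; congr (theta _); apply: linmapP.
- by move=> X Y Z g f theta; apply: linmapP => h; rewrite /=; congr (theta _); apply: linmapP.
- move=> X Y f g theta; apply: linmapP => h; rewrite /= -raddfD; congr (theta _).
  exact: linmapP.
Defined.

End DualHom.

Lemma dualhomE K (X Y : C) (f : hom X Y) (theta : dualhom K Y) (h : homR K (sval X)) :
  (fun_map (dualhom K) f theta : linmap _ _) h =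
  (theta : linmap (homR K (sval Y)) E) (linmap_comp f h : homR K (sval Y)).
Proof. by []. Qed.

Fact scal_hom_linear (V : lmodType L^c) (r : R) : linear (fun v : V => scalar_elt L r *: v).
Proof. by move=> a x y; rewrite scalerDr !scalerA scalar_elt_central. Qed.
Definition scal_hom (V : lmodType L^c) (r : R) : linmap V V := Lin (@scal_hom_linear V r).

Section FunctorModule.
Variables (F : abfun C) (X : C).

(** C is R-linear through its scalar endomorphisms, so an additive functor to abelian groups
    automatically takes values in R-modules. *)
Definition fval : Type := F X.
HB.instance Definition _ := GRing.Zmodule.on fval.

Let scale (r : R) (s : fval) : fval := fun_map F (scal_hom (sval X) r : hom X X) s.

Fact fval_scaleA a b v : scale a (scale b v) = scale (a * b) v.
Proof.
rewrite /scale -fun_mapM; congr (fun_map F _ v); apply: linmapP => x /=.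
by rewrite scalerA scalar_eltM -scalar_elt_central.
Qed.
Fact fval_scale1 : left_id 1 scale.
Proof.
move=> v; rewrite -[RHS]fun_map1; congr (fun_map F _ v); apply: linmapP => x /=.
by rewrite /scalar_elt scale1r -[X in X *: _]/(1 : L^c) scale1r.
Qed.
Fact fval_scaleDr : right_distributive scale +%R.
Proof. by move=> a x y; rewrite /scale raddfD. Qed.
Fact fval_scaleDl v : {morph scale^~ v : a b / a + b}.
Proof.
move=> a b; rewrite /scale -fun_mapD; congr (fun_map F _ v); apply: linmapP => x.
by rewrite /= /scalar_elt scalerDl; apply: (scalerDl (x : sval X)).
Qed.

HB.instance Definition _ := GRing.Zmodule_isLmodule.Build R fval
  fval_scaleA fval_scale1 fval_scaleDr fval_scaleDl.

Lemma fvalZ r (s : fval) : r *: s = fun_map F (scal_hom (sval X) r : hom X X) s :> F X.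
Proof. by []. Qed.

End FunctorModule.

Fact nat_linear (F G : abfun C) (a : nattrans F G) X : linear (a X : fval F X -> fval G X).
Proof. by move=> r x y; rewrite raddfD; congr (_ + _); rewrite !fvalZ nt_natural. Qed.
Definition nat_lin (F G : abfun C) (a : nattrans F G) X : {linear fval F X -> fval G X} :=
  Lin (@nat_linear F G a X).

Lemma homR_scale (U V : lmodType L^c) r (h : homR U V) :
  r *: h = linmap_comp (scal_hom V r) h :> linmap U V.
Proof. exact: linmapP. Qed.

Lemma homR_scale_r (U V : lmodType L^c) r (h : homR U V) :
  r *: h = linmap_comp h (scal_hom U r) :> linmap U V.
Proof. by apply: linmapP => x; rewrite /= linearZ. Qed.

Fact felt_linear (F : abfun C) (X Z : C) (s : F X) :
  linear ((fun h => fun_map F (h : hom Z X) s) : homR (sval Z) (sval X) -> fval F Z).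
Proof.
move=> r g h; rewrite fun_mapD fvalZ -fun_mapM; congr (fun_map F _ s + _).
exact: homR_scale_r.
Qed.

Hypothesis injE : relatively_injective E.
Hypothesis cogE : cogenerator E.
Hypothesis refE : reflexive_for E.
Hypothesis fgL : fin_gen (L : lmodType R).
Hypothesis noethR : forall V : lmodType R, fin_gen V -> noetherian V.

Lemma fval_fin_gen (F : modcat C) (X : C) : fin_gen (fval F X).
Proof.
have [_ [X0 [_ [q [_ qs]]]]] := fpfP F.
have q_lin : linear (q X : homR (sval X) (sval X0) -> fval F X).
  move=> r g h; rewrite raddfD; congr (_ + _); rewrite fvalZ -nt_natural.
  by congr (q X _); exact: homR_scale_r.
apply: (@fin_gen_onto _ _ _ (Lin q_lin)); first by move=> y; have [x <-] := qs X y; exists x.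
by apply: homR_fin_gen.
Qed.

Lemma mono_nt_injective (F G : modcat C) (m : mor F G) : mono m -> nt_injective m.
Proof.
move=> mm X x y e.
have := mm (repf X) (yoneda x) (yoneda y).
have H : eqm (compm m (yoneda x : mor (repf X) F)) (compm m (yoneda y : mor (repf X) F)).
  by move=> Z h; rewrite /= /yoneda_map !nt_natural e.
by move=> /(_ H X (aid X)); rewrite /= /yoneda_map !fun_map1.
Qed.

Section IntoDual.
Variables (F : abfun C) (X : C) (theta : {linear fval F X -> E}).

Fact into_dual_linear Z (s : F Z) :
  linear ((fun k => theta (fun_map F (k : hom X Z) s)) : homR (sval X) (sval Z) -> E).
Proof. by move=> r g h; rewrite -linearP; congr (theta _); exact: (felt_linear s). Qed.

(** A dual Yoneda lemma: maps from F to D Hom(X, -) correspond to functionals on F X, with [dual_id]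
    in the other direction. *)
Definition into_dual : nattrans F (dualhom (sval X)).
Proof.
refine (@nat_of C F (dualhom (sval X)) (fun Z s => Lin (@into_dual_linear Z s)) _ _).
- by move=> Z x y; apply: linmapP => h; rewrite /= raddfD /= raddfD.
- by move=> Z W f x; apply: linmapP => h; rewrite /= -fun_mapM.
Defined.

End IntoDual.

Fact dual_id_linear (F : abfun C) (X : C) (f : nattrans F (dualhom (sval X))) :
  linear (fun s : fval F X => (f X s : linmap (homR (sval X) (sval X)) E) (linmap_id (sval X))).
Proof.
move=> r x y; rewrite raddfD -[LHS]/(_ + _); congr (_ + _).
rewrite fvalZ nt_natural dualhomE -linearZ; congr ((f X x : linmap _ _) _).
exact: linmapP.
Qed.
Definition dual_id (F : abfun C) (X : C) (f : nattrans F (dualhom (sval X))) :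
  {linear fval F X -> E} := Lin (dual_id_linear f).

Lemma dual_idE (F : abfun C) (X : C) (f : nattrans F (dualhom (sval X))) Z (s : F Z)
    (k : homR (sval X) (sval Z)) :
  dual_id f (fun_map F (k : hom X Z) s) = (f Z s : linmap _ _) k.
Proof. by rewrite /= nt_natural dualhomE; congr ((f Z s : linmap _ _) _); apply: linmapP. Qed.

(** By the dual Yoneda lemma it remains to extend a functional from F X to G X, and G X is finitely
    generated over R because G is finitely presented. *)
Lemma dualhom_injective (X : C) (fpX : finitely_presented (dualhom (sval X))) :
  injective_obj (Fpfun fpX : modcat C).
Proof.
move=> F G m /mono_nt_injective mi f.
have [|theta thE] := @injE _ _ (nat_lin m X) (dual_id f) (fval_fin_gen G X).
  by move=> u mu; have -> : u = 0 by [apply: mi; rewrite raddf0]; rewrite raddf0.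
exists (into_dual theta : mor G (Fpfun fpX)) => Z s; apply: linmapP => k.
by rewrite /= -nt_natural; exact: etrans (thE _) (dual_idE f s k).
Qed.

Section Presentation.
Variables (K : fgmod L^c) (a b : nat) (s : 'I_a -> K) (t : 'I_b -> {ffun 'I_a -> (L^c)^o}).
Hypothesis s_gen : forall v, exists c, comb s c = v.
Hypothesis t_gen : forall c, comb s c = 0 -> exists d, comb t d = c.
Hypothesis t_ker : forall l, comb s (t l) = 0.

(** This is Hom(-, Z) applied to the map L^b -> L^a of a free presentation of K. Its kernel is
    Hom(K, Z), embedded in Z^a by [gen_eval]. *)
Definition rel_map (Z : lmodType L^c) (z : pow a Z) : pow b Z :=
  [ffun l => comb (z : 'I_a -> Z) (t l)].

Fact rel_map_linear Z : linear (@rel_map Z).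
Proof.
move=> r z z'; apply/ffunP => l; rewrite !ffunE rstZ scaler_sumr -big_split /=.
apply: eq_bigr => i _; rewrite !ffunE scalerDr rstZ; congr (_ + _).
by rewrite !scalerA scalar_elt_central.
Qed.

Definition gen_eval (Z : lmodType L^c) (k : homR K Z) : pow a Z := [ffun i => (k : linmap K Z) (s i)].

Fact gen_eval_linear Z : linear (@gen_eval Z).
Proof. by move=> r g h; apply/ffunP => i; rewrite !ffunE. Qed.

Lemma comb_gen_eval Z (k : linmap K Z) c : comb (gen_eval k : 'I_a -> Z) c = k (comb s c).
Proof.
by rewrite /= raddf_sum; apply: eq_bigr => i _; rewrite ffunE /= linearZ.
Qed.

Lemma gen_eval_eq0 Z (k : homR K Z) : gen_eval k = 0 -> k = 0.
Proof.
move=> k0; apply: linmapP => v; have [c <-] := s_gen v.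
rewrite -comb_gen_eval k0 /= big1 // => i _; rewrite ffunE.
exact: (scaler0 Z).
Qed.

Lemma rel_map_ker Z (z : pow a Z) : rel_map z = 0 -> exists k : homR K Z, gen_eval k = z.
Proof.
move=> rz; have [|k kE] := @factor_surj _ _ _ _ (comb s) (comb (z : 'I_a -> Z)) s_gen.
  move=> c /t_gen[d <-].
  apply: (free_ext (f := linmap_comp (comb (z : 'I_a -> Z)) (comb t)) (g := \0)) => i.
  rewrite -[LHS]/(comb (z : 'I_a -> Z) (comb t (free_gen i))) comb_gen.
  by have := congr1 (fun g : pow b Z => g i) rz; rewrite !ffunE.
exists k; apply/ffunP => i; rewrite ffunE -[X in k X](comb_gen s) kE.
exact: (@comb_gen _ _ Z (z : 'I_a -> Z) i).
Qed.

Lemma rel_gen_eval Z (k : homR K Z) : rel_map (gen_eval k) = 0.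
Proof. by apply/ffunP => l; rewrite !ffunE comb_gen_eval t_ker raddf0. Qed.

Lemma rel_mapM (Y Z : lmodType L^c) (f : linmap Y Z) (z : pow a Y) :
  power_map b f (rel_map z) = rel_map (power_map a f z).
Proof.
apply/ffunP => l; rewrite !ffunE raddf_sum; apply: eq_bigr => i _.
by rewrite ffunE /= linearZ.
Qed.

End Presentation.
End Dual.

Section EvalAt.
Variables (R : comPzRingType) (V E : lmodType R).
Fact eval_at_linear (v : V) : linear (fun theta : linmap V E => theta v).
Proof. by []. Qed.
Definition eval_at (v : V) : {linear linmap V E -> E} := Lin (eval_at_linear v).
End EvalAt.

(** * Finite presentation and embeddings by means of coinduced modules *)

Section FinitePresentation.
Variables (R : comPzRingType) (L : algType R) (E : fgmod R) (M : addsub L^c).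
Hypothesis injE : relatively_injective E.
Hypothesis cogE : cogenerator E.
Hypothesis refE : reflexive_for E.
Hypothesis fgL : fin_gen (L : lmodType R).
Hypothesis noethR : forall V : lmodType R, fin_gen V -> noetherian V.

Local Notation C := (sub_addcat M).
Local Notation pow k V := {ffun 'I_k -> rst V}.
Local Notation coindE k := (coind_fg fgL noethR (fgmP E) k).

Hypothesis memM_coind : forall k, M (coindE k).
Hypothesis left_approx : forall B : fgmod L^c,
  exists (X : fgmod L^c) (f : {linear B -> X}), left_approximation M f.

Let noethL (V : lmodType L^c) (fgV : fin_gen V) : noetherian V :=
  artin_algebra_noetherian fgL noethR fgV.

Local Notation coindC k := (exist _ (coindE k) (memM_coind k) : C).

Lemma coadj_inj k (Z : lmodType L^c) (g h : linmap Z (coind L E k)) :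
  coadj g = coadj h -> g = h.
Proof. by move=> e; rewrite -(coadjK g) e coadjK. Qed.

Lemma coadjD k (Z : lmodType L^c) (g h : linmap Z (coind L E k)) z :
  coadj (g + h) z = coadj g z + coadj h z.
Proof.
exact: (congr1 (fun t : linmap (pow k Z) E => t z)
  (raddfD (coadjR E k Z) (g : homR _ _) (h : homR _ _))).
Qed.

(** Dualizing 0 -> Hom(K, Z) -> Z^a -> Z^b gives D(Z^b) -> D(Z^a) -> D Hom(K, Z) -> 0, and by
    adjunction the first two terms are the functors represented by [coind b] and [coind a]. *)
Lemma dualhom_fp (K : fgmod L^c) : finitely_presented (dualhom E M K).
Proof.
have [a [s sK]] := fgmP K.
have s_gen v : exists c, comb s c = v.
  have [c ->] := sK v; exists [ffun i => c i].
  by apply: eq_bigr => i _; rewrite ffunE.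
have [ts tsE] := noethL (fin_gen_ffun a (fin_gen_regular L^c)) (submod_ker (comb s)).
pose b := size ts; pose t (l : 'I_b) := ts`_l.
have t_gen c : comb s c = 0 -> exists d, comb t d = c.
  move=> c0; have : span ts c by rewrite -tsE.
  move=> /span_comb[d ->]; exists [ffun i => d i].
  by apply: eq_bigr => i _; rewrite ffunE.
have t_ker l : comb s (t l) = 0.
  have : span ts (t l) by apply: mem_span; rewrite mem_nth.
  by rewrite -tsE.
pose ge Z : {linear homR K Z -> pow a Z} := Lin (@gen_eval_linear _ L K a s Z).
pose rm Z : {linear pow a Z -> pow b Z} := Lin (@rel_map_linear _ L a b t Z).
pose q Z (h : representable (coindC a) Z) : dualhom E M K Z :=
  linmap_comp (coadj (h : linmap _ _)) (ge (sval Z)).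
have qD Z x y : q Z (x + y) = q Z x + q Z y by apply: linmapP => k; apply: coadjD.
have q_nat (Z W : C) (f : hom Z W) x :
    q Z (fun_map (representable (coindC a)) f x) = fun_map (dualhom E M K) f (q W x).
  apply: linmapP => k; rewrite dualhomE.
  rewrite -[LHS]/(coadj (linmap_comp (x : linmap _ _) f) (gen_eval s k)) coadj_comp.
  by rewrite -[RHS]/(coadj _ _); congr (coadj _ _); apply/ffunP => i; rewrite !ffunE.
pose p Z (h : representable (coindC b) Z) : representable (coindC a) Z :=
  adj (linmap_comp (coadj (h : linmap _ _)) (rm (sval Z))).
have pE Z h z : coadj (p Z h : linmap _ _) z = coadj (h : linmap _ _) (rm _ z).
  by rewrite /p adjK.
have pD Z x y : p Z (x + y) = p Z x + p Z y.
  by apply: coadj_inj; apply: linmapP => z; rewrite coadjD !pE coadjD.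
have p_nat (Z W : C) (f : hom Z W) x :
    p Z (fun_map (representable (coindC b)) f x) = fun_map (representable (coindC a)) f (p W x).
  apply: coadj_inj; apply: linmapP => z; rewrite pE.
  rewrite -[LHS]/(coadj (linmap_comp (x : linmap _ _) f) (rm _ z)) coadj_comp.
  rewrite -[RHS]/(coadj (linmap_comp (p W x : linmap _ _) f) z) coadj_comp pE.
  by congr (coadj _ _); exact: rel_mapM.
exists (coindC b), (coindC a), (nat_of pD p_nat), (nat_of qD q_nat); split=> Z y.
  split=> [q0|[x <-]]; last first.
    apply: linmapP => k; rewrite -[LHS]/(coadj (p Z x : linmap _ _) (gen_eval s k)) pE.
    by rewrite -[rm _ _]/(rel_map t (gen_eval s k)) rel_gen_eval // raddf0.
  have [|eta etaE] := @injE _ _ (rm (sval Z)) (coadj (y : linmap _ _)) (pow_fin_gen fgL b (fgmP (sval Z))).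
    move=> z /(rel_map_ker s_gen t_gen)[k <-].
    exact: (congr1 (fun g : linmap _ _ => g k) q0).
  exists (adj eta : linmap _ _); apply: coadj_inj; apply: linmapP => z.
  by rewrite [LHS]pE adjK etaE.
have [|eta etaE] := @injE _ _ (ge (sval Z)) y (pow_fin_gen fgL a (fgmP (sval Z))).
  by move=> k /(gen_eval_eq0 s_gen) ->; rewrite raddf0.
exists (adj eta : linmap _ _); apply: linmapP => k.
by rewrite -[LHS]/(coadj (adj eta) (ge _ k)) adjK etaE.
Qed.

Definition dualhom_mod (K : fgmod L^c) : modcat C := Fpfun (dualhom_fp K).

(* Let X1 -> X0 be a map with X0 inside coind a and X1 the kernel of
   d : coind b -> coind c, and let f : coind b -> coind a extend it. The
   functionals on Hom(Z, X0) are given by the tuples z in Z^a, and z kills the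
   image of Hom(Z, X1) iff (z, y) is balanced for some y in Z^c. *)
Section KillingFunctionals.
Variables (a b c : nat) (f : linmap (coind L E b) (coind L E a))
  (d : linmap (coind L E b) (coind L E c)).

Definition balanced (Z : lmodType L^c) (z : pow a Z) (y : pow c Z) :=
  forall h : linmap Z (coind L E b), coadj (linmap_comp f h) z = coadj (linmap_comp d h) y.

Lemma balanced_map (Y Z : lmodType L^c) (g : linmap Y Z) z y :
  balanced z y -> balanced (power_map a g z) (power_map c g y).
Proof. by move=> zy h; rewrite -!coadj_comp; apply: (zy (linmap_comp h g)). Qed.

(** Over the free module [Phi] with its tautological tuples, the failure to be balanced is a
    functional on Hom(Phi, coind b), hence a tuple m in Phi^b. Dividing by the entries of m makes
    the pair universally balanced. *)
Lemma balanced_universal : exists (B : fgmod L^c) (z0 : pow a B) (y0 : pow c B),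
  balanced z0 y0 /\ forall (Z : fgmod L^c) (z : pow a Z) (y : pow c Z), balanced z y ->
    exists g : linmap B Z, power_map a g z0 = z /\ power_map c g y0 = y.
Proof.
pose Phi := Fgmod (fin_gen_prod (fin_gen_ffun a (fin_gen_regular L^c))
  (fin_gen_ffun c (fin_gen_regular L^c))).
pose ez : pow a Phi := [ffun i => (free_gen i, 0)].
pose ey : pow c Phi := [ffun i => (0, free_gen i)].
have [gap gapE] := sub_linear
  (linmap_comp (eval_at E ez) (linmap_comp (coadjR E a Phi) (homR_post Phi f)))
  (linmap_comp (eval_at E ey) (linmap_comp (coadjR E c Phi) (homR_post Phi d))).
have [m mE] := coind_functional fgL refE gap.
have bal Z (g : linmap Phi Z) :
    balanced (power_map a g ez) (power_map c g ey) <->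
    forall h : linmap Z (coind L E b), coadj h (power_map b g m) = 0.
  have gmE h : coadj h (power_map b g m) =
      coadj (linmap_comp f h) (power_map a g ez) - coadj (linmap_comp d h) (power_map c g ey).
    rewrite -[LHS]coadj_comp -mE gapE -[in RHS]coadj_comp.
    by rewrite -[in X in _ = _ - X]coadj_comp.
  split=> H h; first by rewrite gmE H subrr.
  by apply/eqP; rewrite -subr_eq0 -gmE H.
pose N := span [seq (m i : Phi) | i <- enum 'I_b].
have sN : submod N := span_submod _.
pose B := quot_fgmod (fgmP Phi) sN; pose pi : linmap Phi B := quot_proj sN.
have pim : power_map b pi m = 0.
  apply/ffunP => i; rewrite !ffunE; apply/quot_proj_eq0; apply: mem_span.
  by apply/mapP; exists i; rewrite ?mem_enum.
exists B, (power_map a pi ez), (power_map c pi ey); split.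
  by apply/bal => h; rewrite pim raddf0.
move=> Z z y zy.
pose g : linmap Phi Z := copair (comb (z : 'I_a -> Z)) (comb (y : 'I_c -> Z)).
have gz : power_map a g ez = z.
  apply/ffunP => i; rewrite !ffunE -[LHS]/(comb (z : 'I_a -> Z) (free_gen i) + comb (y : 'I_c -> Z) 0).
  by rewrite raddf0 addr0 comb_gen.
have gy : power_map c g ey = y.
  apply/ffunP => i; rewrite !ffunE -[LHS]/(comb (z : 'I_a -> Z) 0 + comb (y : 'I_c -> Z) (free_gen i)).
  by rewrite raddf0 add0r comb_gen.
have gm : power_map b g m = 0.
  by apply: (coind_separates cogE fgL); apply/bal; rewrite gz gy.
have [||k kE] := @factor_surj _ _ _ _ pi g; first exact: quot_proj_onto.
  move=> u /quot_proj_eq0 Nu; apply: (span_min (submod_ker g) _ Nu) => _ /mapP[i _ ->].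
  by have := congr1 (fun t : pow b Z => t i) gm; rewrite !ffunE.
exists k; rewrite -gz -gy.
by split; apply/ffunP => i; rewrite !ffunE kE.
Qed.

End KillingFunctionals.

(** Functionals on F Z are given by balanced pairs over Z, hence by maps from the universal module B
    to Z, and these factor through a left approximation X of B. So a single functional [th0] on F X
    yields all functionals on all F Z, and these separate elements because E is a cogenerator. *)
Lemma fp_embeds_dualhom (F : modcat C) :
  exists (X : C) (j : nattrans F (dualhom E M (sval X))), nt_injective j.
Proof.
have [X1 [X0 [p [q [pq qs]]]]] := fpfP F.
pose f : linmap (sval X1) (sval X0) := p X1 (aid X1).
have pE Z (h : hom Z X1) : p Z h = linmap_comp f h by rewrite rep_elt.
have [a [i0 i0i]] := coind_embedding cogE fgL noethR (fgmP E) (sval X0).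
have [b [i1 i1i]] := coind_embedding cogE fgL noethR (fgmP E) (sval X1).
have [Q [c1 ic1]] := cokernel_ses i1i.
have [c [i2 i2i]] := coind_embedding cogE fgL noethR (fgmP E) Q.
pose d : linmap (coind L E b) (coind L E c) := linmap_comp i2 c1.
have [|f' f'E] := coind_injective injE fgL (f := i1) (g := linmap_comp i0 f) (fgmP (coindE b)).
  by move=> u /i1i ->; rewrite raddf0.
have q_lin (Z : C) : linear (q Z : homR (sval Z) (sval X0) -> fval F Z).
  move=> r g h; rewrite raddfD; congr (_ + _); rewrite fvalZ -nt_natural.
  by congr (q Z _); exact: homR_scale_r.
pose ev (Z : C) (z : pow a (sval Z)) : {linear homR (sval Z) (sval X0) -> E} :=
  linmap_comp (eval_at E z) (linmap_comp (coadjR E a (sval Z)) (homR_post (sval Z) i0)).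
have evE (Z : C) z h : ev Z z h = coadj (linmap_comp i0 h) z by [].
have kills (Z : C) z y : balanced f' d z y -> forall h, q Z h = 0 -> ev Z z h = 0.
  move=> zy h /pq[h' <-]; rewrite pE evE.
  have -> : linmap_comp i0 (linmap_comp f h') = linmap_comp f' (linmap_comp i1 h').
    by apply: linmapP => x; rewrite /= f'E.
  rewrite zy (_ : linmap_comp d (linmap_comp i1 h') = 0).
    exact: (congr1 (fun t : linmap _ _ => t y) (raddf0 (coadjR E c (sval Z)))).
  by apply: linmapP => x; rewrite /= (ses_comp0 ic1) raddf0.
have represented (Z : C) (theta : {linear fval F Z -> E}) : exists z y, balanced f' d z y /\
    forall h, theta (q Z h) = ev Z z h.
  (* The functional on Hom(Z, X0) extends along i0 to Hom(Z, coind a), where it is given by a tuple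
     z. *)
  have [|t0 t0E] := @injE _ _ (homR_post (sval Z) i0) (linmap_comp theta (Lin (q_lin Z)))
      (homR_fin_gen fgL noethR (sval Z) (coindE a)).
    move=> h ih; rewrite (_ : h = 0) ?raddf0 //; apply: linmapP => x; apply: i0i.
    exact: (congr1 (fun g : linmap _ _ => g x) ih).
  have [z zE] := coind_functional fgL refE t0.
  have thE h : theta (q Z h) = ev Z z h by rewrite evE -zE -[LHS]t0E.
  (* The functional that z induces through f' on Hom(Z, coind b) vanishes on Hom(Z, X1), the kernel
     of composition with d. So it factors through d, which gives the tuple y. *)
  have [|t1 t1E] := @injE _ _ (homR_post (sval Z) d)
      (linmap_comp (eval_at E z) (linmap_comp (coadjR E a (sval Z)) (homR_post (sval Z) f')))
      (homR_fin_gen fgL noethR (sval Z) (coindE c)).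
    move=> h dh.
    have [|h' h'E] := ses_factor_inj ic1 (f := h : linmap _ _).
      by move=> u; apply: i2i; exact: (congr1 (fun g : linmap _ _ => g u) dh).
    rewrite -[LHS]/(coadj (linmap_comp f' h) z).
    have -> : linmap_comp f' h = linmap_comp i0 (linmap_comp f h').
      by apply: linmapP => x; rewrite /= -h'E f'E.
    rewrite -[LHS]/(ev Z z (linmap_comp f h')) -thE -(pE Z h').
    by rewrite (iffRL (pq Z _)) ?raddf0 //; exists h'.
  have [y yE] := coind_functional fgL refE t1.
  by exists z, y; split=> // h; rewrite -yE t1E.
have [B [z0 [y0 [zy0 univ]]]] := balanced_universal f' d.
have [X [k [MX ap]]] := left_approx B.
pose XC : C := exist _ X MX.
have [th0 th0E] : exists th0 : {linear fval F XC -> E}, forall h,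
    th0 (q XC h) = ev XC (power_map a k z0) h.
  apply: (@factor_surj _ _ _ _ (Lin (q_lin XC)) (ev XC (power_map a k z0))).
    by move=> y; have [x <-] := qs XC y; exists x.
  by apply: kills; apply: balanced_map zy0.
exists XC, (into_dual th0) => Z x y exy; apply/eqP; rewrite -subr_eq0; apply/eqP.
have : into_dual th0 Z (x - y) = 0 by rewrite raddfB exy subrr.
move: (x - y) => {exy}{}x jx; apply: contrapT => x0.
have [th thx] := @cogE _ _ (fval_fin_gen fgL noethR F Z) x0; apply: thx.
have [z [y' [zy thE]]] := represented Z th.
have [g [gz _]] := univ (sval Z) z y' zy.
have [u uE] := ap (sval Z) (svalP Z) g.
have e : th0 (fun_map F (u : hom XC Z) x) = 0.
  exact: (congr1 (fun t : linmap _ _ => t (u : homR X (sval Z))) jx).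
have [h hE] := qs Z x; move: e; rewrite -hE -nt_natural th0E thE !evE => e.
rewrite -gz -[RHS]e -[RHS]/(coadj (linmap_comp (linmap_comp i0 h) u) _) [RHS]coadj_comp.
by congr (coadj _ _); apply/ffunP => i; rewrite !ffunE -uE.
Qed.

End FinitePresentation.

(** * Functors of injective dimension at most one *)

Section CostableCorrespondence.
Variables (R : comPzRingType) (L : algType R) (E : fgmod R) (M : addsub L^c) (n : nat).
Hypothesis injE : relatively_injective E.
Hypothesis cogE : cogenerator E.
Hypothesis refE : reflexive_for E.
Hypothesis fgL : fin_gen (L : lmodType R).
Hypothesis noethR : forall V : lmodType R, fin_gen V -> noetherian V.
Hypothesis n2 : (2 <= n)%N.
Hypothesis ctM : cluster_tilting M n.

Local Notation C := (sub_addcat M).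
Local Notation D := (dualhom E M).
Local Notation W := (ext_range M 0 (n - 2)).

Let noethL (V : lmodType L^c) (fgV : fin_gen V) : noetherian V :=
  artin_algebra_noetherian fgL noethR fgV.

Let injL (Y : fgmod L^c) : exists (I : fgmod L^c) (j : {linear Y -> I}),
  relatively_injective I /\ forall y, j y = 0 -> y = 0.
Proof. exact: coind_enough_injectives injE cogE fgL noethR (fgmP E) Y. Qed.

(** Injective modules have no higher Ext, so M contains them; this puts the representing objects of
    [dualhom_fp] into M. *)
Lemma memM_coind k : M (coind_fg fgL noethR (fgmP E) k).
Proof.
apply: (memM_into ctM) => X MX [|j] jn //.
have [P [d [e res]]] := resolution_exists noethL X.
exists P, d, e; split=> //; apply: (injective_cohomology res).
exact: (@coind_injective R L E injE fgL k).
Qed.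

Let left_approx (B : fgmod L^c) :
  exists (X : fgmod L^c) (f : {linear B -> X}), left_approximation M f.
Proof. by have [ff _ _ _ _] := ctM; case: (ff B). Qed.

Local Notation DM K := (dualhom_mod injE memM_coind K).

Lemma dualhom_mod_injective (X : C) : injective_obj (DM (sval X)).
Proof. exact: dualhom_injective. Qed.

Section Covariance.
Variables (K K' : fgmod L^c) (k : linmap K K').

Definition dual_pre : nattrans (D K) (D K').
Proof.
refine (@nat_of C (D K) (D K') (fun Z theta => linmap_comp theta (homR_pre (sval Z) k)) _ _).
- by move=> Z x y; apply: linmapP.
- by move=> Z Y f x; apply: linmapP => h; rewrite /=; congr ((x : linmap _ _) _); apply: linmapP.
Defined.

Lemma dual_preE Z (theta : D K Z) (h : homR K' (sval Z)) :
  (dual_pre Z theta : linmap _ _) h =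
  (theta : linmap (homR K (sval Z)) E) (linmap_comp h k : homR K (sval Z)).
Proof. by []. Qed.
End Covariance.

Lemma dual_separates (K V : fgmod L^c) (h h' : homR K V) :
  (forall theta : linmap (homR K V) E, theta h = theta h') -> h = h'.
Proof.
move=> th; apply/eqP; rewrite -subr_eq0; apply/eqP; apply: contrapT => ne.
have [theta] := @cogE _ _ (homR_fin_gen fgL noethR K V) ne; apply.
by rewrite raddfB /= th subrr.
Qed.

(** K' embeds into an object X of M, so a map into K' is determined by its composite in Hom(K, X),
    which functionals separate. *)
Lemma dual_faithful (K K' : fgmod L^c) (k k' : linmap K K') : W K' ->
  (forall Z (theta : D K Z) (h : linmap K' (sval Z)),
    (theta : linmap (homR K (sval Z)) E) (linmap_comp h k) =
    (theta : linmap (homR K (sval Z)) E) (linmap_comp h k')) -> k = k'.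
Proof.
move=> WK' H; have [X [Y [g [i ig]]]] := ext_range_kernel_exists noethL injL n2 ctM WK'.
have [ii _ _] := ig; apply: linmapP => x; apply: (linear_inj ii).
apply: (congr1 (fun f : linmap K (sval X) => f x) (x := linmap_comp i k) (y := linmap_comp i k')).
by apply: dual_separates => theta; apply: (H X theta i).
Qed.

(** R acts through scalar endomorphisms of Z, so R-linearity is an instance of naturality. *)
Lemma dual_linear (K K' : fgmod L^c) (phi : nattrans (D K) (D K')) (Z : C) r (theta : D K Z) :
  phi Z ((r *: (theta : linmap (homR K (sval Z)) E) : linmap _ _) : D K Z) =
  (r *: (phi Z theta : linmap (homR K' (sval Z)) E) : linmap _ _).
Proof.
have scalE K1 (t : D K1 Z) :
    (r *: (t : linmap (homR K1 (sval Z)) E) : linmap _ _) =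
    fun_map (D K1) (scal_hom (sval Z) r : hom Z Z) t.
  apply: linmapP => h; rewrite -[LHS]/(r *: (t : linmap (homR K1 (sval Z)) E) h) -linearZ.
  by congr ((t : linmap _ _) _); exact: homR_scale.
by rewrite !scalE nt_natural.
Qed.

(* Dualize pointwise by reflexivity, then use that Hom(K', -) is generated by a
   left approximation of K'. *)
Lemma dual_full (K K' : fgmod L^c) (phi : nattrans (D K) (D K')) : W K' ->
  exists k : linmap K K', forall Z (theta : D K Z) (h : homR K' (sval Z)),
    (phi Z theta : linmap _ _) h =
    (theta : linmap (homR K (sval Z)) E) (linmap_comp h k : homR K (sval Z)).
Proof.
move=> WK'; have [X [Y [g [i ig]]]] := ext_range_kernel_exists noethL injL n2 ctM WK'.
have [_ ap] := kernel_left_approx noethL injL n2 ctM ig.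
have psi_lin : linear (fun theta : linmap (homR K (sval X)) E =>
    (phi X theta : linmap (homR K' (sval X)) E) i).
  move=> r t t'; rewrite (raddfD (phi X)) dual_linear.
  by [].
(* Reflexivity of Hom(K, X) gives x : K -> X, which is to become i composed with the map k sought.
   Naturality describes [phi] on all composites w i, and w = g shows that x lands in the kernel of
   g. *)
have [x xE] := @refE _ (Lin psi_lin) (homR_fin_gen fgL noethR K (sval X)).
have pE Z (w : hom X Z) (theta : D K Z) : (phi Z theta : linmap (homR K' (sval Z)) E) (linmap_comp w i) =
    (theta : linmap (homR K (sval Z)) E) (linmap_comp w x).
  rewrite -[LHS](dualhomE w (phi Z theta) i) -nt_natural.
  exact: (xE (fun_map (D K) w theta)).
have gx : linmap_comp g x = 0.
  apply: dual_separates => theta; rewrite -[LHS](pE Y g theta) !raddf0.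
  rewrite (_ : linmap_comp g i = 0) ?raddf0 //.
  by apply: linmapP => y; exact: (ses_comp0 ig).
have [|k kE] := ses_factor_inj ig (f := x : linmap _ _).
  by move=> u; exact: (congr1 (fun f : linmap _ _ => f u) gx).
exists k => Z theta h; have [w wE] := ap (sval Z) (svalP Z) h.
have -> : h = linmap_comp w i by apply: linmapP => y; rewrite -wE.
rewrite (pE Z w theta); congr ((theta : linmap _ _) _); apply: linmapP => y.
by rewrite /= kE.
Qed.

Lemma memM_ext_range (X : C) : W (sval X).
Proof.
split=> [Y MY [] //|Y MY i ir].
by apply: (extMM ctM) => //; [exact: svalP | move: n2 ir; lia].
Qed.

Lemma nt_injective_mono (F G : modcat C) (m : mor F G) : nt_injective m -> mono m.
Proof. by move=> mi Z g h e X x; apply: mi; apply: e. Qed.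

Lemma injective_retract (I : modcat C) : injective_obj I ->
  exists (X : C) (j : nattrans I (D (sval X))) (r : nattrans (D (sval X)) I),
    forall Z x, r Z (j Z x) = x.
Proof.
move=> inj.
have [X [j ji]] := fp_embeds_dualhom injE cogE refE fgL noethR left_approx I.
have [r rE] := inj I (DM (sval X)) j (nt_injective_mono (m := j : mor I (DM (sval X))) ji) (nt_id I).
by exists X, j, r.
Qed.

(** I is cut out of some D Hom(X, -) by an idempotent; by fullness and faithfulness this comes from
    an idempotent of X, which splits in M. *)
Lemma injective_dualhom (I : modcat C) : injective_obj I ->
  exists (Y : C) (u : nattrans (D (sval Y)) I) (v : nattrans I (D (sval Y))),
    (forall Z x, u Z (v Z x) = x) /\ (forall Z x, v Z (u Z x) = x).
Proof.
move=> /injective_retract[X [j [r rj]]].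
have WX := memM_ext_range X.
have [k kE] := dual_full (nt_comp j r) WX.
have kk : linmap_comp k k = k.
  apply: (dual_faithful WX) => Z theta h.
  transitivity ((j Z (r Z theta) : linmap _ _) (linmap_comp h k)).
    rewrite [RHS](kE Z theta (linmap_comp h k)).
    by congr ((theta : linmap _ _) _); apply: linmapP.
  by rewrite -[LHS](kE Z (j Z (r Z theta)) h) -[RHS](kE Z theta h) /= rj.
have [Y [i [p [pi ip]]]] := @idempotent_complete_M _ noethL M n ctM X k kk.
exists Y, (nt_comp r (dual_pre i)), (nt_comp (dual_pre p) j); split=> Z x.
  rewrite -[RHS]rj -[in RHS](rj Z x); congr (r Z _); apply: linmapP => h.
  rewrite [RHS](kE Z (j Z x) h) -[LHS]/((j Z x : linmap _ _) (linmap_comp (linmap_comp h i) p)).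
  congr ((j Z x : linmap _ _) _); rewrite -ip; exact: linmapP.
apply: linmapP => h.
rewrite -[LHS]/((nt_comp j r Z (dual_pre i Z x) : linmap _ _) (linmap_comp h p)) kE dual_preE.
congr ((x : linmap _ _) _); apply: linmapP => y /=.
have ipE z : k z = (i : linmap _ _) ((p : linmap _ _) z).
  by rewrite -[k]ip.
have piE z : (p : linmap _ _) ((i : linmap _ _) z) = z.
  exact: (congr1 (fun f : linmap _ _ => f z) pi).
by rewrite ipE !piE.
Qed.

(** * The injective resolution attached to a kernel *)

Section KernelDual.
Variables (X Y : C) (g : hom X Y) (K : fgmod L^c) (i : {linear K -> sval X}).
Hypothesis ig : short_exact i (g : linmap _ _).

(** i is a left approximation, so Hom(X, Z) -> Hom(K, Z) is onto for Z in M, and its dual is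
    injective. *)
Lemma kernel_dual_injective : nt_injective (dual_pre i).
Proof.
move=> Z t t' e; apply: linmapP => h.
have [_ ap] := kernel_left_approx noethL injL n2 ctM ig.
have [w wE] := ap (sval Z) (svalP Z) h.
have -> : h = linmap_comp w i by apply: linmapP => y; rewrite -wE.
exact: (congr1 (fun f : linmap (homR (sval X) (sval Z)) E => f (w : homR _ _)) e).
Qed.

Lemma kernel_dual_exact : nt_exact (dual_pre i) (dual_pre (g : linmap _ _)).
Proof.
have [_ ap] := kernel_left_approx noethL injL n2 ctM ig.
move=> Z t; split=> [t0|[s <-]]; last first.
  apply: linmapP => w; rewrite !dual_preE (_ : linmap_comp _ i = 0) ?raddf0 //.
  by apply: linmapP => y; rewrite /= (ses_comp0 ig) raddf0.
have [h|h h0|s sE] := @factor_surj _ _ _ _ (homR_pre (sval Z) i) (t : linmap (homR (sval X) (sval Z)) E).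
- have [w wE] := ap (sval Z) (svalP Z) h; exists w.
  by apply: linmapP => y; rewrite -wE.
- have [|w wE] := ses_factor_surj ig (f := h : linmap _ _).
    by move=> a; exact: (congr1 (fun f : linmap _ _ => f a) h0).
  have -> : h = linmap_comp w g by apply: linmapP => y; rewrite -wE.
  exact: (congr1 (fun f : linmap (homR (sval Y) (sval Z)) E => f (w : homR _ _)) t0).
by exists s; apply: linmapP => h; rewrite -[LHS]/(_ h) dual_preE; exact: sE.
Qed.

Lemma kernel_dual_surjective : nt_surjective (dual_pre (g : linmap _ _)).
Proof.
move=> Z t; have [_ _ gs] := ig.
have [|s sE] := @injE _ _ (homR_pre (sval Z) (g : linmap _ _)) (t : linmap _ _)
    (homR_fin_gen fgL noethR (sval X) (sval Z)).
  move=> h h0; rewrite (_ : h = 0) ?raddf0 //; apply: linmapP => y.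
  by have [x <-] := gs y; exact: (congr1 (fun f : linmap _ _ => f x) h0).
by exists s; apply: linmapP => h; exact: sE.
Qed.

End KernelDual.

Record dual_pair := DualPair {
  dp_obj : stable_modules M W;
  dp_fun : costableI1 C;
  dp_map : nattrans (sval dp_fun) (D (sval dp_obj));
  dp_inj : nt_injective dp_map;
  dp_surj : nt_surjective dp_map
}.

Arguments dp_map : clear implicits.
Arguments dp_inj : clear implicits.
Arguments dp_surj : clear implicits.

Lemma dp_inverse t : exists b : nattrans (D (sval (dp_obj t))) (sval (dp_fun t)),
  (forall Z x, dp_map t Z (b Z x) = x) /\ (forall Z x, b Z (dp_map t Z x) = x).
Proof.
have [X x|b bE] := nt_factor_inj (a := nt_id _) (dp_inj t).
  exact: dp_surj.
by exists b; split=> [|Z x]; [exact: bE | apply: (dp_inj t); exact: bE].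
Qed.

Definition dual_related (s t : dual_pair) (k : mor (dp_obj s) (dp_obj t))
    (phi : @mor (costableI1 C) (dp_fun s) (dp_fun t)) :=
  forall Z x, dp_map t Z (phi Z x) = dual_pre (k : linmap _ _) Z (dp_map s Z x).

Lemma dual_related_eq s t (k k' : mor (dp_obj s) (dp_obj t)) phi phi' :
  dual_related k phi -> dual_related k' phi' -> (eqm k k' <-> eqm phi phi').
Proof.
move=> H H'; have [b [eb be]] := dp_inverse s; have [b' [eb' be']] := dp_inverse t.
split=> [[X [u [v [MX uv]]]]|[I [beta [gamma [injI e]]]]].
  exists (DM X), (nt_comp (dual_pre u) (dp_map s)), (nt_comp b' (dual_pre v)); split.
    have injX := @dualhom_mod_injective (exist _ X MX); exact: injX.
  move=> Z x; apply: (dp_inj t); rewrite raddfB H H' /= eb'; apply: linmapP => h.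
  rewrite -[LHS]/((dp_map s Z x : linmap _ _) (linmap_comp h k) -
    (dp_map s Z x : linmap _ _) (linmap_comp h k')) -raddfB.
  congr ((dp_map s Z x : linmap _ _) _); apply: linmapP => y.
  by rewrite -[LHS]/(h (k y) - h (k' y)) -raddfB uv.
(* As I is a retract of some D Hom(X, -), fullness turns the two halves of the factorization through
   I into maps u and v of modules through X. *)
have [X [j [r rj]]] := injective_retract injI.
have [u uE] := dual_full (nt_comp j (nt_comp beta b)) (memM_ext_range X).
have [v vE] := dual_full (nt_comp (dp_map t) (nt_comp gamma r)) (svalP (dp_obj t)).
exists (sval X), u, v; split; first exact: svalP.
have [d dE] := sub_linear (k : linmap _ _) (k' : linmap _ _).
suff dvu : d = linmap_comp v u by move=> y; rewrite -dE dvu.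
apply: (dual_faithful (svalP (dp_obj t))) => Z theta h.
have -> : (theta : linmap _ _) (linmap_comp h (linmap_comp v u)) =
    (dp_map t Z (gamma Z (beta Z (b Z theta))) : linmap _ _) h.
  rewrite -[in RHS](rj Z (beta Z _)) -[RHS]/(_ h) [RHS](vE Z _ h) [RHS](uE Z theta _).
  by congr ((theta : linmap _ _) _); apply: linmapP.
rewrite -e raddfB H H' eb -[RHS]/((theta : linmap _ _) (linmap_comp h k) -
    (theta : linmap _ _) (linmap_comp h k')) -raddfB.
congr ((theta : linmap _ _) _); apply: linmapP => y.
by rewrite -[RHS]/(h (k y) - h (k' y)) -raddfB /= dE.
Qed.

Lemma costable_correspondence : correspondence (stable_modules M W) (costableI1 C).
Proof.
exists dual_pair, dp_obj, dp_fun, dual_related; split; first split.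
- move=> [K WK]; have [X [Y [g [i ig]]]] := ext_range_kernel_exists noethL injL n2 ctM WK.
  have idK : id_le1 (DM K : modcat C).
    exists (DM (sval X)), (DM (sval Y)), (dual_pre i), (dual_pre (g : linmap _ _)).
    split; try exact: dualhom_mod_injective.
    - exact: (kernel_dual_injective ig).
    - exact: (kernel_dual_exact ig).
    - exact: (kernel_dual_surjective ig).
  exists (@DualPair (exist _ K WK) (exist _ (DM K : modcat C) idK) (nt_id _)
    (fun Z x y e => e) (fun Z y => ex_intro _ y erefl)).
  by [].
- move=> [F idF]; have [I0 [I1 [i [p [inj0 inj1 ii ip ps]]]]] := idF.
  have [X [u0 [v0 [uv0 vu0]]]] := injective_dualhom inj0.
  have [Y [u1 [v1 [uv1 vu1]]]] := injective_dualhom inj1.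
  have [g gE] := dual_full (nt_comp v1 (nt_comp p u0)) (memM_ext_range Y).
  (* If w g = 0, then every functional vanishes on w: p is onto, so the functional comes from D
     Hom(X, -), where it is evaluated at w g. Hence g is an epimorphism of C and is onto. *)
  have gs : forall y, exists x, g x = y.
    apply: (epi_onto ctM (f := g : hom X Y)) => Z w wg.
    apply: dual_separates => theta; rewrite raddf0.
    have [s sE] := ps Z (u1 Z theta).
    have := gE Z (v0 Z s) w; rewrite /= uv0 sE vu1 => ->.
    by rewrite -[linmap_comp w g]/(acomp w (g : hom X Y)) wg raddf0.
  have [K [a ag]] := kernel_ses noethL gs.
  have jE Z x : p Z x = u1 Z (dual_pre g Z (v0 Z x)).
    rewrite -[LHS]uv1 -[in LHS](uv0 Z x); congr (u1 Z _); apply: linmapP => h.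
    exact: gE.
  have ke Z t : dual_pre g Z t = 0 <-> exists x, v0 Z (i Z x) = t.
    split=> [t0|[x <-]].
      have [|x xE] := (ip Z (u0 Z t)).1; first by rewrite jE vu0 t0 raddf0.
      by exists x; rewrite xE vu0.
    rewrite -(vu1 Z (dual_pre g Z _)) -jE (iffRL (ip _ _)) ?raddf0 //.
    by exists x.
  (* F and D Hom(K, -) are kernels of the same map of injectives, up to the isomorphisms above, and
     [ev] identifies them. *)
  have [Z x|ev evE] := nt_factor_inj (a := nt_comp v0 i) (kernel_dual_injective ag).
    by apply/(kernel_dual_exact ag); apply/ke; exists x.
  have evi : nt_injective ev.
    move=> Z x y exy; apply: ii; rewrite -[LHS]uv0 -[RHS]uv0; congr (u0 Z _).
    by have := evE Z x; rewrite exy evE.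
  have evs : nt_surjective ev.
    move=> Z t; have [|x xE] := (ke Z (dual_pre a Z t)).1.
      by apply/(kernel_dual_exact ag); exists t.
    by exists x; apply: (kernel_dual_injective ag); rewrite evE.
  have WK := kernel_ext_range noethL injL n2 ctM (g := g : hom X Y) ag.
  by exists (@DualPair (exist _ K WK) (exist _ F idF) ev evi evs).
- split=> s t.
    move=> k; have [b [eb be]] := dp_inverse t.
    by exists (nt_comp b (nt_comp (dual_pre (k : linmap _ _)) (dp_map s))) => Z x; rewrite /= eb.
  move=> phi; have [b [eb be]] := dp_inverse s.
  have [k kE] := dual_full (nt_comp (dp_map t) (nt_comp phi b)) (svalP (dp_obj t)).
  exists k => Z x; apply: linmapP => h.
  by have := kE Z (dp_map s Z x) h; rewrite /= be.
- by move=> t Z x; apply: linmapP => h; rewrite dual_preE; congr ((dp_map t Z x : linmap _ _) _); apply: linmapP.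
- move=> s t u k phi k' phi' H' H Z x; rewrite -[LHS]/(dp_map u Z (phi' Z (phi Z x))) H' H.
  by apply: linmapP => h; rewrite !dual_preE; congr ((dp_map s Z x : linmap _ _) _); apply: linmapP.
by move=> s t k phi k' phi'; apply: dual_related_eq.
Qed.

End CostableCorrespondence.

Theorem proposition7p10 (R : comPzRingType) (L : algType R) (n : nat)
    (M : addsub L^c) :
  artin_algebra L -> (2 <= n)%N -> cluster_tilting M n ->
  equivalent (stableP1 (sub_addcat M))
             (opcat (stableP1 (opaddcat (sub_addcat M)))) /\
  equivalent (stableP1 (sub_addcat M)) (costableI1 (sub_addcat M)).
Proof.
move=> [artR fgL] n2 ctM; have [E [injE cogE refE]] := matlis_module artR.
have noethR (V : lmodType R) : fin_gen V -> noetherian V.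
  by apply: noetherian_fin_gen => I; apply: artinian_noetherian_ideal.
have noethL := artin_algebra_noetherian fgL noethR.
have injL := coind_enough_injectives injE cogE fgL noethR (fgmP E).
split; first exact: (stableP1_op noethL injL n2 ctM).
(* Both equivalences pass through the stable category of the kernels K; they part only in the
   functors attached to K. *)
apply: (equivalent_trans (stableP1_stable_modules noethL injL n2 ctM)).
apply: correspondence_equivalent.
exact: (costable_correspondence injE cogE refE fgL noethR n2 ctM).
Qed.
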